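(* In the setting described in the context, let $S\subset\Omega$, $\Sigma\subset\widehat\Omega$ be a pair of measurable subsets with $0<\mu_{2m}(S)<\infty$ and $0<\widehat\mu_{2\widehat m}(\Sigma)<\infty$. Then any function $f\in L^2(\Omega,\mu)$ vanishes as soon as $f$ is supported in $S$ and $\mathcal T(f)$ is supported in $\Sigma$; that is, if $f=0$ $\mu$-a.e. on $\Omega\setminus S$ and $\mathcal T(f)=0$ $\widehat\mu$-a.e. on $\widehat\Omega\setminus\Sigma$, then $f=0$.
   Context: Let $\Omega,\widehat\Omega\subset\mathbb R^d$ be convex cones ($\lambda x$ stays in the cone for $x$ in the cone and $\lambda>0$) with non-empty interior, endowed with Borel measures $\mu,\widehat\mu$, absolutely continuous with respect to Lebesgue measure, with polar decompositions $d\mu(r\zeta)=r^{2a-1}\,dr\,Q(\zeta)\,d\sigma(\zeta)$ and $d\widehat\mu(r\zeta)=r^{2\widehat a-1}\,dr\,\widehat Q(\zeta)\,d\sigma(\zeta)$, where $\sigma$ is the surface measure on the unit sphere $\mathbb S^{d-1}$, $Q,\widehat Q\in L^1(\mathbb S^{d-1},d\sigma)$ are nonnegative and not identically zero, and $\widehat a=a>0$. Let $\mathcal K:\Omega\times\widehat\Omega\to\mathbb C$ be a kernel that is continuous, polynomially bounded: $|\mathcal K(x,\xi)|\le c_{\mathcal T}(1+|x|)^m(1+|\xi|)^{\widehat m}$ (with $m,\widehat m\ge0$), and homogeneous: $\mathcal K(\lambda x,\xi)=\mathcal K(x,\lambda\xi)$ for $\lambda>0$. Define the integral operator $$\mathcal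 T(f)(\xi)=\int_\Omega f(x)\mathcal K(x,\xi)\,d\mu(x),\qquad \xi\in\widehat\Omega,$$ on $\mathcal S(\Omega)$ (Schwartz functions on $\Omega$). For $\rho\ge0$ put $d\mu_\rho(x)=(1+|x|)^\rho d\mu(x)$, $d\widehat\mu_\rho(\xi)=(1+|\xi|)^\rho d\widehat\mu(\xi)$; the same integral defines $\mathcal T(f)$ for $f\in L^1(\Omega,\mu_m)$. Assume: (Inversion Formula) if $f\in L^1(\Omega,\mu_m)$ and $\mathcal T(f)\in L^1(\widehat\Omega,\widehat\mu_{\widehat m})$, then $f$ is (a.e. equal to) a continuous function with $\sup_x |f(x)|/(1+|x|)^m<\infty$ and $f(x)=\int_{\widehat\Omega}\mathcal T(f)(\xi)\overline{\mathcal K(x,\xi)}\,d\widehat\mu(\xi)$ for $x\in\Omega$; (Plancherel) $\|\mathcal T(f)\|_{L^2(\widehat\Omega,\widehat\mu)}=\|f\|_{L^2(\Omega,\mu)}$ for $f\in\mathcal S(\Omega)$, and $\mathcal T$ extends uniquely to a unitary operator from $L^2(\Omega,\mu)$ onto $L^2(\widehat\Omega,\widehat\mu)$, still denoted $\mathcal T$. *)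

(* Defs.v *)
From HB Require Import structures.
From mathcomp Require Import all_boot all_order all_algebra.
From mathcomp Require Import complex.
From mathcomp Require Import all_classical all_reals all_analysis.
From mathcomp Require Import measurable_realfun.

Set Implicit Arguments.
Unset Strict Implicit.
Unset Printing Implicit Defensive.

Import Order.TTheory GRing.Theory Num.Theory.
Import numFieldNormedType.Exports.

Local Open Scope classical_set_scope.
Local Open Scope ring_scope.

Lemma borel_setC (T : topologicalType) (A : set T) :
  <<s @open T >> A -> <<s @open T >> (~` A).
Proof. by move=> oA; rewrite -setTD; exact: sigma_algebraCD. Qed.

HB.instance Definition _ (R : realType) (d : nat) :=
  @isMeasurable.Build (sigma_display (@open 'rV[R]_d)) 'rV[R]_d
    <<s @open 'rV[R]_d >> (@sigma_algebra0 _ setT _) (@borel_setC _)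
    (@sigma_algebra_bigcup _ setT _).

Section euclidean_space.
Context {R : realType}.

(* The library norm `|x| on 'rV[R]_d is the sup norm. *)
Definition enorm d (x : 'rV[R]_d) : R := Num.sqrt (\sum_i x 0 i ^+ 2).

Definition usphere d : set 'rV[R]_d := [set x | enorm x = 1].

Lemma enorm_continuous d : continuous (@enorm d).
Proof.
move=> x; apply: (@continuous_comp _ _ _ (fun x : 'rV[R]_d => \sum_i x 0 i ^+ 2)).
  apply: (@continuous_big _ _ +%R 0 xpredT add_continuous _ (index_enum 'I_d)
    (fun i (y : 'rV[R]_d) => y 0 i ^+ 2)) => i _ y.
  apply: (@continuous_comp _ _ _ (fun y : 'rV[R]_d => y 0 i) (fun t => t ^+ 2)).
    exact: coord_continuous.
  exact: exprn_continuous.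
exact: sqrt_continuous.
Qed.

Lemma rV_continuous_measurable d (f : 'rV[R]_d -> R) :
  continuous f -> measurable_fun setT f.
Proof.
move=> /continuousP cf; apply: (measurability _ (RGenOInfty.measurableE R)).
move=> /= _ [_ [x ->] <-]; rewrite setTI; apply: sub_sigma_algebra.
exact/cf/interval_open.
Qed.

Lemma measurable_row d :
  measurable_fun setT (fun t : d.-tuple R => \row_i tnth t i : 'rV[R]_d).
Proof.
apply: (measurability (@open 'rV[R]_d)) => // _ [A oA <-]; rewrite setTI.
pose F n := if unpickle n is Some qk
  then let: (q, k) := (qk : 'rV[rat]_d * nat) in
    [set t : d.-tuple R | ball (map_mx ratr q : 'rV[R]_d) k.+1%:R^-1 `<=` A /\
       forall i, ball (ratr (q 0 i) : R) k.+1%:R^-1 (tnth t i)]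
  else set0.
rewrite (_ : _ @^-1` A = \bigcup_n F n).
  apply: bigcupT_measurable => n; rewrite /F.
  case: unpickle => [[q k]|]; last exact: measurable0.
  have [qA|qA] := pselect (ball (map_mx ratr q : 'rV[R]_d) k.+1%:R^-1 `<=` A); last first.
    rewrite (_ : mkset _ = set0); last by apply/seteqP; split => t // -[].
    exact: measurable0.
  rewrite (_ : mkset _ = \bigcap_(i in [set: 'I_d])
    ((@tnth _ R ^~ i) @^-1` ball (ratr (q 0 i) : R) k.+1%:R^-1)).
    apply: fin_bigcap_measurable => // i _.
    rewrite -[X in measurable X]setTI; apply: measurable_tnth => //.
    exact: measurable_ball.
  apply/seteqP; split => t /=; first by move=> [_ h] i _; exact: h.
  by move=> h; split => // i; exact: h.
apply/seteqP; split => [t At|t [n _]]; last first.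
  rewrite /F; case: unpickle => [[q k] /= [qA h]|//].
  apply: qA; split; first by rewrite invr_gt0.
  by move=> i j; rewrite ord1 !mxE; exact: h.
have /nbhs_ballP[e /= e0 eA] : nbhs (\row_i tnth t i : 'rV[R]_d) A.
  exact: open_nbhs_nbhs.
have [k ke] : exists k, k.+1%:R^-1 < e / 2 :> R.
  have e20 : 0 < e / 2 by rewrite divr_gt0.
  exists (Num.bound (e / 2)^-1); rewrite invf_plt ?posrE//.
  by rewrite (lt_trans (archi_boundP _)) ?ltr_nat// invr_ge0 ltW.
have k0 : 0 < k.+1%:R^-1 :> R by rewrite invr_gt0.
have /choice[q hq] : forall i, exists r : rat,
    `|tnth t i - ratr r| < k.+1%:R^-1.
  move=> i; have [r] := @rat_in_itvoo R (tnth t i - k.+1%:R^-1)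
    (tnth t i + k.+1%:R^-1) ltac:(by rewrite ltrD2l gt0_cp).
  rewrite in_itv/= => rt; exists r; rewrite distrC ltr_distl.
  exact: rt.
exists (pickle ((\row_i q i : 'rV[rat]_d), k)) => //.
rewrite /F pickleK /=; split; last first.
  by move=> i; rewrite mxE /ball /= distrC.
move=> y [_ hy]; apply: eA; split => // i j.
have := hy i j; rewrite !mxE /ball /= => hyj.
rewrite -(subrKA (ratr (q j))).
by rewrite (le_lt_trans (ler_normD _ _))// (splitr e) ltrD// (lt_trans _ ke).
Qed.

Lemma measurable_rV d d' (T : measurableType d') (f : T -> 'rV[R]_d) :
  (forall i, measurable_fun setT (fun x => f x 0 i)) -> measurable_fun setT f.
Proof.
move=> mf.
rewrite (_ : f = (fun t : d.-tuple R => \row_i tnth t i : 'rV[R]_d) \o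
                 (fun x => [tuple f x 0 i | i < d])).
  apply: measurableT_comp; first exact: measurable_row.
  apply/measurable_fun_tnthP => i.
  rewrite (_ : _ \o _ = fun x => f x 0 i) //.
  by apply/funext => x /=; rewrite tnth_mktuple.
by apply/funext => x /=; apply/rowP => i; rewrite mxE tnth_mktuple.
Qed.

End euclidean_space.

Section measure_image.
Context d1 d2 (T1 : measurableType d1) (T2 : measurableType d2) (R : realType).
Variables (m : {measure set T1 -> \bar R}) (f : T1 -> T2).

Definition measure_image (mf : measurable_fun setT f) : set T2 -> \bar R :=
  pushforward m f.

Hypothesis mf : measurable_fun setT f.

Let image0 : measure_image mf set0 = 0%E. Proof. exact: measure0. Qed.

Let image_ge0 A : (0 <= measure_image mf A)%E. Proof. exact: measure_ge0. Qed.

Let image_sigma_additive : semi_sigma_additive (measure_image mf).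
Proof. exact: measure_semi_sigma_additive. Qed.

HB.instance Definition _ := isMeasure.Build _ _ _ (measure_image mf)
  image0 image_ge0 image_sigma_additive.

End measure_image.

Section lebesgue_measure_Rd.
Context {R : realType}.

Definition tuple_cons n (x : R * n.-tuple R) : n.+1.-tuple R :=
  [tuple of x.1 :: x.2].

Lemma measurable_tuple_cons n : measurable_fun setT (@tuple_cons n).
Proof. exact: measurable_cons. Qed.

Section lebesgue_tuple_step.
Variables (n : nat) (m : {sigma_finite_measure set (n.-tuple R) -> \bar R}).

Definition lebesgue_tuple_step : set (n.+1.-tuple R) -> \bar R :=
  measure_image ((@lebesgue_measure R) \x m)%E (@measurable_tuple_cons n).

HB.instance Definition _ := Measure.on lebesgue_tuple_step.

Let lebesgue_tuple_step_sigma_finite : sigma_finite setT lebesgue_tuple_step.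
Proof.
have /sigma_finiteP[F [TF ndF Foo]] := sigma_finiteT (@lebesgue_measure R).
have /sigma_finiteP[G [TG ndG Goo]] := sigma_finiteT m.
pose uncons (t : n.+1.-tuple R) := (thead t, [tuple of behead t]).
have consK : cancel (@tuple_cons n) uncons.
  by move=> [x t]; rewrite /uncons theadE; congr pair; exact: val_inj.
have muncons : measurable_fun setT uncons.
  by apply: measurable_fun_pair; [exact: measurable_tnth|exact: measurable_behead].
exists (fun k => uncons @^-1` (F k `*` G k)).
  rewrite -preimage_bigcup; apply/esym/seteqP; split => // t _ /=.
  have [i _ Fi] : (\bigcup_i F i) (uncons t).1 by rewrite -TF.
  have [j _ Gj] : (\bigcup_j G j) (uncons t).2 by rewrite -TG.
  exists (maxn i j) => //; split.
    by move: Fi; exact/subsetPset/ndF/leq_maxl.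
  by move: Gj; exact/subsetPset/ndG/leq_maxr.
move=> k; have [mFk Fkoo] := Foo k; have [mGk Gkoo] := Goo k; split.
  rewrite -[X in measurable X]setTI; apply: muncons => //.
  exact: measurableX.
rewrite /lebesgue_tuple_step /measure_image /pushforward -comp_preimage.
rewrite (_ : uncons \o _ = id); last by apply/funext => x /=; rewrite consK.
rewrite preimage_id (_ : _ (F k `*` G k) = lebesgue_measure (F k) * m (G k))%E.
  by rewrite lte_mul_pinfty// ge0_fin_numE.
exact: (product_measure1E (@lebesgue_measure R) m).
Qed.

HB.instance Definition _ := Measure_isSigmaFinite.Build _ _ _
  lebesgue_tuple_step lebesgue_tuple_step_sigma_finite.

End lebesgue_tuple_step.

Fixpoint lebesgue_tuple n : {sigma_finite_measure set (n.-tuple R) -> \bar R} :=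
  match n with
  | 0 => \d_([tuple])
  | n'.+1 => lebesgue_tuple_step (lebesgue_tuple n')
  end.

Definition lebesgue_rV d : set 'rV[R]_d -> \bar R :=
  measure_image (lebesgue_tuple d) (@measurable_row R d).

HB.instance Definition _ d := Measure.on (@lebesgue_rV d).

Lemma measurable_enorm d : measurable_fun setT (@enorm R d).
Proof. by apply: rV_continuous_measurable; exact: enorm_continuous. Qed.

Definition normalize d (x : 'rV[R]_d) : 'rV[R]_d := (enorm x)^-1 *: x.

Lemma measurable_normalize d : measurable_fun setT (@normalize d).
Proof.
apply: measurable_rV => i; under eq_fun do rewrite mxE.
apply: measurable_funM; last first.
  by apply: rV_continuous_measurable; exact: coord_continuous.
under eq_fun do rewrite -powR_inv1 ?sqrtr_ge0//.
apply: (measurableT_comp (measurable_powR _)); exact: measurable_enorm.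
Qed.

Definition punctured_uball d : set 'rV[R]_d := [set x | 0 < enorm x <= 1].

Lemma measurable_punctured_uball d : measurable (@punctured_uball d).
Proof.
rewrite (_ : @punctured_uball d = @enorm R d @^-1` `]0, 1]).
  by rewrite -[X in measurable X]setTI; apply: measurable_enorm.
by apply/seteqP; split => x /=; rewrite in_itv.
Qed.

(* The surface measure of a part A of the unit sphere is d times the volume
   of the cone { r z | 0 < r <= 1, z in A }. It is seen here as a measure on
   R^d carried by the sphere. *)
Definition surface_measure d : set 'rV[R]_d -> \bar R :=
  mscale (d%:R%:nng : {nonneg R}) (measure_image
    (mrestr (@lebesgue_rV d) (@measurable_punctured_uball d))
    (@measurable_normalize d)).

HB.instance Definition _ d := Measure.on (@surface_measure d).

End lebesgue_measure_Rd.

Record convex_cone (R : realType) (d : nat) := ConvexCone {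
  cone_set : set 'rV[R]_d ;
  cone_convex : convex_set (cone_set : set (convex_lmodType 'rV[R]_d)) ;
  cone_scale : forall (lambda : R) (x : 'rV[R]_d),
    0 < lambda -> cone_set x -> cone_set (lambda *: x) ;
  cone_interior : cone_set^° !=set0 }.

(* The type of the points of a cone, with the subspace topology and the
   associated Borel sigma-algebra; the cone itself need not be a Borel set. *)
Definition cone_pt R d (C : convex_cone R d) : Type := set_type (cone_set C).

Coercion cone_pt : convex_cone >-> Sortclass.

Section cone_points.
Context {R : realType} {d : nat} (C : convex_cone R d).

Definition cone_val (x : C) : 'rV[R]_d := set_val x.

Lemma cone_point_subproof : exists x : C, True.
Proof.
have [x /interior_subset Cx] := cone_interior C.
by exists (SigSub (mem_set Cx)).
Qed.

HB.instance Definition _ := Topological.copy (cone_pt C) (set_type (cone_set C)).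
HB.instance Definition _ := isPointed.Build (cone_pt C)
  (projT1 (cid cone_point_subproof)).
HB.instance Definition _ :=
  @isMeasurable.Build (sigma_display (@open (cone_pt C))) (cone_pt C)
    <<s @open (cone_pt C) >> (@sigma_algebra0 _ setT _) (@borel_setC _)
    (@sigma_algebra_bigcup _ setT _).

End cone_points.

Section weighted_measure.
Context {R : realType} {d : nat} {C : convex_cone R d}.

Lemma cone_val_continuous : continuous (@cone_val R d C).
Proof. exact: initial_continuous. Qed.

Lemma cone_continuous_measurable (f : C -> R) :
  continuous f -> measurable_fun setT f.
Proof.
move=> /continuousP cf; apply: (measurability _ (RGenOInfty.measurableE R)).
move=> /= _ [_ [x ->] <-]; rewrite setTI; apply: sub_sigma_algebra.
exact/cf/interval_open.
Qed.

Variables (mu : {measure set C -> \bar R}) (rho : R).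

Definition weight (x : C) : R := (1 + enorm (cone_val x)) `^ rho.

Lemma measurable_weight : measurable_fun setT weight.
Proof.
apply: (measurableT_comp (measurable_powR rho)).
apply: measurable_funD; first exact: measurable_cst.
apply: cone_continuous_measurable => x.
apply: (@continuous_comp C 'rV[R]_d R (@cone_val R d C) (@enorm R d)).
  exact: cone_val_continuous.
exact: enorm_continuous.
Qed.

Definition weighted (A : set C) : \bar R := \int[mu]_(x in A) (weight x)%:E.

Let weighted0 : weighted set0 = 0%E. Proof. exact: integral_set0. Qed.

Let weighted_ge0 A : (0 <= weighted A)%E.
Proof. by apply: integral_ge0 => x _; rewrite lee_fin powR_ge0. Qed.

Let weighted_sigma_additive : semi_sigma_additive weighted.
Proof.
apply: semi_sigma_additive_nng_induced => [|x]; last by rewrite lee_fin powR_ge0.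
by apply/measurable_EFinP; exact: measurable_weight.
Qed.

HB.instance Definition _ := isMeasure.Build _ _ _ weighted
  weighted0 weighted_ge0 weighted_sigma_additive.

End weighted_measure.

Section measures_on_cones.
Context {R : realType} {d : nat} {C : convex_cone R d}.
Variable mu : {measure set C -> \bar R}.

Definition lebesgue_abs_continuous := forall A : set 'rV[R]_d,
  measurable A -> lebesgue_rV A = 0%E -> mu (@cone_val R d C @^-1` A) = 0%E.

(* d mu (r z) = r ^ (2 a - 1) dr Q(z) d sigma (z), with Q nonnegative,
   integrable on the sphere and not the zero element of L^1; the Borel subsets
   of the cone are the traces of the Borel subsets of R^d. *)
Definition polar_decomposition (a : R) (Q : 'rV[R]_d -> R) :=
  [/\ (@surface_measure R d).-integrable (@usphere R d) (EFin \o Q),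
      (forall z, usphere z -> 0 <= Q z),
      ~ {ae (@surface_measure R d), forall z, usphere z -> Q z = 0} &
      forall A : set 'rV[R]_d, measurable A ->
        mu (@cone_val R d C @^-1` A) =
        (\int[lebesgue_measure]_(r in `]0%R, +oo[)
           \int[@surface_measure R d]_(z in @usphere R d)
             (\1_A (r *: z) * r `^ (2 * a - 1) * Q z)%:E)%E].

End measures_on_cones.

Section complex_functions.
Context {R : realType} {disp : measure_display} {T : measurableType disp}.
Variable mu : {measure set T -> \bar R}.
Implicit Types f g : T -> R[i].

Definition cmeasurable f :=
  measurable_fun setT (fun x => complex.Re (f x)) /\
  measurable_fun setT (fun x => complex.Im (f x)).

Definition cintegral f : R[i] :=
  ((\int[mu]_x complex.Re (f x)) +i* (\int[mu]_x complex.Im (f x)))%C.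

Definition cLnorm (p : \bar R) f : \bar R :=
  Lnorm mu p (fun x => (Normc.normc (f x))%:E).

Definition cLfun (p : \bar R) f := cmeasurable f /\ (cLnorm p f < +oo)%E.

End complex_functions.

Section schwartz_functions.
Context {R : realType} {d : nat}.

Definition partial (i : 'I_d) (f : 'rV[R]_d -> R) : 'rV[R]_d -> R :=
  fun x => 'D_('e_i) f x.

Definition partials (s : seq 'I_d) (f : 'rV[R]_d -> R) : 'rV[R]_d -> R :=
  foldr partial f s.

Definition schwartz_real (f : 'rV[R]_d -> R) := forall s : seq 'I_d,
  [/\ continuous (partials s f),
      (forall i x, derivable (partials s f) x 'e_i) &
      forall k : nat, exists M : R, forall x,
        enorm x ^+ k * `|partials s f x| <= M].

(* The Schwartz functions on a cone are the restrictions to it of the complex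
   Schwartz functions on R^d. *)
Definition schwartz (C : convex_cone R d) (f : C -> R[i]) :=
  exists F : 'rV[R]_d -> R[i],
    [/\ schwartz_real (fun x => complex.Re (F x)),
        schwartz_real (fun x => complex.Im (F x)) &
        forall x : C, f x = F (cone_val x)].

End schwartz_functions.

Section integral_operator.
Context {R : realType} {d : nat} {Omega Omegah : convex_cone R d}.
Variables (mu : {measure set Omega -> \bar R}).
Variables (muh : {measure set Omegah -> \bar R}).
Variable K : Omega -> Omegah -> R[i].

Definition kernel_continuous :=
  continuous (fun p : Omega * Omegah => K p.1 p.2 : R[i]^o).

Definition kernel_bounded (c m mh : R) := forall x xi,
  Normc.normc (K x xi) <=
    c * (1 + enorm (cone_val x)) `^ m * (1 + enorm (cone_val xi)) `^ mh.

Definition kernel_homogeneous :=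
  forall (lambda : R) (x x' : Omega) (xi xi' : Omegah), 0 < lambda ->
    cone_val x' = lambda *: cone_val x ->
    cone_val xi' = lambda *: cone_val xi ->
    K x' xi = K x xi'.

Definition integral_operator (f : Omega -> R[i]) : Omegah -> R[i] :=
  fun xi => cintegral mu (fun x => f x * K x xi).

Definition inversion_formula (m mh : R) := forall f : Omega -> R[i],
  cLfun (weighted mu m) 1%:E f ->
  cLfun (weighted muh mh) 1%:E (integral_operator f) ->
  exists g : Omega -> R[i],
    [/\ {ae mu, forall x, f x = g x},
        continuous (g : Omega -> R[i]^o),
        (exists M : R, forall x,
          Normc.normc (g x) / (1 + enorm (cone_val x)) `^ m <= M) &
        forall x, g x =
          cintegral muh (fun xi => integral_operator f xi * (K x xi)^*%C)].

Definition plancherel := forall f : Omega -> R[i], schwartz f ->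
  cLnorm muh 2%:E (integral_operator f) = cLnorm mu 2%:E f.

(* U, acting on representatives, induces a unitary operator from
   L^2(Omega, mu) onto L^2(Omegah, muh) that extends the integral operator
   on Schwartz functions. *)
Record unitary_extension (U : (Omega -> R[i]) -> (Omegah -> R[i])) : Prop := {
  ue_Lfun : forall f, cLfun mu 2%:E f -> cLfun muh 2%:E (U f) ;
  ue_ae_eq : forall f g, cLfun mu 2%:E f -> cLfun mu 2%:E g ->
    {ae mu, forall x, f x = g x} -> {ae muh, forall xi, U f xi = U g xi} ;
  ue_linear : forall (c : R[i]) f g, cLfun mu 2%:E f -> cLfun mu 2%:E g ->
    {ae muh, forall xi, U (fun x => c * f x + g x) xi = c * U f xi + U g xi} ;
  ue_isometry : forall f, cLfun mu 2%:E f ->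
    cLnorm muh 2%:E (U f) = cLnorm mu 2%:E f ;
  ue_onto : forall h, cLfun muh 2%:E h -> exists f,
    cLfun mu 2%:E f /\ {ae muh, forall xi, U f xi = h xi} ;
  ue_extends : forall f, schwartz f ->
    {ae muh, forall xi, U f xi = integral_operator f xi} }.

Definition unique_unitary_extension (U : (Omega -> R[i]) -> (Omegah -> R[i])) :=
  unitary_extension U /\
  forall V, unitary_extension V -> forall f, cLfun mu 2%:E f ->
    {ae muh, forall xi, V f xi = U f xi}.

End integral_operator.

(* Main.v *)
(** Testing against the functions exp (- q), with q a
polynomial bounded below by |x|^2, determines a function almost everywhere, so T
is given by its kernel on L^2 functions integrable against the growth of the
kernel, and so is its inverse. Suppose now that f is supported in S and q = T f in
Sigma, and choose representatives given by the kernel: the sets U and V where they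
do not vanish are then radially open. Dilations by l < 1 satisfy
mu (U / l) = l^(- 2 a) mu (U) and are intertwined by T, the kernel being
homogeneous. If q is not zero, the dilates q (l^j .), j < N, are linearly
independent, since a dependence relation would produce a set of finite nonzero
measure absorbing its own dilates. As l tends to 1, the sets carrying these N
dilates and their preimages have weights at most those of V and U plus 1. But the
Hilbert-Schmidt norm of the kernel restricted to these sets bounds N by a constant. *)

(* The exponents 2m and 2mh are those of |K|^2, which is at most cT^2 (1+|x|)^(2m) (1+|xi|)^(2mh):
   its integral over a product of two sets is controlled by the product of their weights. Dilating
   supports known only up to null sets says nothing about single points. The kernel formulas give
   representatives continuous along rays, so each point of the set where one is nonzero stays in
   that set under dilations of ratio close to 1; dominated convergence then makes the weight of a
   dilate outside the set tend to 0. The enlarged weights are bounded independently of N, so N is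
   fixed first, beyond the Hilbert-Schmidt bound, and the ratio l only afterwards. Inner products
   are real parts of Hermitian ones: independence over the reals suffices, and the price is a factor
   2, because the real and imaginary parts of a function are estimated separately. No orthonormal
   basis is extracted: the preimages of the dilates have the same Gram matrix as the dilates, and
   Bessel's inequality, written with its inverse, is integrated over x. *)
Require Import Defs.
From HB Require Import structures.
From mathcomp Require Import all_boot all_order all_algebra.
From mathcomp Require Import complex.
From mathcomp Require Import all_classical all_reals all_analysis.
From mathcomp Require Import measurable_realfun ring lra.

Import Order.TTheory GRing.Theory Num.Theory.
Import numFieldNormedType.Exports.

Set Implicit Arguments.
Unset Strict Implicit.
Unset Printing Implicit Defensive.

Local Open Scope classical_set_scope.
Local Open Scope ring_scope.

(** * Real-valued integrable functions *)

Section real_integrals.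
Context {disp : measure_display} {T : measurableType disp} {R : realType}.
Variable mu : {measure set T -> \bar R}.
Implicit Types f g : T -> R.

Definition rint f := mu.-integrable [set: T] (EFin \o f).

Lemma rint_measurable f : rint f -> measurable_fun setT f.
Proof. by move=> /(measurable_int mu) /measurable_EFinP. Qed.

Lemma rint_dom f g : measurable_fun setT f -> rint g ->
  (forall x, `|f x| <= g x) -> rint f.
Proof.
move=> mf ig fg; apply: (le_integrable _ _ _ ig) => //; first exact/measurable_EFinP.
by move=> x _ /=; rewrite lee_fin (le_trans (fg x))// ler_norm.
Qed.

Lemma rintD f g : rint f -> rint g -> rint (fun x => f x + g x).
Proof. by move=> hf hg; apply: (integrableD measurableT hf hg). Qed.

Lemma rintZ c f : rint f -> rint (fun x => c * f x).
Proof. by move=> hf; apply: (integrableZl measurableT c hf). Qed.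

Lemma rint0 : rint (fun=> 0).
Proof. exact: integrable0. Qed.

Lemma rint_sum I (s : seq I) (F : I -> T -> R) : (forall i, rint (F i)) ->
  rint (fun x => \sum_(i <- s) F i x).
Proof.
move=> h; elim: s => [|i s ih].
  by under eq_fun do rewrite big_nil; exact: rint0.
by under eq_fun do rewrite big_cons; exact: rintD.
Qed.

Lemma Rintegral_sum I (s : seq I) (F : I -> T -> R) : (forall i, rint (F i)) ->
  \int[mu]_x (\sum_(i <- s) F i x) = \sum_(i <- s) \int[mu]_x F i x.
Proof.
move=> h; elim: s => [|i s ih].
  rewrite big_nil; under eq_Rintegral do rewrite big_nil.
  by rewrite Rintegral_cst// mul0r.
rewrite big_cons -ih -RintegralD//; [|exact: h|exact: rint_sum].
by apply: eq_Rintegral => x _; rewrite big_cons.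
Qed.

Lemma rint_abs f : rint f -> rint (fun x => `|f x|).
Proof. exact: integrable_norm. Qed.

Lemma eq_ae_Rintegral f g : measurable_fun setT f -> measurable_fun setT g ->
  {ae mu, forall x, f x = g x} -> \int[mu]_x f x = \int[mu]_x g x.
Proof.
move=> mf mg fg; congr fine; apply: ae_eq_integral => //.
- exact/measurable_EFinP.
- exact/measurable_EFinP.
- by apply: filterS fg => x -> _.
Qed.

Lemma ae_rint f g : measurable_fun setT f ->
  {ae mu, forall x, g x = f x} -> rint g -> rint f.
Proof.
move=> mf fg ig; apply/integrableP; split; first exact/measurable_EFinP.
move/integrableP : (ig) => [mg]; apply: le_lt_trans.
rewrite le_eqVlt; apply/orP; left; apply/eqP.
apply: ae_eq_integral => //.
- by apply: measurableT_comp => //; exact/measurable_EFinP.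
- exact: measurableT_comp.
- by apply: filterS fg => x /= -> _.
Qed.

Lemma ge0_rintP f : measurable_fun setT f -> (forall x, 0 <= f x) ->
  rint f <-> (\int[mu]_x (f x)%:E < +oo)%E.
Proof.
move=> mf f0; have e : (\int[mu]_x `|(EFin \o f) x| = \int[mu]_x (f x)%:E)%E.
  by apply: eq_integral => x _ /=; rewrite ger0_norm.
split=> [/integrableP[_]|h]; first by rewrite e.
by apply/integrableP; split; [exact/measurable_EFinP|rewrite e].
Qed.

Lemma Rintegral_eq0 f : rint f -> (forall x, 0 <= f x) ->
  \int[mu]_x f x = 0 -> {ae mu, forall x, f x = 0}.
Proof.
move=> intf f0 h; have mf := rint_measurable intf.
have : (\int[mu]_x `|(EFin \o f) x| = 0)%E.
  have e : (\int[mu]_x `|(EFin \o f) x| = \int[mu]_x (f x)%:E)%E.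
    by apply: eq_integral => x _ /=; rewrite ger0_norm.
  rewrite e -[LHS]fineK; first by congr EFin.
  exact: integrable_fin_num.
have mEf : measurable_fun setT (EFin \o f) by exact/measurable_EFinP.
move/(ae_eq_integral_abs mu measurableT mEf).
by apply: filterS => x /(_ I) [].
Qed.

Lemma rint_indic (A : set T) f : measurable A -> rint f ->
  rint (fun x => f x * \1_A x).
Proof.
move=> mA intf; apply: (rint_dom _ (rint_abs intf)).
  by apply: measurable_funM; [exact: rint_measurable|exact: measurable_indic].
move=> x; rewrite normrM ler_piMr//.
by rewrite indicE; case: (_ \in _); rewrite ?normr1// normr0.
Qed.

End real_integrals.

(** * The real scalar product on the complex plane *)

Section complex_dot.
Context {R : realType}.
Implicit Types z w : R[i].

(** The real part of z times the conjugate of w. Staying with real scalars keeps integrals and Gram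
    matrices real. *)
Definition cdot z w : R := complex.Re z * complex.Re w + complex.Im z * complex.Im w.

Lemma cdotC z w : cdot z w = cdot w z.
Proof. by rewrite /cdot mulrC [X in _ + X]mulrC. Qed.

Lemma cdot0l w : cdot 0 w = 0. Proof. by rewrite /cdot /= !mul0r addr0. Qed.

Lemma cdotDl z z' w : cdot (z + z') w = cdot z w + cdot z' w.
Proof. by case: z z' w => [a b] [a' b'] [c d]; rewrite /cdot /=; ring. Qed.

Lemma cdotZl (c : R) z w : cdot (c%:C%C * z) w = c * cdot z w.
Proof. by case: z w => [a b] [a' b']; rewrite /cdot /=; ring. Qed.

Lemma cdotZr (c : R) z w : cdot w (c%:C%C * z) = c * cdot w z.
Proof. by rewrite cdotC cdotZl cdotC. Qed.

Lemma cdotNl z w : cdot (- z) w = - cdot z w.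
Proof. by case: z w => [a b] [a' b']; rewrite /cdot /=; ring. Qed.

(** Multiplication by [w] has multiplication by the conjugate of [w] as its adjoint; the conjugate
    kernel of the inverse transform comes from here. *)
Lemma cdotMl z w k : cdot (z * w) k = cdot z (k * w^*%C).
Proof. by case: z w k => [a b] [c d] [e f]; rewrite /cdot /=; ring. Qed.

Lemma cdot_ge0 z : 0 <= cdot z z.
Proof. by rewrite /cdot -!expr2 addr_ge0// sqr_ge0. Qed.

Lemma sqr_normc z : Normc.normc z ^+ 2 = cdot z z.
Proof.
by case: z => [a b]; rewrite /cdot /= sqr_sqrtr ?addr_ge0 ?sqr_ge0// !expr2.
Qed.

Lemma normc_ge0 z : 0 <= Normc.normc z.
Proof. by case: z => [a b] /=; rewrite sqrtr_ge0. Qed.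

Lemma cdot_eq0 z : cdot z z = 0 -> z = 0.
Proof.
by rewrite -sqr_normc => /eqP; rewrite sqrf_eq0 => /eqP /Normc.eq0_normc.
Qed.

Lemma cdot_normc z w : `|cdot z w| <= Normc.normc z * Normc.normc w.
Proof.
have h : 0 <= Normc.normc z * Normc.normc w by rewrite mulr_ge0// normc_ge0.
rewrite -(ler_sqr (normr_ge0 _))// ?nnegrE// real_normK ?num_real//.
rewrite exprMn !sqr_normc.
case: z w {h} => [a b] [c d]; rewrite /cdot /=.
(* Lagrange's identity: the two sides of the squared inequality differ by (a d - b c)^2. *)
have := sqr_ge0 (a * d - b * c); nra.
Qed.

Lemma cdot_le z w : `|cdot z w| <= cdot z z + cdot w w.
Proof.
apply: (le_trans (cdot_normc _ _)); rewrite -!sqr_normc.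
have := normc_ge0 z; have := normc_ge0 w.
move: (Normc.normc z) (Normc.normc w) => x y; nra.
Qed.

Lemma cdotDD z w : cdot (z + w) (z + w) <= 2 * (cdot z z + cdot w w).
Proof.
case: z w => [a b] [c d]; rewrite /cdot /=.
have := sqr_ge0 (a - c); have := sqr_ge0 (b - d); nra.
Qed.

Lemma Re_le_normc z : `|complex.Re z| <= Normc.normc z.
Proof.
case: z => a b /=; rewrite -sqrtr_sqr ler_wsqrtr// lerDl; exact: sqr_ge0.
Qed.

Lemma Im_le_normc z : `|complex.Im z| <= Normc.normc z.
Proof.
case: z => a b /=; rewrite -sqrtr_sqr ler_wsqrtr// lerDr; exact: sqr_ge0.
Qed.

Lemma normc_le_ReIm z : Normc.normc z <= `|complex.Re z| + `|complex.Im z|.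
Proof.
rewrite -(ler_sqr (normc_ge0 z)) ?nnegrE ?addr_ge0// sqr_normc /cdot -!expr2.
rewrite sqrrD !real_normK ?num_real//.
have := mulr_ge0 (normr_ge0 (complex.Re z)) (normr_ge0 (complex.Im z)).
by move=> h; rewrite addrAC lerDl mulrn_wge0.
Qed.

Lemma normc_conj z : Normc.normc z^*%C = Normc.normc z.
Proof. by case: z => a b /=; rewrite sqrrN. Qed.

Lemma Normc_real (x : R) : Normc.normc x%:C%C = `|x|.
Proof. by rewrite /= expr0n/= addr0 sqrtr_sqr. Qed.

Lemma complexP z w : complex.Re z = complex.Re w -> complex.Im z = complex.Im w -> z = w.
Proof. by case: z w => [a b] [c d] /= -> ->. Qed.

Lemma ReE_cdot z : complex.Re z = cdot z 1.
Proof. by rewrite /cdot /= mulr1 mulr0 addr0. Qed.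

Lemma ImE_cdot z : complex.Im z = cdot z 'i%C.
Proof. by rewrite /cdot /= mulr1 mulr0 add0r. Qed.

End complex_dot.

(** * Square-integrable complex functions *)

Section square_integrable.
Context {disp : measure_display} {T : measurableType disp} {R : realType}.
Variable mu : {measure set T -> \bar R}.
Implicit Types f g h : T -> R[i].

Lemma cmeasurable_real (r : T -> R) :
  measurable_fun setT r -> cmeasurable (fun x => (r x)%:C%C).
Proof. by move=> mr; split => //=; exact: measurable_cst. Qed.

Lemma cmeasurable0 : @cmeasurable R disp T (fun=> 0).
Proof. by split; exact: measurable_cst. Qed.

Lemma cmeasurableD f g : cmeasurable f -> cmeasurable g ->
  cmeasurable (fun x => f x + g x).
Proof.
move=> [rf jf] [rg jg]; split.
- rewrite (_ : (fun _ => _) = (fun x => complex.Re (f x) + complex.Re (g x))).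
    exact: measurable_funD.
  by apply/funext => x; case: (f x) (g x) => [? ?] [].
- rewrite (_ : (fun _ => _) = (fun x => complex.Im (f x) + complex.Im (g x))).
    exact: measurable_funD.
  by apply/funext => x; case: (f x) (g x) => [? ?] [].
Qed.

Lemma cmeasurableM f g : cmeasurable f -> cmeasurable g ->
  cmeasurable (fun x => f x * g x).
Proof.
move=> [rf jf] [rg jg]; split.
- rewrite (_ : (fun _ => _) = (fun x => complex.Re (f x) * complex.Re (g x) -
     complex.Im (f x) * complex.Im (g x))).
    by apply: measurable_funB; exact: measurable_funM.
  by apply/funext => x; case: (f x) (g x) => [? ?] [].
- rewrite (_ : (fun _ => _) = (fun x => complex.Re (f x) * complex.Im (g x) +
     complex.Im (f x) * complex.Re (g x))).
    by apply: measurable_funD; exact: measurable_funM.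
  by apply/funext => x; case: (f x) (g x) => [? ?] [].
Qed.

Lemma cmeasurable_conj f : cmeasurable f -> cmeasurable (fun x => (f x)^*%C).
Proof.
move=> [rf jf]; split.
- rewrite (_ : (fun _ => _) = (fun x => complex.Re (f x)))//.
  by apply/funext => x; case: (f x).
- rewrite (_ : (fun _ => _) = (fun x => - complex.Im (f x))).
    exact: measurableT_comp.
  by apply/funext => x; case: (f x).
Qed.

Lemma cmeasurableZ (c : R) f : cmeasurable f ->
  cmeasurable (fun x => c%:C%C * f x).
Proof.
by move=> mf; apply: cmeasurableM => //; apply: cmeasurable_real; exact: measurable_cst.
Qed.

Lemma measurable_cdot f g : cmeasurable f -> cmeasurable g ->
  measurable_fun setT (fun x => cdot (f x) (g x)).
Proof. by move=> [? ?] [? ?]; apply: measurable_funD; exact: measurable_funM. Qed.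

Lemma measurable_normc f : cmeasurable f ->
  measurable_fun setT (fun x => Normc.normc (f x)).
Proof.
move=> mf; rewrite (_ : (fun _ => _) = (fun x => Num.sqrt (cdot (f x) (f x)))).
  apply: (measurableT_comp (continuous_measurable_fun (@sqrt_continuous R))) => //.
  exact: measurable_cdot.
by apply/funext => x; rewrite -sqr_normc sqrtr_sqr ger0_norm// normc_ge0.
Qed.

(** Membership in L^2 expressed through the integrability of |f|^2; [cLfun2P] identifies it with
    [cLfun] at exponent 2. *)
Definition sqint f := cmeasurable f /\ rint mu (fun x => cdot (f x) (f x)).

Definition rip f g : R := \int[mu]_x cdot (f x) (g x).

Lemma sqint_cdot f g : sqint f -> sqint g -> rint mu (fun x => cdot (f x) (g x)).
Proof.
move=> [mf jf] [mg jg]; apply: (rint_dom _ (rintD jf jg)).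
  exact: measurable_cdot.
by move=> x; exact: cdot_le.
Qed.

Lemma sqint0 : sqint (fun=> 0).
Proof.
split; first exact: cmeasurable0.
by under eq_fun do rewrite cdot0l; exact: rint0.
Qed.

Lemma sqintD f g : sqint f -> sqint g -> sqint (fun x => f x + g x).
Proof.
move=> [mf jf] [mg jg]; split; first exact: cmeasurableD.
apply: (rint_dom _ (rintZ 2 (rintD jf jg))).
  by apply: measurable_cdot; exact: cmeasurableD.
by move=> x; rewrite ger0_norm ?cdot_ge0// cdotDD.
Qed.

Lemma sqintZ (c : R) f : sqint f -> sqint (fun x => c%:C%C * f x).
Proof.
move=> [mf jf]; split; first exact: cmeasurableZ.
under eq_fun do rewrite cdotZl cdotZr.
exact/rintZ/rintZ.
Qed.

Lemma sqintN f : sqint f -> sqint (fun x => - f x).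
Proof.
move=> /(sqintZ (-1)); congr sqint; apply/funext => x.
by case: (f x) => a b; apply: complexP => /=; ring.
Qed.

Lemma sqint_sum I (s : seq I) (c : I -> R) (F : I -> T -> R[i]) :
  (forall i, sqint (F i)) -> sqint (fun x => \sum_(i <- s) (c i)%:C%C * F i x).
Proof.
move=> h; elim: s => [|i s ih].
  by under eq_fun do rewrite big_nil; exact: sqint0.
by under eq_fun do rewrite big_cons; apply: sqintD => //; exact: sqintZ.
Qed.

Lemma ripC f g : rip f g = rip g f.
Proof. by apply: eq_Rintegral => x _; rewrite cdotC. Qed.

Lemma ripDl f g h : sqint f -> sqint g -> sqint h ->
  rip (fun x => f x + g x) h = rip f h + rip g h.
Proof.
move=> sf sg sh; rewrite /rip -RintegralD//; [|exact: sqint_cdot..].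
by apply: eq_Rintegral => x _; rewrite cdotDl.
Qed.

Lemma ripDr f g h : sqint f -> sqint g -> sqint h ->
  rip h (fun x => f x + g x) = rip h f + rip h g.
Proof. by move=> *; rewrite ripC ripDl// ![rip h _]ripC. Qed.

Lemma ripZl (c : R) f h : sqint f -> sqint h ->
  rip (fun x => c%:C%C * f x) h = c * rip f h.
Proof.
move=> sf sh; rewrite /rip -RintegralZl//; last exact: sqint_cdot.
by apply: eq_Rintegral => x _; rewrite cdotZl.
Qed.

Lemma rip_suml I (s : seq I) (c : I -> R) (F : I -> T -> R[i]) h :
  (forall i, sqint (F i)) -> sqint h ->
  rip (fun x => \sum_(i <- s) (c i)%:C%C * F i x) h = \sum_(i <- s) c i * rip (F i) h.
Proof.
move=> hF hh; elim: s => [|i s ih].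
  rewrite big_nil /rip; under eq_Rintegral do rewrite big_nil cdot0l.
  by rewrite Rintegral_cst// mul0r.
rewrite big_cons -ih -ripZl// -ripDl//; [|exact: sqintZ|exact: sqint_sum].
by apply: eq_Rintegral => x _; rewrite big_cons.
Qed.

Lemma rip_ae f f' g g' : cmeasurable f -> cmeasurable f' -> cmeasurable g ->
  cmeasurable g' -> {ae mu, forall x, f x = f' x} -> {ae mu, forall x, g x = g' x} ->
  rip f g = rip f' g'.
Proof.
move=> mf mf' mg mg' ff gg; apply: eq_ae_Rintegral; [exact: measurable_cdot..|].
by apply: filterS2 ff gg => x -> ->.
Qed.

Lemma rip_eq0 f : sqint f -> rip f f = 0 -> {ae mu, forall x, f x = 0}.
Proof.
move=> [mf jf] /Rintegral_eq0 -/(_ jf (fun x => cdot_ge0 _)).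
by apply: filterS => x /cdot_eq0.
Qed.

Lemma rip_ge0 f : 0 <= rip f f.
Proof. by apply: Rintegral_ge0 => x _; exact: cdot_ge0. Qed.

Lemma cLnorm2E f : (cLnorm mu 2%:E f `^ 2 = \int[mu]_x (cdot (f x) (f x))%:E)%E.
Proof.
rewrite /cLnorm poweR_Lnorm//; apply: eq_integral => x _.
rewrite /= ger0_norm ?normc_ge0// powR_mulrn ?normc_ge0//.
by rewrite sqr_normc.
Qed.

Lemma cLfun2P f : cLfun mu 2%:E f <-> sqint f.
Proof.
have e mf := ge0_rintP mu (measurable_cdot mf mf) (fun x => cdot_ge0 (f x)).
split=> -[mf h]; split => //.
- by apply/(e mf); rewrite -cLnorm2E; exact: poweR_lty.
- move/(e mf) : h; rewrite -cLnorm2E.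
  apply: contraTT; rewrite -!leNgt !leye_eq => /eqP ->.
  by rewrite poweRyr.
Qed.

Lemma cLnorm2_rip f : rip f f = fine (cLnorm mu 2%:E f `^ 2).
Proof. by rewrite cLnorm2E. Qed.

End square_integrable.

(** * Integral operators whose kernel has product growth *)

Section kernel_operator_def.
Context {disp : measure_display} {X : measurableType disp} {R : realType}.
Variable mu : {measure set X -> \bar R}.

(** When |K x y| is at most [w1 x * w2 y], this condition for the weight [w1] makes the kernel
    integral of [f] converge absolutely at every [y]. *)
Definition wint (w : X -> R) (f : X -> R[i]) :=
  cmeasurable f /\ rint mu (fun x => Normc.normc (f x) * w x).

(** The integral of [integral_operator], over arbitrary spaces so that the conjugate transposed
    kernel is covered as well. *)
Definition kop (Y : Type) (K : X -> Y -> R[i]) (f : X -> R[i]) (y : Y) : R[i] :=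
  cintegral mu (fun x => f x * K x y).

End kernel_operator_def.

Section kernel_operators.
Context {d1 d2 : measure_display} {X : measurableType d1} {Y : measurableType d2}
  {R : realType}.
Variable mu : {sigma_finite_measure set X -> \bar R}.

(** No integrability is assumed: Tonelli handles the positive and the negative part separately, and
    [fine], which sends infinite values to a default, is measurable. *)
Lemma measurable_Rintegral (h : X * Y -> R) : measurable_fun setT h ->
  measurable_fun setT (fun y => \int[mu]_x h (x, y)).
Proof.
move=> mh; apply/measurable_EFinP.
have mE : measurable_fun setT (EFin \o h) by exact/measurable_EFinP.
have key : measurable_fun setT (fun y => \int[mu]_x (h (x, y))%:E)%E.
  under eq_fun do rewrite integralE.
  apply: emeasurable_funB.
  - rewrite (_ : (fun _ => _) = fubini_G mu (EFin \o h)^\+%E).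
      apply: measurable_fun_fubini_tonelli_G => //; exact: measurable_funepos.
    by apply/funext => y; apply: eq_integral => x _; rewrite !funeposE.
  - rewrite (_ : (fun _ => _) = fubini_G mu (EFin \o h)^\-%E).
      apply: measurable_fun_fubini_tonelli_G => //; exact: measurable_funeneg.
    by apply/funext => y; apply: eq_integral => x _; rewrite !funenegE.
apply/measurable_EFinP.
exact: measurableT_comp (fine_measurable measurableT) key.
Qed.

Variables (K : X -> Y -> R[i]) (w1 : X -> R) (w2 : Y -> R).
Hypothesis mK : cmeasurable (fun p : X * Y => K p.1 p.2).
Hypotheses (w1_ge0 : forall x, 0 <= w1 x) (w2_ge0 : forall y, 0 <= w2 y).
Hypothesis Kw : forall x y, Normc.normc (K x y) <= w1 x * w2 y.

Lemma cmeasurable_fst (f : X -> R[i]) : cmeasurable f ->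
  cmeasurable (fun p : X * Y => f p.1).
Proof.
by move=> [rf jf]; split;
  [exact: (measurableT_comp rf measurable_fst)|
   exact: (measurableT_comp jf measurable_fst)].
Qed.

Lemma cmeasurable_section y : cmeasurable (fun x => K x y).
Proof.
move: mK => [rK jK]; split.
- exact: (measurableT_comp rK (measurable_pair2 y)).
- exact: (measurableT_comp jK (measurable_pair2 y)).
Qed.

Lemma kop_cmeasurable f : cmeasurable f -> cmeasurable (kop mu K f).
Proof.
move=> mf; have [rfK jfK] := cmeasurableM (cmeasurable_fst mf) mK.
by split; [exact: (measurable_Rintegral rfK)|exact: (measurable_Rintegral jfK)].
Qed.

Lemma wint_normcM f y : wint mu w1 f -> rint mu (fun x => Normc.normc (f x * K x y)).
Proof.
move=> [mf jf]; apply: (rint_dom _ (rintZ (w2 y) jf)).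
  by apply: measurable_normc; apply: cmeasurableM => //; exact: cmeasurable_section.
move=> x; rewrite ger0_norm ?normc_ge0// Normc.normcM mulrCA.
by rewrite ler_wpM2l ?normc_ge0// mulrC.
Qed.

Lemma wint_Re f y : wint mu w1 f -> rint mu (fun x => complex.Re (f x * K x y)).
Proof.
move=> hf; apply: (rint_dom _ (wint_normcM y hf)).
  by have [] := cmeasurableM (proj1 hf) (cmeasurable_section y).
by move=> x; exact: Re_le_normc.
Qed.

Lemma wint_Im f y : wint mu w1 f -> rint mu (fun x => complex.Im (f x * K x y)).
Proof.
move=> hf; apply: (rint_dom _ (wint_normcM y hf)).
  by have [] := cmeasurableM (proj1 hf) (cmeasurable_section y).
by move=> x; exact: Im_le_normc.
Qed.

Lemma cdot_cintegral (h : X -> R[i]) z : rint mu (fun x => complex.Re (h x)) ->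
  rint mu (fun x => complex.Im (h x)) ->
  cdot (cintegral mu h) z = \int[mu]_x cdot (h x) z.
Proof.
move=> rh jh; rewrite /cdot /cintegral /= -!RintegralZr//.
rewrite -RintegralD//.
- by have := rintZ (complex.Re z) rh; under eq_fun do rewrite mulrC.
- by have := rintZ (complex.Im z) jh; under eq_fun do rewrite mulrC.
Qed.

Lemma kop_cdot f y z : wint mu w1 f ->
  cdot (kop mu K f y) z = \int[mu]_x cdot (f x) (z * (K x y)^*%C).
Proof.
move=> hf; rewrite cdot_cintegral; [|exact: wint_Re|exact: wint_Im].
by apply: eq_Rintegral => x _; rewrite cdotMl.
Qed.

Lemma kop_bound f : wint mu w1 f -> exists2 M, 0 <= M &
  forall y, Normc.normc (kop mu K f y) <= M * w2 y.
Proof.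
move=> hf; have [_ If] := hf.
have I0 : 0 <= \int[mu]_x (Normc.normc (f x) * w1 x).
  by apply: Rintegral_ge0 => x _; rewrite mulr_ge0// normc_ge0.
(* The factor 2 pays for bounding the real and the imaginary part separately. *)
exists (2 * \int[mu]_x (Normc.normc (f x) * w1 x)); first by rewrite mulr_ge0.
move=> y; have B : forall h : X -> R, rint mu h ->
    (forall x, `|h x| <= Normc.normc (f x * K x y)) ->
    `|\int[mu]_x h x| <= \int[mu]_x (Normc.normc (f x) * w1 x) * w2 y.
  move=> h ih hle; apply: (le_trans (le_normr_Rintegral measurableT ih)).
  rewrite -RintegralZr//; apply: le_Rintegral => //.
  - exact: rint_abs.
  - by have := rintZ (w2 y) If; under eq_fun do rewrite mulrC.
  - move=> x _; apply: (le_trans (hle x)); rewrite Normc.normcM -mulrA.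
    by rewrite ler_wpM2l ?normc_ge0.
apply: (le_trans (normc_le_ReIm _)); rewrite -mulrA mulr_natl mulr2n.
apply: lerD; apply: B.
- exact: wint_Re.
- by move=> x; exact: Re_le_normc.
- exact: wint_Im.
- by move=> x; exact: Im_le_normc.
Qed.

End kernel_operators.

(** * Fubini and the adjoint operator *)

Section fubini_adjoint.
Context {d1 d2 : measure_display} {X : measurableType d1} {Y : measurableType d2}
  {R : realType}.
Variables (mu : {sigma_finite_measure set X -> \bar R})
  (nu : {sigma_finite_measure set Y -> \bar R}).

(** A majorant that splits as u(x) v(y) has a finite iterated integral, which Tonelli turns into
    integrability on the product. *)
Lemma rint_prod (F : X * Y -> R) (u : X -> R) (v : Y -> R) :
  measurable_fun setT F -> rint mu u -> rint nu v ->
  (forall x y, `|F (x, y)| <= u x * v y) -> rint (mu \x nu)%E F.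
Proof.
move=> mF iu iv Fuv; have mE : measurable_fun setT (EFin \o F) by exact/measurable_EFinP.
apply/integrable12ltyP => //.
have au := rint_abs iu; have av := rint_abs iv.
apply: (@le_lt_trans _ _ (\int[mu]_x ((`|u x|)%:E * (\int[nu]_y `|v y|)%:E))%E).
  apply: ge0_le_integral => //.
  - by move=> x _; apply: integral_ge0 => y _; rewrite lee_fin.
  - change (measurable_fun setT (fubini_F nu (abse \o (EFin \o F)))).
    apply: measurable_fun_fubini_tonelli_F => [|p]; last exact: abse_ge0.
    exact: measurableT_comp.
  - apply: emeasurable_funM => //; apply/measurable_EFinP; exact: rint_measurable au.
  - move=> x _; rewrite /Rintegral fineK; last exact: integrable_fin_num.
    rewrite -integralZl//; apply: ge0_le_integral => //.
    + by apply: measurableT_comp => //; apply/measurable_EFinP;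
        exact: (measurableT_comp mF (measurable_pair1 x)).
    + apply: measurable_funeM; apply/measurable_EFinP; exact: rint_measurable av.
    + move=> y _; rewrite -EFinM lee_fin.
      by rewrite (le_trans (Fuv x y))// -normrM ler_norm.
rewrite (_ : (\int[mu]_x _) = (\int[mu]_x `|u x|%:E) * (\int[nu]_y `|v y|)%:E)%E; last first.
  by rewrite integralZr.
by apply: lte_mul_pinfty; [exact: integral_ge0|exact: integrable_fin_num|exact: ltry].
Qed.

Lemma Rintegral_Fubini (F : X * Y -> R) : rint (mu \x nu)%E F ->
  (forall x, rint nu (fun y => F (x, y))) ->
  (forall y, rint mu (fun x => F (x, y))) ->
  \int[mu]_x (\int[nu]_y F (x, y)) = \int[nu]_y (\int[mu]_x F (x, y)).
Proof.
move=> iF iFx iFy; rewrite /Rintegral; congr fine.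
transitivity (\int[mu]_x \int[nu]_y (F (x, y))%:E)%E.
  apply: eq_integral => x _; rewrite fineK//.
  exact: integrable_fin_num (iFx x).
rewrite (Fubini iF).
apply: eq_integral => y _; rewrite fineK//.
exact: integrable_fin_num (iFy y).
Qed.

Variables (K : X -> Y -> R[i]) (w1 : X -> R) (w2 : Y -> R).
Hypothesis mK : cmeasurable (fun p : X * Y => K p.1 p.2).
Hypotheses (w1_ge0 : forall x, 0 <= w1 x) (w2_ge0 : forall y, 0 <= w2 y).
Hypothesis Kw : forall x y, Normc.normc (K x y) <= w1 x * w2 y.

Definition adjK (y : Y) (x : X) : R[i] := (K x y)^*%C.

Lemma cmeasurable_adjK : cmeasurable (fun p : Y * X => adjK p.1 p.2).
Proof.
have [rK jK] := cmeasurable_conj mK.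
by split; [exact: (measurableT_comp rK (@measurable_swap _ _ Y X))|
   exact: (measurableT_comp jK (@measurable_swap _ _ Y X))].
Qed.

Lemma adjK_bound y x : Normc.normc (adjK y x) <= w2 y * w1 x.
Proof. by rewrite normc_conj mulrC. Qed.

(** Fubini for the real part of f(x) K(x,y) times the conjugate of g(y), dominated by the product of
    the integrable functions |f| w1 and |g| w2. *)
Lemma kop_adjoint f g : wint mu w1 f -> wint nu w2 g ->
  rip nu (kop mu K f) g = rip mu f (kop nu adjK g).
Proof.
move=> hf hg; have [mf jf] := hf; have [mg jg] := hg.
pose F (p : X * Y) := cdot (f p.1) (g p.2 * (K p.1 p.2)^*%C).
have mg2 : cmeasurable (fun p : X * Y => g p.2).
  have [rg ig] := mg.
  by split; [exact: (measurableT_comp rg measurable_snd)|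
     exact: (measurableT_comp ig measurable_snd)].
have mF : measurable_fun setT F.
  apply: measurable_cdot; first exact: cmeasurable_fst.
  by apply: cmeasurableM => //; exact: cmeasurable_conj.
have Fle x y : `|F (x, y)| <= (Normc.normc (f x) * w1 x) * (Normc.normc (g y) * w2 y).
  apply: (le_trans (cdot_normc _ _)); rewrite /= Normc.normcM normc_conj mulrACA.
  by rewrite -mulrA !ler_wpM2l ?normc_ge0.
have iF : rint (mu \x nu)%E F by exact: rint_prod jf jg Fle.
transitivity (\int[nu]_y \int[mu]_x F (x, y)).
  apply: eq_Rintegral => y _; exact: (kop_cdot mK Kw).
transitivity (\int[mu]_x \int[nu]_y F (x, y)); last first.
  apply: eq_Rintegral => x _; rewrite cdotC.
  rewrite (kop_cdot cmeasurable_adjK adjK_bound)//.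
  apply: eq_Rintegral => y _; rewrite /F /adjK /=.
  by case: (f x) (g y) (K x y) => [a b] [c e] [k l]; rewrite /cdot /=; ring.
symmetry; apply: Rintegral_Fubini => //.
- move=> x; apply: (rint_dom _ (rintZ (Normc.normc (f x) * w1 x) jg)) => [|y].
    by exact: (measurableT_comp mF (measurable_pair1 x)).
  exact: Fle.
- move=> y; apply: (rint_dom _ (rintZ (Normc.normc (g y) * w2 y) jf)) => [|x].
    by exact: (measurableT_comp mF (measurable_pair2 y)).
  by rewrite mulrC; exact: Fle.
Qed.

End fubini_adjoint.

(** * Gram matrices and the Hilbert-Schmidt bound *)

Section hilbert_schmidt.
Context {d1 d2 : measure_display} {X : measurableType d1} {Y : measurableType d2}
  {R : realType}.
Variables (mu : {measure set X -> \bar R}) (nu : {measure set Y -> \bar R}).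
Variables (N : nat) (f : 'I_N -> X -> R[i]) (g : 'I_N -> Y -> R[i]).
Hypotheses (f2 : forall i, sqint mu (f i)) (g2 : forall i, sqint nu (g i)).
Hypothesis g_free : forall v : 'I_N -> R,
  {ae nu, forall y, \sum_i (v i)%:C%C * g i y = 0} -> forall i, v i = 0.

Let G : 'M[R]_N := \matrix_(i, j) rip nu (g i) (g j).

Let rip_comb (v : 'I_N -> R) (h : Y -> R[i]) : sqint nu h ->
  rip nu (fun y => \sum_i (v i)%:C%C * g i y) h = \sum_i v i * rip nu (g i) h.
Proof. by move=> h2; rewrite rip_suml. Qed.

Let comb2 (v : 'I_N -> R) : sqint nu (fun y => \sum_i (v i)%:C%C * g i y).
Proof. exact: sqint_sum. Qed.

Let rip_comb2 (v : 'I_N -> R) :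
  rip nu (fun y => \sum_i (v i)%:C%C * g i y) (fun y => \sum_i (v i)%:C%C * g i y) =
  \sum_i v i * \sum_j v j * G j i.
Proof.
rewrite rip_comb//; apply: eq_bigr => i _; congr (_ * _).
by rewrite ripC rip_comb//; apply: eq_bigr => j _; rewrite mxE.
Qed.

(** A vector killed by the Gram matrix gives a combination of norm zero, hence zero almost
    everywhere, which [g_free] excludes unless the vector is zero. *)
Lemma gram_unit : G \in unitmx.
Proof.
rewrite unitmxE unitfE; apply/negP => /det0P[v v0 vG].
case/negP: v0; apply/eqP/rowP => i; rewrite [RHS]mxE.
apply: (g_free (v := fun i => v 0 i)); apply: rip_eq0 => //.
rewrite rip_comb2 big1// => j _.
have /rowP/(_ j) := vG; rewrite !mxE => ->; by rewrite mulr0.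
Qed.

Let H := invmx G.

(** The left-hand side is the squared norm of the orthogonal projection [p] of [h] onto the real
    span of the [g i]; the coefficients [c] solve the normal equations, and the inequality is the
    nonnegativity of the squared norm of h - p. *)
Lemma bessel (h : Y -> R[i]) : sqint nu h ->
  \sum_i \sum_j H i j * (rip nu (g i) h * rip nu (g j) h) <= rip nu h h.
Proof.
move=> h2; pose u : 'rV[R]_N := \row_i rip nu (g i) h.
pose c := u *m H.
have cG : c *m G = u by rewrite /c mulmxKV// gram_unit.
pose p := fun y => \sum_i (c 0 i)%:C%C * g i y.
have p2 : sqint nu p by exact: comb2.
have pp : rip nu p p = \sum_i c 0 i * u 0 i.
  rewrite rip_comb2; apply: eq_bigr => i _; congr (_ * _).
  by rewrite -cG mxE.
have ph : rip nu p h = \sum_i c 0 i * u 0 i.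
  by rewrite rip_comb//; apply: eq_bigr => i _; rewrite [u _ _]mxE.
have := rip_ge0 nu (fun y => h y + - p y).
have np2 : sqint nu (fun y => - p y) by exact: sqintN.
have hN k : sqint nu k -> rip nu (fun y => - p y) k = - rip nu p k.
  move=> k2; rewrite -mulN1r -ripZl//; apply: eq_Rintegral => y _.
  by rewrite cdotZl cdotNl mulN1r.
have hp2 : sqint nu (fun y => h y + - p y) by exact: sqintD.
rewrite ripDl// hN// ripC ripDl// hN// [rip nu p (fun _ => _ + _)]ripC ripDl// hN// [rip nu h p]ripC ph pp.
rewrite subrr subr0 subr_ge0; apply: le_trans.
rewrite le_eqVlt; apply/orP; left; apply/eqP.
rewrite exchange_big; apply: eq_bigr => i _; rewrite mxE mulr_suml.
by apply: eq_bigr => j _; rewrite !mxE; ring.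
Qed.

Hypothesis fg : forall i j, rip mu (f i) (f j) = rip nu (g i) (g j).
Variables (S : set X) (k k' : X -> Y -> R[i]) (w : X -> R).
Hypothesis w_int : rint mu (fun x => w x * \1_S x).
Hypotheses (k2 : forall x, S x -> sqint nu (k x)) (k'2 : forall x, S x -> sqint nu (k' x)).
Hypotheses (k_le : forall x, S x -> rip nu (k x) (k x) <= w x)
  (k'_le : forall x, S x -> rip nu (k' x) (k' x) <= w x).
Hypothesis f_Re : forall i x, S x -> complex.Re (f i x) = rip nu (g i) (k x).
Hypothesis f_Im : forall i x, S x -> complex.Im (f i x) = rip nu (g i) (k' x).
Hypothesis f_supp : forall i x, ~ S x -> f i x = 0.

(* Integrating the Bessel inequality at every x: its left-hand side integrates to
   the trace of the Gram matrix times its inverse. *)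
Lemma hilbert_schmidt_dim : N%:R <= 2 * \int[mu]_x (w x * \1_S x).
Proof.
pose F x := \sum_i \sum_j H i j * cdot (f i x) (f j x).
have iF : rint mu F.
  by apply: rint_sum => i; apply: rint_sum => j; apply: rintZ; exact: sqint_cdot.
have FN : \int[mu]_x F x = N%:R.
  rewrite Rintegral_sum; last first.
    by move=> i; apply: rint_sum => j; apply: rintZ; exact: sqint_cdot.
  transitivity (\tr (H *m G^T)).
    rewrite /mxtrace; apply: eq_bigr => i _.
    rewrite Rintegral_sum; last by move=> j; apply: rintZ; exact: sqint_cdot.
    rewrite [RHS]mxE; apply: eq_bigr => j _.
    by rewrite RintegralZl//; [rewrite !mxE -fg|exact: sqint_cdot].
  have -> : G^T = G by apply/matrixP => i j; rewrite !mxE ripC.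
  by rewrite mulVmx ?gram_unit// mxtrace1.
rewrite -FN -RintegralZl//; apply: le_Rintegral => //; first exact: rintZ.
move=> x _; rewrite /F indicE; have [/set_mem Sx|/negP Sx] := boolP (x \in S).
- rewrite mulr1 mulr_natl mulr2n.
  (* Bessel's inequality is used twice, for the real parts and for the imaginary parts of the
     [f i x]; hence the factor 2. *)
  apply: (@le_trans _ _ (\sum_i \sum_j H i j * (rip nu (g i) (k x) * rip nu (g j) (k x)) +
     \sum_i \sum_j H i j * (rip nu (g i) (k' x) * rip nu (g j) (k' x)))).
    rewrite -big_split /= ler_sum// => i _; rewrite -big_split /= ler_sum// => j _.
    by rewrite /cdot -!f_Re// -!f_Im// -mulrDr.
  apply: lerD.
  + exact: le_trans (bessel (k2 Sx)) (k_le Sx).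
  + exact: le_trans (bessel (k'2 Sx)) (k'_le Sx).
- rewrite mulr0 mulr0 big1// => i _; rewrite big1// => j _.
  by rewrite f_supp ?cdot0l ?mulr0// => Sx'; apply: Sx; exact/mem_set.
Qed.

End hilbert_schmidt.

(** * Testing against a class of functions *)

Section total_classes.
Context {disp : measure_display} {X : measurableType disp} {R : realType}.
Variables (mu : {measure set X -> \bar R}) (w : X -> R).

(* H ranges over the functions that are sums of an L^2 function and a function
   of the growth of the kernel: this covers both T f and its integral formula. *)
Definition total (D : set (X -> R)) := forall H : X -> R,
  measurable_fun setT H ->
  (exists (h : X -> R) (M : R), [/\ measurable_fun setT h, rint mu (fun x => h x ^+ 2) &
     forall x, `|H x| <= `|h x| + M * w x]) ->
  (forall phi, D phi -> \int[mu]_x (phi x * H x) = 0) ->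
  {ae mu, forall x, H x = 0}.

(** The function phi or i phi: the real pairing with the first sees real parts, with the second
    imaginary parts. *)
Definition cpair (b : bool) (phi : X -> R) (x : X) : R[i] :=
  if b then (phi x)%:C%C else Complex 0 (phi x).

Hypothesis mw : measurable_fun setT w.
Hypothesis w_ge0 : forall x, 0 <= w x.

Lemma wint_cdot f (A : X -> R[i]) M : wint mu w f -> cmeasurable A ->
  (forall x, Normc.normc (A x) <= M * w x) -> rint mu (fun x => cdot (f x) (A x)).
Proof.
move=> [mf jf] mA AM; apply: (rint_dom _ (rintZ M jf)) => [|x].
  exact: measurable_cdot.
apply: (le_trans (cdot_normc _ _)); rewrite mulrCA.
by rewrite ler_wpM2l ?normc_ge0.
Qed.

(** The real and imaginary parts of [A - f] are dominated by |f| plus a multiple of [w], so they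
    belong to the class that [total] tests; [cpair true] and [cpair false] annihilate them in
    turn. *)
Lemma total_ae_eq (D : set (X -> R)) (A f : X -> R[i]) M : total D ->
  (forall b phi, D phi -> sqint mu (cpair b phi) /\ wint mu w (cpair b phi)) ->
  cmeasurable A -> (forall x, Normc.normc (A x) <= M * w x) -> sqint mu f ->
  (forall b phi, D phi -> rip mu (cpair b phi) A = rip mu (cpair b phi) f) ->
  {ae mu, forall x, f x = A x}.
Proof.
move=> totD Dint mA AM f2 DAf; have [mf jf] := f2.
have key (p : R[i] -> R) b :
    (forall z z', p (z + z') = p z + p z') -> (forall z, p (- z) = - p z) ->
    (forall z, `|p z| <= Normc.normc z) ->
    (forall h, cmeasurable h -> measurable_fun setT (fun x : X => p (h x))) ->
    (forall phi x z, cdot (cpair b phi x) z = phi x * p z) ->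
    {ae mu, forall x, p (A x) - p (f x) = 0}.
  move=> pD pN p_le pm pphi; apply: totD.
  - by apply: measurable_funB; exact: pm.
  - exists (fun x => Normc.normc (f x)), M; split; first exact: measurable_normc.
      by under eq_fun do rewrite sqr_normc.
    move=> x; rewrite [leRHS]addrC; apply: (le_trans (ler_normB _ _)).
    apply: lerD; first exact: le_trans (p_le _) (AM x).
    by rewrite [leRHS]ger0_norm ?normc_ge0.
  - move=> phi Dphi; have [s1 w1] := Dint b phi Dphi.
    under eq_Rintegral do rewrite mulrBr -!pphi.
    rewrite RintegralB//; last exact: sqint_cdot.
      by apply/eqP; rewrite subr_eq0; apply/eqP; exact: DAf.
    exact: wint_cdot w1 mA AM.
have hRe := key (@complex.Re R) true.
have hIm := key (@complex.Im R) false.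
have /hRe {}hRe : forall z z' : R[i], complex.Re (z + z') = complex.Re z + complex.Re z'.
  by case=> [? ?] [].
have /hIm {}hIm : forall z z' : R[i], complex.Im (z + z') = complex.Im z + complex.Im z'.
  by case=> [? ?] [].
apply: filterS2 (hRe _ _ _ _) (hIm _ _ _ _).
- by move=> x /eqP + /eqP; rewrite !subr_eq0 => /eqP h1 /eqP h2; exact: complexP.
- by case.
- exact: Re_le_normc.
- by move=> h [].
- by move=> phi x [a b]; rewrite /cdot /= mul0r addr0.
- by case.
- exact: Im_le_normc.
- by move=> h [].
- by move=> phi x [a b]; rewrite /cdot /= mul0r add0r.
Qed.

End total_classes.

(** * Unitary operators given by a kernel on test functions *)

Section unitary_kernel_operator.
Context {d1 d2 : measure_display} {X : measurableType d1} {Y : measurableType d2}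
  {R : realType}.
Variables (mu : {sigma_finite_measure set X -> \bar R})
  (nu : {sigma_finite_measure set Y -> \bar R}).
Variables (K : X -> Y -> R[i]) (w1 : X -> R) (w2 : Y -> R).
Hypothesis mK : cmeasurable (fun p : X * Y => K p.1 p.2).
Hypotheses (w1_ge0 : forall x, 0 <= w1 x) (w2_ge0 : forall y, 0 <= w2 y).
Hypothesis Kw : forall x y, Normc.normc (K x y) <= w1 x * w2 y.
Variable T : (X -> R[i]) -> (Y -> R[i]).
Hypothesis T_sqint : forall f, sqint mu f -> sqint nu (T f).
Hypothesis T_add : forall f g, sqint mu f -> sqint mu g ->
  {ae nu, forall y, T (fun x => f x + g x) y = T f y + T g y}.
Hypothesis T_iso : forall f, sqint mu f -> rip nu (T f) (T f) = rip mu f f.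
Hypothesis T_onto : forall h, sqint nu h ->
  exists2 f, sqint mu f & {ae nu, forall y, T f y = h y}.
Variables (DX : set (X -> R)) (DY : set (Y -> R)).
Hypotheses (DX_total : total mu w1 DX) (DY_total : total nu w2 DY).
Hypothesis DX_int : forall b phi, DX phi ->
  sqint mu (cpair b phi) /\ wint mu w1 (cpair b phi).
Hypothesis DY_int : forall b phi, DY phi ->
  sqint nu (cpair b phi) /\ wint nu w2 (cpair b phi).
Hypothesis T_DX : forall b phi, DX phi ->
  {ae nu, forall y, T (cpair b phi) y = kop mu K (cpair b phi) y}.

(** Real polarization: expanding the squared norms of f + g and of its image leaves twice the two
    inner products. *)
Lemma unitary_rip f g : sqint mu f -> sqint mu g -> rip nu (T f) (T g) = rip mu f g.
Proof.
move=> f2 g2; have Tf2 := T_sqint f2; have Tg2 := T_sqint g2.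
have fg2 := sqintD f2 g2; have := T_iso fg2.
have Tfg2 := T_sqint fg2; have TT2 := sqintD Tf2 Tg2.
rewrite (rip_ae (proj1 Tfg2) (proj1 TT2) (proj1 Tfg2) (proj1 TT2)
  (T_add f2 g2) (T_add f2 g2)).
rewrite !ripDl// !ripDr// !T_iso// [rip nu (T g) (T f)]ripC [rip mu g f]ripC.
lra.
Qed.

(* Test functions phi satisfy <phi, T^* g> = <T phi, T f> = <phi, f>, by Fubini and
   the isometry. *)
Lemma unitary_inv_kop f g : sqint mu f -> wint nu w2 g -> sqint nu g ->
  {ae nu, forall y, T f y = g y} -> {ae mu, forall x, f x = kop nu (adjK K) g x}.
Proof.
move=> f2 gw g2 Tfg.
have mA : cmeasurable (kop nu (adjK K) g).
  exact: (kop_cmeasurable nu (cmeasurable_adjK mK) (proj1 g2)).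
have [M M0 AM] := kop_bound (cmeasurable_adjK mK) w2_ge0 (adjK_bound Kw) gw.
apply: (total_ae_eq DX_total DX_int mA AM f2) => b phi Dphi.
have [p2 pw] := DX_int b Dphi.
rewrite -(kop_adjoint mK Kw pw gw) -(unitary_rip p2 f2).
apply: rip_ae.
- exact: (kop_cmeasurable mu mK (proj1 p2)).
- by have [] := T_sqint p2.
- by have [] := g2.
- by have [] := T_sqint f2.
- by apply: filterS (T_DX b Dphi) => y ->.
- by apply: filterS Tfg => y ->.
Qed.

(* Test functions on the target side are images of some h by surjectivity, and
   [unitary_inv_kop] identifies h. *)
Lemma unitary_kop f : sqint mu f -> wint mu w1 f ->
  {ae nu, forall y, T f y = kop mu K f y}.
Proof.
move=> f2 fw; have mA := kop_cmeasurable mu mK (proj1 f2).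
have [M M0 AM] := kop_bound mK w1_ge0 Kw fw.
apply: (total_ae_eq DY_total DY_int mA AM (T_sqint f2)) => b phi Dphi.
have [p2 pw] := DY_int b Dphi; have [h h2 Th] := T_onto p2.
have hA := unitary_inv_kop h2 pw p2 Th.
rewrite ripC (kop_adjoint mK Kw fw pw).
rewrite (@rip_ae _ _ _ mu f f (kop nu (adjK K) (cpair b phi)) h); first last.
- by apply: filterS hA => x ->.
- exact: aeW.
- by have [] := h2.
- exact: (kop_cmeasurable nu (cmeasurable_adjK mK) (proj1 p2)).
- by have [] := f2.
- by have [] := f2.
rewrite -unitary_rip// ripC; apply: rip_ae => //.
- by have [] := T_sqint h2.
- by have [] := p2.
- by have [] := T_sqint f2.
- by have [] := T_sqint f2.
- exact: aeW.
Qed.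

End unitary_kernel_operator.

(** * A countable base of R^d *)

Section rational_balls.
Context {R : realType} {d : nat}.

(** Sup-norm balls that form a base of the topology. Their indices form a countable type, so that
    open sets become unions of sequences. *)
Definition qball (p : 'rV[rat]_d * nat) : set 'rV[R]_d :=
  ball (map_mx ratr p.1 : 'rV[R]_d) p.2.+1%:R^-1.

Lemma qballP (x : 'rV[R]_d) (A : set 'rV[R]_d) : nbhs x A ->
  exists p, qball p x /\ qball p `<=` A.
Proof.
move=> /nbhs_ballP[e /= e0 eA].
(* With a radius below e / 2, the point and every other point of the ball are within e / 2 of the
   rational centre, hence within e of each other. *)
have [k ke] : exists k, k.+1%:R^-1 < e / 2 :> R.
  have e20 : 0 < e / 2 by rewrite divr_gt0.
  exists (Num.bound (e / 2)^-1); rewrite invf_plt ?posrE//.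
  by rewrite (lt_trans (archi_boundP _)) ?ltr_nat// invr_ge0 ltW.
have k0 : 0 < k.+1%:R^-1 :> R by rewrite invr_gt0.
have /choice[q hq] : forall i, exists r : rat, `|x 0 i - ratr r| < k.+1%:R^-1.
  move=> i; have [r] := @rat_in_itvoo R (x 0 i - k.+1%:R^-1)
    (x 0 i + k.+1%:R^-1) ltac:(by rewrite ltrD2l gt0_cp).
  rewrite in_itv/= => rt; exists r; rewrite distrC ltr_distl.
  exact: rt.
exists (\row_i q i : 'rV[rat]_d, k); split.
  by split => // i j; rewrite !mxE /ball /= distrC ord1.
move=> y [_ hy]; apply: eA; split => // i j.
have := hy i j; rewrite !mxE /ball /= => hyj.
rewrite -(subrKA (ratr (q j))) ord1.
rewrite (le_lt_trans (ler_normD _ _))// (splitr e) ltrD// ?(lt_trans _ ke)//.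
by move: hyj; rewrite ord1.
Qed.

Lemma measurable_open_rV (A : set 'rV[R]_d) : open A -> measurable A.
Proof. by move=> oA; exact: sub_sigma_algebra. Qed.

Lemma measurable_qball p : measurable (qball p).
Proof. by apply: measurable_open_rV; apply: ball_open; rewrite invr_gt0. Qed.

End rational_balls.

(** * Borel sets and dilations of a cone *)

Section cone_geometry.
Context {R : realType} {d : nat} (C : convex_cone R d).
Implicit Types x y : C.

Lemma cone_val_inj : injective (@cone_val R d C).
Proof. exact: val_inj. Qed.

Lemma cone_openP (A : set C) : open A ->
  exists2 B : set 'rV[R]_d, open B & @cone_val R d C @^-1` B = A.
Proof. by case=> B; exists B. Qed.

Lemma cone_nbhsP (x : C) (A : set C) : nbhs x A ->
  exists2 B : set 'rV[R]_d, nbhs (cone_val x) B & @cone_val R d C @^-1` B `<=` A.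
Proof.
move=> [W [[B oB <-] Bx BA]]; exists B => //.
exact: open_nbhs_nbhs.
Qed.

(** The traces of Borel sets form a sigma-algebra containing the open sets of the cone. The polar
    formula, stated for traces, thus determines the measure of every Borel set of the cone. *)
Lemma cone_measurableP (A : set C) : measurable A ->
  exists2 B : set 'rV[R]_d, measurable B & @cone_val R d C @^-1` B = A.
Proof.
move=> mA; pose M := [set A : set C | exists2 B : set 'rV[R]_d, measurable B &
  @cone_val R d C @^-1` B = A].
suff : <<s @open C >> `<=` M by apply.
apply: smallest_sub.
- split.
  + by exists set0 => //; rewrite preimage_set0.
  + move=> _ [B mB <-]; exists (~` B); first exact: measurableC.
    by rewrite setTD preimage_setC.
  + move=> F hF; have /choice[G hG] : forall n, exists B : set 'rV[R]_d,
        measurable B /\ @cone_val R d C @^-1` B = F n.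
      by move=> n; have [B mB BF] := hF n; exists B.
    exists (\bigcup_n G n); first by apply: bigcup_measurable => n _; case: (hG n).
    by rewrite preimage_bigcup; apply: eq_bigcupr => n _; case: (hG n).
- move=> _ /cone_openP[B oB <-]; exists B => //; exact: measurable_open_rV.
Qed.

Lemma measurable_cone_val : measurable_fun setT (@cone_val R d C).
Proof.
apply: (measurability (@open 'rV[R]_d)) => // _ [A oA <-]; rewrite setTI.
by apply: sub_sigma_algebra; exists A.
Qed.

(* The identity when l <= 0. *)
Definition dil (l : R) (x : C) : C :=
  match pselect (0 < l) with
  | left l0 => SigSub (mem_set (cone_scale l0 (set_valP x)))
  | right _ => x
  end.

Lemma dilE l x : 0 < l -> cone_val (dil l x) = l *: cone_val x.
Proof. by rewrite /dil; case: pselect. Qed.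

Lemma dil_comp l l' x : 0 < l -> 0 < l' -> dil l (dil l' x) = dil (l * l') x.
Proof.
by move=> l0 l'0; apply: cone_val_inj; rewrite !dilE ?mulr_gt0// scalerA.
Qed.

Lemma dil1 x : dil 1 x = x.
Proof. by apply: cone_val_inj; rewrite dilE// scale1r. Qed.

Lemma dilK l : 0 < l -> cancel (dil l) (dil l^-1).
Proof. by move=> l0 x; rewrite dil_comp ?invr_gt0// mulVf ?gt_eqF// dil1. Qed.

Lemma enorm_scale (n : nat) (l : R) (v : 'rV[R]_n) : 0 <= l ->
  enorm (l *: v) = l * enorm v.
Proof.
move=> l0; rewrite /enorm; under eq_bigr do rewrite mxE exprMn.
by rewrite -mulr_sumr sqrtrM ?sqr_ge0// sqrtr_sqr ger0_norm.
Qed.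

Lemma scale_measurable (l : R) : measurable_fun setT (fun v : 'rV[R]_d => l *: v).
Proof.
apply: measurable_rV => i; under eq_fun do rewrite mxE.
apply: measurable_funM => //.
by apply: rV_continuous_measurable; exact: coord_continuous.
Qed.

Lemma measurable_dil l : measurable_fun setT (dil l).
Proof.
have [l0|l0] := boolP (0 < l); last first.
  rewrite (_ : dil l = id); first exact: measurable_id.
  by apply/funext => x; rewrite /dil; case: pselect => // h; case/negP: l0.
move=> _ A /cone_measurableP[B mB <-]; rewrite setTI.
rewrite (_ : dil l @^-1` _ = @cone_val R d C @^-1` ((fun v => l *: v) @^-1` B)).
  rewrite -[X in measurable X]setTI; apply: measurable_cone_val => //.
  by rewrite -[X in measurable X]setTI; exact: scale_measurable.
by apply/funext => x /=; rewrite dilE.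
Qed.

End cone_geometry.

(** The product space carries the product sigma-algebra. An open set belongs to it because, by
    second countability, it is a countable union of products of traces of rational balls. *)
Lemma continuous_cone_prod_measurable (R : realType) (d : nat)
    (C D : convex_cone R d) (F : C * D -> R) :
  continuous F -> measurable_fun setT F.
Proof.
move=> /continuousP cF; apply: (measurability _ (RGenOInfty.measurableE R)).
move=> /= _ [_ [a ->] <-]; rewrite setTI.
pose U := [set t | a < t].
have oU : open (F @^-1` U) by apply: cF; exact: open_gt.
pose P n : set (C * D) := if unpickle n is Some pq
  then let: (p, q) := (pq : ('rV[rat]_d * nat) * ('rV[rat]_d * nat)) in
    [set z : C * D | (@cone_val R d C @^-1` qball p) `*`
       (@cone_val R d D @^-1` qball q) `<=` F @^-1` U /\
       qball p (cone_val z.1) /\ qball q (cone_val z.2)]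
  else set0.
rewrite (_ : F @^-1` _ = \bigcup_n P n).
  apply: bigcupT_measurable => n; rewrite /P.
  case: unpickle => [[p q]|]; last exact: measurable0.
  set Q := (_ `<=` F @^-1` U); have [hQ|hQ] := pselect Q; last first.
    rewrite (_ : mkset _ = set0); last by apply/seteqP; split => z // -[].
    exact: measurable0.
  rewrite (_ : mkset _ = (@cone_val R d C @^-1` qball p) `*`
    (@cone_val R d D @^-1` qball q)).
    apply: measurableX; rewrite -[X in measurable X]setTI;
      apply: measurable_cone_val => //; exact: measurable_qball.
  by apply/seteqP; split => z /= => [[]|].
apply/seteqP; split => [z|z [n _]]; last first.
  rewrite /P; case: unpickle => [[p q] /= [hF [hp hq]]|//].
  have := hF z; rewrite /U /= in_itv /= andbT; exact.
rewrite /= in_itv /= andbT => Fz.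
have : nbhs z (F @^-1` U) by exact: open_nbhs_nbhs.
move=> [[A B] /= [/cone_nbhsP[A' /qballP[p [pz pA]] AA']
  /cone_nbhsP[B' /qballP[q [qz qB]] BB']] AB].
exists (pickle (p, q)) => //; rewrite /P pickleK /=; split => //.
by move=> [x y] [/= px qy]; apply: AB; split => /=; [exact/AA'/pA|exact/BB'/qB].
Qed.

(** * Scaling and polar coordinates *)

Section lebesgue_scaling.
Context {R : realType}.
Local Open Scope ereal_scope.

(** Lebesgue measure is l times its image under multiplication by l: the two agree on half-open
    intervals, hence everywhere by uniqueness. *)
Lemma ge0_integral_scale (l : R) (G : R -> \bar R) : (0 < l)%R ->
  measurable_fun setT G -> (forall r, 0 <= G r) ->
  \int[lebesgue_measure]_(r in `]0%R, +oo[) G r =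
  l%:E * \int[lebesgue_measure]_(r in `]0%R, +oo[) G (l * r)%R.
Proof.
move=> l0 mG G0.
have ml : measurable_fun setT (fun r : R => l * r)%R by exact: measurable_funM.
have l0' : (0 <= l)%R by exact: ltW.
have ml' : @measurable_fun _ _ (measurableTypeR R) (measurableTypeR R) setT
    (fun r : R => l * r)%R by exact: ml.
pose m : {measure set (measurableTypeR R) -> \bar R} :=
  mscale (NngNum l0') (measure_image (@lebesgue_measure R) ml').
have mE A : measurable A -> lebesgue_measure A = m A.
  move: A; apply: lebesgue_measure_unique => _ [[x y] _ <-].
  rewrite [RHS](_ : _ = l%:E * lebesgue_measure ((fun r => l * r)%R @^-1` `]x, y]))//.
  rewrite (_ : _ @^-1` _ = `](x / l)%R, (y / l)%R]%classic); last first.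
    apply/seteqP; split => r /=; rewrite !in_itv/= ltr_pdivrMr// ler_pdivlMr//;
      by rewrite mulrC.
  rewrite !lebesgue_measure_itv/= !lte_fin ltr_pM2r ?invr_gt0//.
  case: ifPn => _; last by rewrite mule0.
  by rewrite -!EFinD -EFinM -mulrBl mulrC divfK ?gt_eqF.
have -> : \int[lebesgue_measure]_(r in `]0%R, +oo[) G r =
    \int[m]_(r in `]0%R, +oo[) G r.
  by apply: eq_measure_integral => A mA _; exact: mE.
rewrite ge0_integral_mscale//; last exact: measurable_funS mG.
rewrite ge0_integral_pushforward//; last exact: measurable_funS mG.
rewrite (_ : _ @^-1` _ = `]0%R, +oo[%classic)//.
by apply/seteqP; split => r /=; rewrite !in_itv/= !andbT pmulr_rgt0.
Qed.

End lebesgue_scaling.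

Section polar_density.
Context {R : realType} {d : nat}.
Variable Q : 'rV[R]_d -> R.
Hypothesis Q_int : (@surface_measure R d).-integrable (@usphere R d) (EFin \o Q).
Hypothesis Q_ge0 : forall z, usphere z -> 0 <= Q z.

Let Q' : 'rV[R]_d -> R := Q \_ (@usphere R d).

Lemma measurable_usphere : measurable (@usphere R d).
Proof.
rewrite -[X in measurable X]setTI.
exact: (@measurable_enorm R d measurableT _ (measurable_set1 1)).
Qed.

Let Q'_int : rint (@surface_measure R d) Q'.
Proof.
rewrite /rint /Q' -restrict_EFin.
exact/(integrable_mkcond _ measurable_usphere).
Qed.

Let Q'_ge0 z : 0 <= Q' z.
Proof. by rewrite /Q' patchE; case: ifPn => // /set_mem; exact: Q_ge0. Qed.

(* The proof arguments let canonical structures find the measure instance. *)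
Definition polar_weight
    (_ : (@surface_measure R d).-integrable (@usphere R d) (EFin \o Q))
    (_ : forall z, usphere z -> 0 <= Q z) (B : set 'rV[R]_d) : \bar R :=
  (\int[@surface_measure R d]_(z in B) ((Q \_ (@usphere R d)) z)%:E)%E.

Local Notation W := (polar_weight Q_int Q_ge0).

Let polar_weight0 : W set0 = 0%E. Proof. exact: integral_set0. Qed.

Let polar_weight_ge0 A : (0 <= W A)%E.
Proof. by apply: integral_ge0 => x _; rewrite lee_fin Q'_ge0. Qed.

Let polar_weight_sigma_additive : semi_sigma_additive W.
Proof.
apply: semi_sigma_additive_nng_induced => [|x]; last by rewrite lee_fin Q'_ge0.
by apply/measurable_EFinP; exact: rint_measurable Q'_int.
Qed.

HB.instance Definition _ := isMeasure.Build _ _ _ W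
  polar_weight0 polar_weight_ge0 polar_weight_sigma_additive.

Lemma polar_weight_fin : fin_num_fun W.
Proof.
move=> U mU; rewrite ge0_fin_numE//.
apply: (@le_lt_trans _ _ (W setT)); first by apply: le_measure; rewrite ?inE.
by apply: integrable_lty.
Qed.

HB.instance Definition _ := Measure_isFinite.Build _ _ _ W polar_weight_fin.

Lemma measurable_polar_coordinates :
  measurable_fun setT (fun p : R * 'rV[R]_d => p.1 *: p.2).
Proof.
apply: measurable_rV => i; under eq_fun do rewrite mxE.
apply: measurable_funM => //.
apply: (measurableT_comp (f := fun v : 'rV[R]_d => v 0 i)) => //.
by apply: rV_continuous_measurable; exact: coord_continuous.
Qed.

(** The sets in question are the sections of the measurable set of pairs (r, z) with r z in [A], and
    the measure of sections is measurable because the spherical measure is finite. *)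
Lemma measurable_polar_section (A : set 'rV[R]_d) : measurable A ->
  measurable_fun setT (fun r : R => W ((fun z => r *: z) @^-1` A)).
Proof.
move=> mA; pose B := (fun p : R * 'rV[R]_d => p.1 *: p.2) @^-1` A.
have mB : measurable B.
  by rewrite -[X in measurable X]setTI; exact: measurable_polar_coordinates.
have := measurable_fun_xsection W mB; congr measurable_fun.
apply/funext => r /=; congr W; apply/seteqP; split => z.
- by rewrite /xsection /= inE.
- by move=> h; rewrite /xsection /= inE.
Qed.

(** Absorbing [Q] into the spherical measure turns the inner polar integral into the measure of a
    section, on which dilations act by composition. *)
Lemma polar_inner (A : set 'rV[R]_d) (r c : R) : measurable A -> 0 <= c ->
  (\int[@surface_measure R d]_(z in @usphere R d) (\1_A (r *: z) * c * Q z)%:E =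
   c%:E * W ((fun z => r *: z) @^-1` A))%E.
Proof.
move=> mA c0; set B := _ @^-1` A.
have mB : measurable B.
  by rewrite -[X in measurable X]setTI; exact: scale_measurable.
rewrite /polar_weight [in RHS]integral_mkcond -ge0_integralZl//.
- rewrite [LHS]integral_mkcond; apply: eq_integral => z _.
  rewrite !patchE /= indicE; case: ifPn => [zS|zS]; last first.
    by case: ifPn => _; rewrite ?patchE ?(negbTE zS) mule0.
  rewrite (_ : (r *: z \in A) = (z \in B)); last by rewrite /B; apply/idP/idP; rewrite !inE.
  case: ifPn => zB; rewrite ?patchE ?zS ?mul1r ?mul0r ?mule0//.
- apply/(measurable_restrictT _ mB)/measurable_funTS.
  by apply/measurable_EFinP; exact: rint_measurable Q'_int.
- by move=> z _; rewrite patchE; case: ifPn => // _; rewrite lee_fin Q'_ge0.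
Qed.

End polar_density.

(** * Homogeneity of measures with a polar decomposition *)

Section homogeneous_measure.
Context {R : realType} {d : nat} {C : convex_cone R d}.
Variables (mu : {measure set C -> \bar R}) (a : R) (Q : 'rV[R]_d -> R).
Hypothesis mu_polar : polar_decomposition mu a Q.

Let Q_int : (@surface_measure R d).-integrable (@usphere R d) (EFin \o Q).
Proof. by case: mu_polar. Qed.

Let Q_ge0 : forall z, usphere z -> 0 <= Q z.
Proof. by case: mu_polar. Qed.

Local Notation W := (polar_weight Q_int Q_ge0).

Let muE (A : set 'rV[R]_d) : measurable A -> (mu (@cone_val R d C @^-1` A) =
  \int[lebesgue_measure]_(r in `]0%R, +oo[)
     ((r `^ (2 * a - 1))%:E * W ((fun z => r *: z) @^-1` A)))%E.
Proof.
move=> mA; have [_ _ _ ->//] := mu_polar.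
by apply: eq_integral => r _; rewrite polar_inner// powR_ge0.
Qed.

(** The substitution of l r for r in the polar formula multiplies r^(2 a - 1) dr by l^(2 a) and
    leaves the spherical factor unchanged. *)
Lemma measure_dil (l : R) (A : set C) : 0 < l -> measurable A ->
  mu (dil l @^-1` A) = ((l `^ (- (2 * a)))%:E * mu A)%E.
Proof.
move=> l0 /cone_measurableP[B mB <-].
rewrite (_ : dil l @^-1` _ = @cone_val R d C @^-1` ((fun v => l *: v) @^-1` B)); last first.
  by apply/funext => x /=; rewrite dilE.
rewrite !muE//; last by rewrite -[X in measurable X]setTI; exact: scale_measurable.
have mW := measurable_polar_section Q_int Q_ge0 mB.
rewrite [in RHS](@ge0_integral_scale _ l); last 3 first.
- exact: l0.
- apply: emeasurable_funM; last exact: mW.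
  by apply/measurable_EFinP; exact: measurable_powR.
- by move=> r; apply: mule_ge0; [rewrite lee_fin powR_ge0|exact: measure_ge0].
(* The factors l^(- 2 a) of the claim, l of dr and l^(2 a - 1) of the density cancel. *)
have cE : l `^ (- (2 * a)) * l * l `^ (2 * a - 1) = 1.
  rewrite -mulrA -{2}(powRr1 (ltW l0)) -powRD; last by rewrite (gt_eqF l0) implybT.
  by rewrite addrC subrK powRN mulVf// gt_eqF// powR_gt0.
rewrite muleA -EFinM -ge0_integralZl//.
- apply: eq_integral => r; rewrite inE/= in_itv/= andbT => r0.
  rewrite muleA -EFinM; congr (_%:E * W _)%E.
    by rewrite powRM ?ltW// mulrA cE mul1r.
  by apply/funext => z /=; rewrite scalerA.
- apply: measurable_funTS; apply: emeasurable_funM.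
    apply/measurable_EFinP; apply: (measurableT_comp (measurable_powR _)).
    exact: measurable_funM.
  apply: (measurableT_comp mW); exact: measurable_funM.
- by move=> r _; apply: mule_ge0; [rewrite lee_fin powR_ge0|exact: measure_ge0].
- by rewrite lee_fin mulr_ge0 ?powR_ge0// ltW.
Qed.

Lemma measurable_cone_enorm (B : set R) : measurable B ->
  measurable [set x : C | B (enorm (cone_val x))].
Proof.
move=> mB; rewrite -[X in measurable X]setTI.
apply: (measurableT_comp (@measurable_enorm R d) (@measurable_cone_val R d C)) => //.
Qed.

Let mE (B : set R) : measurable B -> measurable [set x : 'rV[R]_d | B (enorm x)].
Proof.
by move=> mB; rewrite -[X in measurable X]setTI; exact: measurable_enorm.
Qed.

(** The section of a radial set at radius r > 0 contains the whole sphere or misses it, according to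
    whether r is in [B], and the spherical measure sees only the sphere. *)
Let radialE (B : set R) : measurable B -> (mu [set x | B (enorm (cone_val x))] =
  \int[lebesgue_measure]_(r in `]0%R, +oo[ `&` B)
     ((r `^ (2 * a - 1))%:E * W (@usphere R d)))%E.
Proof.
move=> mB; have mBR := mE mB.
rewrite -[X in mu X]/(@cone_val R d C @^-1` [set x | B (enorm x)]) muE//.
rewrite [RHS]integral_mkcondr; apply: eq_integral => r.
rewrite inE/= in_itv/= andbT => r0; rewrite patchE.
have sE z : usphere z -> enorm (r *: z) = r.
  by move=> z1; rewrite enorm_scale ?ltW// z1 mulr1.
case: ifPn => rB.
  congr (_ * _)%E; rewrite /polar_weight integral_mkcond [RHS]integral_mkcond.
  apply: eq_integral => z _; rewrite !patchE; have [zS|zS] := boolP (z \in @usphere R d).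
    by rewrite mem_set//= sE; [exact/set_mem|exact/set_mem].
  by case: ifPn.
rewrite /polar_weight integral0_eq ?mule0// => z /= zB; rewrite patchE.
case: ifPn => // /set_mem zS; case/negP: rB; rewrite inE.
by move: zB; rewrite sE.
Qed.

Lemma annulus_finite : (mu [set x : C | (1 < enorm (cone_val x) <= 2)%R] < +oo)%E.
Proof.
have -> : [set x : C | 1 < enorm (cone_val x) <= 2] =
    [set x : C | (`]1%R, 2%R]%classic : set R) (enorm (cone_val x))].
  by apply/seteqP; split => x /=; rewrite in_itv.
(* The exponent 2 a - 1 may be negative; on ]1, 2] its absolute value gives an upper bound in both
   cases. *)
rewrite radialE//; pose c : R := 2 `^ `|2 * a - 1|.
have W0 : (0 <= W (@usphere R d))%E.
  exact: measure_ge0.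
have Wfin : (W (@usphere R d) < +oo)%E.
  have := polar_weight_fin Q_int Q_ge0 (@measurable_usphere R d).
  by rewrite ge0_fin_numE.
apply: (@le_lt_trans _ _ (\int[lebesgue_measure]_(r in `]0%R, +oo[ `&` `]1%R, 2%R])
    (c%:E * W (@usphere R d)))%E).
  apply: ge0_le_integral => //.
  - exact: measurableI.
  - by move=> r _; rewrite mule_ge0// lee_fin powR_ge0.
  - apply: emeasurable_funM => //; apply: measurable_funTS.
    by apply/measurable_EFinP; exact: measurable_powR.
  - move=> r [_]; rewrite /= in_itv/= => /andP[r1 r2].
    apply: lee_wpmul2r => //; rewrite lee_fin /c.
    apply: (@le_trans _ _ (r `^ `|2 * a - 1|)).
      by apply: ler_powR; [exact: ltW|exact: ler_norm].
    by apply: ge0_ler_powR; rewrite ?nnegrE// ltW// (lt_trans _ r1).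
rewrite integral_cst; last exact: measurableI.
rewrite -muleA lte_mul_pinfty// ?lee_fin ?powR_ge0//.
rewrite lte_mul_pinfty//; first by rewrite ge0_fin_numE.
apply: (@le_lt_trans _ _ (lebesgue_measure (`]1%R, 2%R]%classic : set R))).
  by apply: le_measure; rewrite ?inE//; exact: measurableI.
by rewrite lebesgue_measure_itv/=; case: ifPn; rewrite ?ltry.
Qed.

(** The polar formula integrates over r > 0, which excludes the radius 0. *)
Lemma measure_origin : mu [set x | enorm (cone_val x) = 0] = 0%E.
Proof.
rewrite (radialE (measurable_set1 0)) (_ : _ `&` _ = set0) ?integral_set0//.
by apply/seteqP; split => r // -[/=]; rewrite in_itv/= andbT => r0 rE; rewrite rE ltxx in r0.
Qed.

End homogeneous_measure.

(** * Integrability with respect to homogeneous measures *)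

Lemma exprn_le_expR (R : realType) (u : R) (n : nat) : 0 <= u ->
  u ^+ n <= n`!%:R * expR u.
Proof.
move=> u0; case: n => [|n]; first by rewrite expr0 mul1r -[leLHS](@expR0 R) ler_expR.
rewrite mulrC -ler_pdivrMr ?ltr0n ?fact_gt0//.
by apply: le_trans (expR_ge1Dxn n u0); rewrite lerDr.
Qed.

Lemma powR_exprn (R : realType) (x p : R) (n : nat) : 0 <= x ->
  (x ^+ n) `^ p = (x `^ p) ^+ n.
Proof.
by move=> x0; rewrite -!powR_mulrn ?powR_ge0// -!powRrM (mulrC p).
Qed.

Section homogeneous_measures.
Context {R : realType} {d : nat} {C : convex_cone R d}.
Variables (mu : {measure set C -> \bar R}) (a : R).
Hypothesis a_gt0 : 0 < a.
Hypothesis mu_dil : forall (l : R) (A : set C), 0 < l -> measurable A ->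
  mu (dil l @^-1` A) = ((l `^ (- (2 * a)))%:E * mu A)%E.

Lemma ge0_integral_dil (l : R) (f : C -> \bar R) : 0 < l ->
  measurable_fun setT f -> (forall x, 0 <= f x)%E ->
  (\int[mu]_x f (dil l x) = (l `^ (- (2 * a)))%:E * \int[mu]_x f x)%E.
Proof.
move=> l0 mf f0; have ml := @measurable_dil R d C l.
have L0 : 0 <= l `^ (- (2 * a)) by exact: powR_ge0.
pose m : {measure set C -> \bar R} := measure_image mu ml.
transitivity (\int[m]_x f x)%E; first by rewrite [RHS]ge0_integral_pushforward.
transitivity (\int[mscale (NngNum L0) mu]_x f x)%E; last exact: ge0_integral_mscale.
by apply: eq_measure_integral => A mA _; rewrite [LHS]mu_dil.
Qed.

Lemma rint_dil (l : R) (f : C -> R) : 0 < l -> rint mu f ->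
  rint mu (fun x => f (dil l x)).
Proof.
move=> l0 intf; have mf := rint_measurable intf.
apply/integrableP; split.
  by apply/measurable_EFinP; apply: (measurableT_comp mf); exact: measurable_dil.
move/integrableP : intf => [mEf fin].
rewrite (ge0_integral_dil (f := fun x => `|(f x)%:E|)%E)//; last exact: measurableT_comp.
by rewrite lte_mul_pinfty// ?lee_fin ?powR_ge0.
Qed.

Lemma Rintegral_dil (l : R) (f : C -> R) : 0 < l -> rint mu f ->
  \int[mu]_x f (dil l x) = l `^ (- (2 * a)) * \int[mu]_x f x.
Proof.
move=> l0 intf; have mf := rint_measurable intf.
have mE : measurable_fun setT (EFin \o f) by exact/measurable_EFinP.
rewrite /Rintegral integralE [in RHS]integralE.
have eP : (\int[mu]_x (fun x => (f (dil l x))%:E)^\+ x =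
    (l `^ (- (2 * a)))%:E * \int[mu]_x (EFin \o f)^\+ x)%E.
  rewrite -ge0_integral_dil//; last exact: measurable_funepos.
  by apply: eq_integral => x _; rewrite !funeposE.
have eN : (\int[mu]_x (fun x => (f (dil l x))%:E)^\- x =
    (l `^ (- (2 * a)))%:E * \int[mu]_x (EFin \o f)^\- x)%E.
  rewrite -ge0_integral_dil//; last exact: measurable_funeneg.
  by apply: eq_integral => x _; rewrite !funenegE.
rewrite eP eN -muleBr//; last first.
  exact: integrable_add_def.
by rewrite fineM//= -integralE; exact: integrable_fin_num.
Qed.

Hypothesis mu_annulus : (mu [set x : C | (1 < enorm (cone_val x) <= 2)%R] < +oo)%E.
Hypothesis mu_origin : mu [set x : C | enorm (cone_val x) = 0] = 0%E.

Let shell (s : R) := [set x : C | s < enorm (cone_val x) <= 2 * s].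

Let measurable_shell s : measurable (shell s).
Proof.
have := measurable_cone_enorm (C := C) (measurable_itv `]s, (2 * s)]).
by congr measurable; apply/seteqP; split => x /=; rewrite in_itv.
Qed.

(** [shell s] is the preimage of [shell 1] under the dilation by 1/s. *)
Let mu_shell s : 0 < s -> mu (shell s) = ((s `^ (2 * a))%:E * mu (shell 1))%E.
Proof.
move=> s0; have s'0 : 0 < s^-1 by rewrite invr_gt0.
rewrite (_ : s `^ (2 * a) = s^-1 `^ (- (2 * a))); last first.
  by rewrite -powR_inv1 ?ltW// -powRrM mulrN mulN1r opprK.
rewrite -mu_dil//; congr (mu _); apply/funext => x; rewrite /shell /=.
rewrite dilE// enorm_scale ?(ltW s'0)// ltr_pdivlMl// ler_pdivrMl// !mulr1.
by rewrite (mulrC s 2).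
Qed.

(** Comparison with a geometric series: the shell of radius [s k] contributes at most [c k] times
    its measure, that is B q^k times the measure of the unit shell. The radii may shrink to 0 or
    grow to infinity; both cases occur. *)
Lemma dyadic_integral (W : C -> R) (E : set C) (s c : nat -> R) (q B : R) :
  measurable_fun setT W -> (forall x, 0 <= W x) -> measurable E ->
  (forall k, 0 < s k) -> (forall k, 0 <= c k) -> 0 < q < 1 -> 0 <= B ->
  (forall k, c k * s k `^ (2 * a) <= B * q ^+ k) ->
  (forall x, E x -> exists k, s k < enorm (cone_val x) <= 2 * s k) ->
  (forall k x, s k < enorm (cone_val x) <= 2 * s k -> W x <= c k) ->
  (\int[mu]_(x in E) (W x)%:E < +oo)%E.
Proof.
move=> mW W0 mE s0 c0 /andP[q0 q1] B0 csB Es Wc.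
have mshell : mu (shell 1) \is a fin_num.
  by rewrite ge0_fin_numE// /shell mulr1.
pose F k (x : C) : \bar R := (c k * \1_(shell (s k)) x)%:E.
have F0 k x : (0 <= F k x)%E by rewrite lee_fin mulr_ge0.
have mF k : measurable_fun setT (F k).
  by apply/measurable_EFinP; apply: measurable_funM => //; exact: measurable_indic.
apply: (@le_lt_trans _ _ (\int[mu]_x \sum_(k <oo) F k x)%E).
  apply: (@le_trans _ _ (\int[mu]_(x in E) \sum_(k <oo) F k x)%E).
    apply: ge0_le_integral => //.
    - by move=> x _; rewrite lee_fin.
    - by apply: measurable_funTS; exact/measurable_EFinP.
    - by apply: measurable_funTS; exact: ge0_emeasurable_sum.
    - move=> x /Es[k sk].
      apply: (@le_trans _ _ (\sum_(0 <= i < k.+1) F i x)%E); last first.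
        exact: nneseries_lim_ge.
      rewrite big_nat_recr//= -[leLHS]add0e leeD ?sume_ge0//.
      by rewrite /F lee_fin indicE mem_set// mulr1 (Wc k).
  apply: ge0_subset_integral => //; first exact: ge0_emeasurable_sum.
  by move=> x _; exact: nneseries_ge0.
rewrite integral_nneseries//.
apply: (@le_lt_trans _ _ (B * (1 - q)^-1 * fine (mu (shell 1)))%:E); last exact: ltry.
apply: lime_le; first by apply: is_cvg_nneseries => k _ _; exact: integral_ge0.
apply: nearW => n; apply: (@le_trans _ _ (\sum_(0 <= k < n)
    (B * q ^+ k * fine (mu (shell 1)))%:E)%E).
  apply: lee_sum => k _; rewrite /F; under eq_integral do rewrite EFinM.
  rewrite ge0_integralZl//; last 2 first.
    by apply/measurable_EFinP; exact: measurable_indic.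
    by rewrite lee_fin.
  rewrite integral_indic// setIT (mu_shell (s0 k)) muleA -EFinM [leRHS]EFinM fineK//.
  by apply: lee_wpmul2r => //; rewrite lee_fin.
rewrite sumEFin lee_fin -mulr_suml ler_wpM2r ?fine_ge0//.
by have := geometric_le_lim n B0 q0 ltac:(by rewrite ger0_norm// ltW).
Qed.

(** The origin is null. In the unit ball the shells of radius 2^(-k-1) give the ratio 2^(- 2 a),
    less than 1 as a > 0; outside it the shells of radius 2^k give the ratio 2^(2 a - p), less than
    1 by the decay assumed of [W]. *)
Lemma radial_integrable (W : C -> R) (c p : R) : measurable_fun setT W ->
  (forall x, 0 <= W x <= c) -> 2 * a < p ->
  (forall x, W x * enorm (cone_val x) `^ p <= c) -> rint mu W.
Proof.
move=> mW Wc ap Wp; have W0 x : 0 <= W x by have /andP[] := Wc x.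
have c0 : 0 <= c by have /andP[h1] := Wc point; exact: le_trans.
apply/ge0_rintP => //.
pose E1 := [set x : C | enorm (cone_val x) = 0].
pose E2 := [set x : C | 0 < enorm (cone_val x) <= 1].
pose E3 := [set x : C | 1 < enorm (cone_val x)].
have m1 : measurable E1 by exact: (measurable_cone_enorm (C := C) (measurable_set1 0)).
have m2 : measurable E2.
  have := measurable_cone_enorm (C := C) (measurable_itv `]0, 1]).
  by congr measurable; apply/seteqP; split => x /=; rewrite in_itv.
have m3 : measurable E3.
  have := measurable_cone_enorm (C := C) (measurable_itv `]1, +oo[).
  by congr measurable; apply/seteqP; split => x /=; rewrite in_itv/= andbT.
have TE : [set: C] = E1 `|` (E2 `|` E3).
  apply/esym/seteqP; split => // x _ /=.
  have : 0 <= enorm (cone_val x) by exact: sqrtr_ge0.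
  rewrite le_eqVlt => /orP[/eqP x0|x0]; first by left.
  right; have [h|h] := leP (enorm (cone_val x)) 1; [left|right] => //.
  by rewrite /E2 /= x0.
have mWE D : measurable_fun D (EFin \o W) by apply: measurable_funTS; exact/measurable_EFinP.
rewrite TE ge0_integral_setU//; last 3 first.
- exact: measurableU.
- by move=> x _; rewrite lee_fin.
- apply/disj_set2P/seteqP; split => // x [].
  by rewrite /E1 /E2 /E3 /= => x0 []; rewrite x0 ?ltxx// ltNge ler01.
rewrite [X in (_ + X)%E]ge0_integral_setU//; last 2 first.
- by move=> x _; rewrite lee_fin.
- apply/disj_set2P/seteqP; split => // x []; rewrite /E2 /E3 /= => /andP[_ h1] h2.
  by have := le_lt_trans h1 h2; rewrite ltxx.
have h1a : (1 : R) `^ (2 * a) = 1 by rewrite powR1.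
rewrite null_set_integral// add0e lte_add_pinfty//.
- apply: (@dyadic_integral W _ (fun k => 2^-1 ^+ k.+1) (fun=> c) (2^-1 `^ (2 * a)) c) => //.
  + apply/andP; split; first exact: powR_gt0.
    rewrite -[ltRHS]h1a; apply: gt0_ltr_powR; rewrite ?nnegrE ?mulr_gt0//.
    by rewrite invf_lt1// ltr1n.
  + move=> k; apply: ler_wpM2l => //.
    rewrite powR_exprn ?invr_ge0// exprS ler_piMl ?exprn_ge0 ?powR_ge0//.
    rewrite -[leRHS]h1a; apply: ge0_ler_powR; rewrite ?nnegrE ?mulr_ge0 ?ltW//.
    by rewrite invf_lt1// ltr1n.
  + move=> x /= /andP[x0 x1].
    have ex : exists k, 2^-1 ^+ k.+1 < enorm (cone_val x).
      have [k hk] : exists k, (enorm (cone_val x))^-1 < 2 ^+ k.+1 :> R.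
        exists (Num.bound (enorm (cone_val x))^-1).
        apply: (lt_trans (archi_boundP _)); first by rewrite invr_ge0 ltW.
        by rewrite -natrX ltr_nat (ltn_trans (ltnSn _))// ltn_expl.
      by exists k; rewrite exprVn invf_plt ?posrE ?exprn_gt0.
    (* Minimality of k provides the upper bound |x| <= 2^(-k); for k = 0 this is |x| <= 1. *)
    exists (ex_minn ex); case: ex_minnP => -[|k] hk kmin; rewrite hk/=.
      by rewrite expr1 mulfV// pnatr_eq0.
    rewrite exprS mulrA mulfV ?mul1r; last by rewrite pnatr_eq0.
    rewrite leNgt; apply/negP => /kmin; by rewrite ltnn.
  + by move=> k x _; have /andP[] := Wc x.
- apply: (@dyadic_integral W _ (fun k => 2 ^+ k) (fun k => c * (2 ^+ k) `^ (- p))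
    (2 `^ (2 * a - p)) c) => //.
  + by move=> k; rewrite mulr_ge0// powR_ge0.
  + rewrite powR_gt0//= -opprB powRN invf_lt1 ?powR_gt0//.
    have h1 : (1 : R) `^ (p - 2 * a) = 1 by rewrite powR1.
    by rewrite -[ltLHS]h1 gt0_ltr_powR ?subr_gt0 ?nnegrE// ltr1n.
  + move=> k; rewrite -mulrA ler_wpM2l// -powRD; last by rewrite expf_eq0 pnatr_eq0 andbF implybT.
    by rewrite powR_exprn// addrC.
  + move=> x /= x1.
    have ex : exists k, enorm (cone_val x) <= 2 ^+ k.+1.
      exists (Num.bound (enorm (cone_val x))); apply: ltW.
      apply: (lt_trans (archi_boundP _)); first by rewrite sqrtr_ge0.
      by rewrite -natrX ltr_nat (ltn_trans (ltnSn _))// ltn_expl.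
    (* Minimality of k provides the lower bound 2^k < |x|; for k = 0 this is 1 < |x|. *)
    exists (ex_minn ex); case: ex_minnP => -[|k] hk kmin; rewrite -exprS hk andbT.
      by rewrite expr0.
    rewrite ltNge; apply/negP => /kmin; by rewrite ltnn.
  + move=> k x /andP[xk _]; have k0 : 0 < 2 ^+ k :> R by rewrite exprn_gt0.
    rewrite powRN ler_pdivlMr ?powR_gt0//; apply: le_trans (Wp x).
    apply: ler_wpM2l => //; apply: ge0_ler_powR; rewrite ?nnegrE ?ltW//.
    * by rewrite (lt_trans _ ap)// mulr_gt0.
    * exact: lt_trans xk.
Qed.

Lemma gauss_integrable (b : R) :
  rint mu (fun x => weight b x * expR (- enorm (cone_val x) ^+ 2)).
Proof.
have [N [bN aN]] : exists N : nat, b <= N%:R /\ 2 * a < N%:R.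
  exists (Num.bound (Num.max `|b| (2 * a))).
  have h : Num.max `|b| (2 * a) < (Num.bound (Num.max `|b| (2 * a)))%:R.
    by apply: archi_boundP; rewrite le_max normr_ge0.
  split; first by rewrite (le_trans _ (ltW h))// le_max ler_norm.
  by rewrite (le_lt_trans _ h)// le_max lexx orbT.
(* Of the 2N powers of 1 + |x|, N dominate the weight and N give the decay asked by
   [radial_integrable]. The constant comes from u^M <= M! e^u at u = 1 + t and from 1 + t - t^2 <=
   2. *)
pose M := (N + N)%N; pose c : R := M`!%:R * expR 2.
have key t : 0 <= t -> (1 + t) ^+ M * expR (- t ^+ 2) <= c.
  move=> t0; have t1 : 0 <= 1 + t by rewrite addr_ge0.
  apply: (@le_trans _ _ ((M`!%:R * expR (1 + t)) * expR (- t ^+ 2))).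
    by rewrite ler_wpM2r ?expR_ge0// exprn_le_expR.
  rewrite -mulrA -expRD ler_wpM2l// ler_expR.
  have := sqr_ge0 (t - 2^-1); nra.
have wN (x : C) : weight b x <= (1 + enorm (cone_val x)) ^+ N.
  rewrite -powR_mulrn ?addr_ge0 ?sqrtr_ge0//; apply: ler_powR => //.
  by rewrite lerDl sqrtr_ge0.
have e0 (x : C) : 0 <= enorm (cone_val x) :> R by exact: sqrtr_ge0.
have le1 (x : C) : (1 + enorm (cone_val x)) ^+ N <= (1 + enorm (cone_val x)) ^+ M.
  by apply: ler_weXn2l; [rewrite lerDl e0|rewrite leq_addr].
apply: (@radial_integrable _ c N%:R) => //.
- apply: measurable_funM; first exact: measurable_weight.
  apply: measurableT_comp => //; apply: measurableT_comp => //.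
  apply: measurable_funX.
  exact: (measurableT_comp (@measurable_enorm R d) (@measurable_cone_val R d C)).
- move=> x; rewrite mulr_ge0 ?powR_ge0 ?expR_ge0//=; apply: le_trans (key _ (e0 x)).
  by rewrite ler_wpM2r ?expR_ge0// (le_trans (wN x)).
- move=> x; apply: le_trans (key _ (e0 x)); rewrite mulrAC ler_wpM2r ?expR_ge0//.
  rewrite exprD; apply: ler_pM; rewrite ?powR_ge0//.
  by rewrite powR_mulrn// lerXn2r ?nnegrE ?addr_ge0// lerDr ler01.
Qed.

(** Balls around the origin have finite measure: the indicator of the ball of radius n is at most
    e^(n^2) times the Gaussian, which is integrable. *)
Lemma homogeneous_sigma_finite : sigma_finite setT mu.
Proof.
pose F n := [set x : C | enorm (cone_val x) <= n%:R].
have mF n : measurable (F n).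
  have := measurable_cone_enorm (C := C) (measurable_itv `]-oo, n%:R]).
  by congr measurable; apply/seteqP; split => x /=; rewrite in_itv.
exists F.
  apply/esym/seteqP; split => // x _; exists (Num.bound (enorm (cone_val x))) => //=.
  by apply: ltW; apply: archi_boundP; exact: sqrtr_ge0.
move=> n; split => //.
have h : rint mu (fun x => weight 0 x * expR (- enorm (cone_val x) ^+ 2)).
  exact: gauss_integrable.
have : rint mu (fun x => \1_(F n) x : R).
  apply: (rint_dom _ (rintZ (expR (n%:R ^+ 2)) h)) => [|x]; first exact: measurable_indic.
  rewrite /weight powRr0 mul1r -expRD indicE; case: (boolP (x \in F n)) => [/set_mem xF|_].
    by rewrite normr1 -[leLHS](@expR0 R) ler_expR subr_ge0 lerXn2r ?nnegrE ?sqrtr_ge0//.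
  by rewrite /= mulr0n normr0 expR_ge0.
move=> /integrable_lty; rewrite integral_indic// setIT; exact.
Qed.

End homogeneous_measures.

(** * Polynomials times exponentials of polynomials *)

Section polynomial_expressions.
Context {R : realType} {d : nat}.

(** Polynomials are kept as syntax, so that partial differentiation is a recursive function and
    every iterated derivative of p exp(-q) can be written in the same form. *)
Inductive pexp : Type :=
| PCst of R
| PVar of 'I_d
| PAdd of pexp & pexp
| PMul of pexp & pexp.

Fixpoint peval (p : pexp) (x : 'rV[R]_d) : R :=
  match p with
  | PCst c => c
  | PVar i => x 0 i
  | PAdd p q => peval p x + peval q x
  | PMul p q => peval p x * peval q x
  end.

Fixpoint pderiv (i : 'I_d) (p : pexp) : pexp :=
  match p with
  | PCst _ => PCst 0
  | PVar j => PCst (i == j)%:R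
  | PAdd p q => PAdd (pderiv i p) (pderiv i q)
  | PMul p q => PAdd (PMul p (pderiv i q)) (PMul q (pderiv i p))
  end.

Fixpoint pexpX (p : pexp) (n : nat) : pexp :=
  if n is n'.+1 then PMul p (pexpX p n') else PCst 1.

Lemma pevalX p n x : peval (pexpX p n) x = peval p x ^+ n.
Proof. by elim: n => [|n ih] /=; rewrite ?expr0// ih exprS. Qed.

Definition psum (s : seq pexp) : pexp := foldr PAdd (PCst 0) s.

Lemma peval_sum s x : peval (psum s) x = \sum_(p <- s) peval p x.
Proof. by elim: s => [|p s ih] /=; rewrite ?big_nil// big_cons ih. Qed.

(** Passing to the restriction to a line makes the one-variable chain rule for the exponential
    applicable. *)
Lemma is_derive_lineP (f : 'rV[R]_d -> R) (x v : 'rV[R]_d) (df : R) :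
  is_derive x v f df <-> is_derive (0 : R) (1 : R) (fun h : R => f (h *: v + x)) df.
Proof.
have e : (fun h : R => h^-1 *: ((f \o shift x) (h *: v) - f x)) =
  (fun h : R => h^-1 *: (((fun h : R => f (h *: v + x)) \o shift 0) (h *: 1) -
    f (0 *: v + x))).
  by apply/funext => h /=; rewrite addr0 scale0r add0r [h *: 1]mulr1.
split=> -[h1 h2]; split.
- by rewrite /derivable -e.
- by rewrite -h2 /derive -e.
- by rewrite /derivable e.
- by rewrite -h2 /derive e.
Qed.

Lemma is_derive_peval p (x : 'rV[R]_d) i :
  is_derive x 'e_i (peval p) (peval (pderiv i p) x).
Proof.
elim: p => [c|j|p ihp q ihq|p ihp q ihq] /=.
- exact: is_derive_cst.
- apply/is_derive_lineP.
  rewrite (_ : (fun _ => _) = (fun h : R => h * (i == j)%:R + x 0 j)).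
    by apply: is_derive_eq; rewrite scaler0 add0r addr0 [_ *: 1]mulr1.
  by apply/funext => h; rewrite !mxE eqxx eq_sym.
- exact: is_deriveD.
- exact: is_deriveM.
Qed.

Lemma continuous_peval p : continuous (peval p).
Proof.
elim: p => [c|j|p ihp q ihq|p ihp q ihq] /= x.
- exact: cst_continuous.
- exact: coord_continuous.
- by apply: continuousD; [exact: ihp|exact: ihq].
- by apply: continuousM; [exact: ihp|exact: ihq].
Qed.

Lemma coord_le_enorm (x : 'rV[R]_d) i : `|x 0 i| <= enorm x.
Proof.
rewrite -sqrtr_sqr ler_wsqrtr// (bigD1 i)//= lerDl sumr_ge0// => j _.
exact: sqr_ge0.
Qed.

Lemma peval_growth p : exists c n, 0 <= c /\
  forall x, `|peval p x| <= c * (1 + enorm x) ^+ n.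
Proof.
have e0 (x : 'rV[R]_d) : 0 <= enorm x by exact: sqrtr_ge0.
have e1 (x : 'rV[R]_d) : 1 <= 1 + enorm x by rewrite lerDl e0.
have e1' (x : 'rV[R]_d) : 0 <= 1 + enorm x by rewrite addr_ge0.
elim: p => [c|j|p [c [n [c0 cp]]] q [c' [n' [c'0 cq]]]
  |p [c [n [c0 cp]]] q [c' [n' [c'0 cq]]]] /=.
- by exists `|c|, 0%N; split => // x; rewrite expr0 mulr1.
- exists 1, 1%N; split => // x; rewrite mul1r expr1 (le_trans (coord_le_enorm _ _))//.
  by rewrite lerDr ler01.
- exists (c + c'), (n + n')%N; split=> [|x]; first exact: addr_ge0.
  rewrite (le_trans (ler_normD _ _))// mulrDl; apply: lerD.
    rewrite (le_trans (cp x))// ler_wpM2l//; apply: ler_weXn2l => //.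
    exact: leq_addr.
  rewrite (le_trans (cq x))// ler_wpM2l//; apply: ler_weXn2l => //.
  exact: leq_addl.
- exists (c * c'), (n + n')%N; split=> [|x]; first exact: mulr_ge0.
  by rewrite normrM exprD mulrACA ler_pM.
Qed.

Lemma exprn_gauss_bound (n : nat) : exists M : R, forall t, 0 <= t ->
  (1 + t) ^+ n * expR (- t ^+ 2) <= M.
Proof.
exists (n`!%:R * expR 2) => t t0; have t1 : 0 <= 1 + t by rewrite addr_ge0.
apply: (@le_trans _ _ ((n`!%:R * expR (1 + t)) * expR (- t ^+ 2))).
  by rewrite ler_wpM2r ?expR_ge0// exprn_le_expR.
rewrite -mulrA -expRD ler_wpM2l// ler_expR.
have := sqr_ge0 (t - 2^-1); nra.
Qed.

Definition pgauss (p q : pexp) (x : 'rV[R]_d) : R := peval p x * expR (- peval q x).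

Lemma is_derive_pgauss p q (x : 'rV[R]_d) i : is_derive x 'e_i (pgauss p q)
  (pgauss (PAdd (pderiv i p) (PMul (PCst (-1)) (PMul p (pderiv i q)))) q x).
Proof.
have /is_derive_lineP hp := is_derive_peval p x i.
have /is_derive_lineP hq := is_derive_peval q x i.
apply/is_derive_lineP.
pose P (h : R) := peval p (h *: 'e_i + x).
pose Q (h : R) := peval q (h *: 'e_i + x).
have hQ : is_derive (0 : R) (1 : R) (fun h => - Q h) (- peval (pderiv i q) x).
  exact: is_deriveN.
have hE : is_derive (0 : R) (1 : R) (expR \o (fun h => - Q h))
    (expR (- Q 0) * - peval (pderiv i q) x).
  exact: is_derive1_comp.
have hM := @is_deriveM _ _ P (expR \o (fun h => - Q h)) 0 1 _ _ hp hE.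
rewrite [X in is_derive _ _ X _](_ : _ = P * (expR \o (fun h => - Q h)))//.
apply: (@is_derive_eq _ _ _ _ _ _ _ _ hM).
rewrite /P /Q /pgauss /= scale0r add0r.
by rewrite /GRing.scale /=; ring.
Qed.

Lemma partials_pgauss s p q : exists p', partials s (pgauss p q) = pgauss p' q.
Proof.
elim: s => [|i s [p' ih]] /=; first by exists p.
exists (PAdd (pderiv i p') (PMul (PCst (-1)) (PMul p' (pderiv i q)))).
rewrite ih; apply/funext => x; rewrite /partial.
by have [_ ->] := is_derive_pgauss p' q x i.
Qed.

(** Every iterated derivative is a polynomial times the same exponential, and q >= |x|^2 makes this
    exponential beat all polynomial growth. *)
Lemma schwartz_pgauss p q : (forall x, enorm x ^+ 2 <= peval q x) ->
  schwartz_real (pgauss p q).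
Proof.
move=> hq s; have [p' ->] := partials_pgauss s p q; split.
- move=> x; apply: continuousM; first exact: continuous_peval.
  apply: (@continuous_comp _ _ _ (fun x => - peval q x) expR); last exact: continuous_expR.
  by apply: continuousN; exact: continuous_peval.
- by move=> i x; have [] := is_derive_pgauss p' q x i.
- move=> k; have [c [n [c0 cn]]] := peval_growth p'.
  have [M hM] := exprn_gauss_bound (k + n).
  exists (c * M) => x; have e0 : 0 <= enorm x by exact: sqrtr_ge0.
  apply: le_trans (ler_wpM2l c0 (hM _ e0)); rewrite normrM (ger0_norm (expR_ge0 _)).
  rewrite (_ : c * _ = (1 + enorm x) ^+ k * ((c * (1 + enorm x) ^+ n) *
    expR (- enorm x ^+ 2))); last by rewrite exprD; ring.
  apply: ler_pM; rewrite ?exprn_ge0// ?mulr_ge0 ?expR_ge0//.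
    by rewrite lerXn2r ?nnegrE ?addr_ge0// lerDr ler01.
  by apply: ler_pM; rewrite ?expR_ge0// ler_expR lerN2.
Qed.

Definition sqnorm_exp : pexp := psum [seq pexpX (PVar i) 2 | i <- enum 'I_d].

Lemma peval_sqnorm x : peval sqnorm_exp x = enorm x ^+ 2.
Proof.
rewrite peval_sum big_map /enorm sqr_sqrtr; last first.
  by apply: sumr_ge0 => i _; exact: sqr_ge0.
by rewrite big_enum /=; apply: eq_bigr => i _; rewrite mulr1.
Qed.

Lemma schwartz_real0 : schwartz_real (fun _ : 'rV[R]_d => 0).
Proof.
rewrite (_ : (fun=> 0) = pgauss (PCst 0) sqnorm_exp); last first.
  by apply/funext => x; rewrite /pgauss /= mul0r.
by apply: schwartz_pgauss => x; rewrite peval_sqnorm.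
Qed.

End polynomial_expressions.

(** * Dominated convergence and pi-systems *)

Section density_measures.
Context {disp : measure_display} {T : measurableType disp} {R : realType}.
Variable mu : {measure set T -> \bar R}.

Lemma dominated_Rintegral_cvg (f_ : nat -> T -> R) (f g : T -> R) :
  (forall n, measurable_fun setT (f_ n)) -> measurable_fun setT f -> rint mu g ->
  (forall n x, `|f_ n x| <= g x) -> (forall x, f_ ^~ x @ \oo --> f x) ->
  (fun n => \int[mu]_x f_ n x) @ \oo --> \int[mu]_x f x.
Proof.
move=> mf_ mf ig fg ff.
have h1 n : measurable_fun setT (EFin \o f_ n) by exact/measurable_EFinP.
have h2 : measurable_fun setT (EFin \o f) by exact/measurable_EFinP.
have h3 : {ae mu, forall x, setT x -> (fun n => (EFin \o f_ n) x) @ \oo --> (EFin \o f) x}.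
  by apply: aeW => x _; apply: cvg_EFin; [exact: nearW|exact: ff].
have h4 : {ae mu, forall x n, setT x -> (`|(EFin \o f_ n) x| <= (EFin \o g) x)%E}.
  by apply: aeW => x n _; rewrite /= lee_fin.
have [intf _ h] := dominated_convergence measurableT h1 h2 h3 ig h4.
apply: fine_cvg; rewrite /Rintegral fineK//; exact: integrable_fin_num.
Qed.

Section density.
Variable f : T -> R.

(* The proof arguments let canonical structures find the measure instance. *)
Definition density_measure (_ : measurable_fun setT f) (_ : forall x, 0 <= f x)
  (A : set T) : \bar R := (\int[mu]_(x in A) (f x)%:E)%E.

Hypotheses (mf : measurable_fun setT f) (f0 : forall x, 0 <= f x).
Local Notation W := (density_measure mf f0).

Let density0 : W set0 = 0%E. Proof. exact: integral_set0. Qed.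

Let density_ge0 A : (0 <= W A)%E.
Proof. by apply: integral_ge0 => x _; rewrite lee_fin. Qed.

Let density_sigma_additive : semi_sigma_additive W.
Proof.
apply: semi_sigma_additive_nng_induced => [|x]; last by rewrite lee_fin.
exact/measurable_EFinP.
Qed.

HB.instance Definition _ := isMeasure.Build _ _ _ W
  density0 density_ge0 density_sigma_additive.

End density.

(** The positive and negative parts of [g] are densities of two finite measures that agree on the
    pi-system, hence on all measurable sets; so [g] has integral zero over each of them. *)
Lemma integral_pi_system_ae0 (G : set (set T)) (g : T -> R) :
  measurable = <<s G >> -> setI_closed G -> G setT -> rint mu g ->
  (forall A, G A -> \int[mu]_x (g x * \1_A x) = 0) ->
  {ae mu, forall x, g x = 0}.
Proof.
move=> mG GI GT ig gA; have mg := rint_measurable ig.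
have mp : measurable_fun setT (g^\+) by exact: measurable_funrpos.
have mn : measurable_fun setT (g^\-) by exact: measurable_funrneg.
have ip : rint mu (g^\+) by exact: integrable_funrpos.
have in_ : rint mu (g^\-) by exact: integrable_funrneg.
have p0 x : 0 <= g^\+ x by exact: funrpos_ge0.
have n0 x : 0 <= g^\- x by exact: funrneg_ge0.
pose mup : {measure set T -> \bar R} := density_measure mp p0.
pose mun : {measure set T -> \bar R} := density_measure mn n0.
have fin (h : T -> R) A : measurable A -> rint mu h ->
    (\int[mu]_(x in A) (h x)%:E = (\int[mu]_x (h x * \1_A x))%:E)%E.
  move=> mA ih; have ihA := rint_indic mA ih.
  rewrite /Rintegral fineK; last exact: integrable_fin_num.
  rewrite integral_mkcond; apply: eq_integral => x _.
  by rewrite patchE indicE; case: ifPn => _; rewrite ?mulr1 ?mulr0.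
have GmE A : G A -> measurable A by move=> GA; rewrite mG; exact: sub_sigma_algebra.
have pn A : measurable A -> \int[mu]_x (g x * \1_A x) =
    \int[mu]_x (g^\+ x * \1_A x) - \int[mu]_x (g^\- x * \1_A x).
  move=> mA; rewrite -RintegralB//; [|exact: rint_indic|exact: rint_indic].
  apply: eq_Rintegral => x _; rewrite -mulrBl; congr (_ * _).
  by rewrite -[in LHS](funrposBneg g).
have upn A : measurable A -> mup A = mun A.
  apply: (measure_unique G (fun=> setT)) => //.
  - by apply/seteqP; split => // x _; exists 0%N.
  - move=> B GB; have mB := GmE _ GB.
    rewrite [LHS](fin _ _ mB ip) [RHS](fin _ _ mB in_); congr EFin.
    by apply/eqP; rewrite -subr_eq0 -pn// gA.
  - by move=> _; exact: integrable_lty ip.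
have : ae_eq mu setT (EFin \o g) (cst 0%E).
  apply: integral_ae_eq => // E _ mE.
  rewrite [LHS](fin g)// integral0 pn//.
  have := upn _ mE; rewrite [LHS](fin _ _ mE ip) [RHS](fin _ _ mE in_) => -[->].
  by rewrite subrr.
by apply: filterS => x /(_ I) [].
Qed.

End density_measures.

(** * Exponential approximation of sharp cutoffs *)

Section power_cutoff.
Context {R : realType}.

(** Half of the exponent compensates n: since z^n is the least of the first n powers up to it, n z^n
    is at most the geometric sum 1 / (1 - z). The other half tends to 0. *)
Lemma cvg_natM_expr (z : R) : 0 <= z < 1 ->
  (fun n : nat => n%:R * z ^+ n.*2) @ \oo --> (0 : R).
Proof.
move=> /andP[z0 z1].
have bnd n : n%:R * z ^+ n <= (1 - z)^-1.
  have [->|z0'] := eqVneq z 0.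
    rewrite subr0 invr1; case: n => [|n]; first by rewrite mul0r.
    by rewrite exprS mul0r mulr0.
  have zp : 0 < z by rewrite lt_neqAle eq_sym z0'.
  have := geometric_le_lim n (ler01 : 0 <= 1 :> R) zp ltac:(by rewrite ger0_norm).
  rewrite mul1r; apply: le_trans; rewrite /series /geometric /=.
  rewrite -[X in X%:R * _](subn0 n) -sumr_const_nat mulr_suml.
  apply: ler_sum_nat => k /andP[_ kn]; rewrite !mul1r.
  by apply: ler_wiXn2l => //; [exact: ltW z1|exact: ltnW].
apply: (@squeeze_cvgr _ _ _ _ (fun=> 0) (fun n => (1 - z)^-1 * z ^+ n)).
- apply: nearW => n; rewrite mulr_ge0 ?exprn_ge0//= -addnn exprD mulrA.
  by rewrite ler_wpM2r ?exprn_ge0.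
- exact: cvg_cst.
- rewrite -[X in _ --> X](mulr0 (1 - z)^-1); apply: cvgMr.
  by apply: cvg_expr; rewrite ger0_norm.
Qed.

(** For |y| >= 1 the exponent is at most -n, and exp(-n) <= 1 / (1 + n). The factor n settles the
    boundary |y| = 1, where the powers alone stay equal to 1. *)
Lemma cvg_power_cutoff (y : R) :
  (fun n : nat => expR (- (n%:R * (y ^+ 2) ^+ n.*2))) @ \oo --> ((`|y| < 1)%R%:R : R).
Proof.
have [y1|y1] := ltP `|y| 1.
  have : expR (- (n%:R * (y ^+ 2) ^+ n.*2)) @[n --> \oo] --> expR (- (0 : R)).
    apply: continuous_cvg; first exact: continuous_expR.
    apply: cvgN; apply: cvg_natM_expr; rewrite sqr_ge0/=.
    by rewrite -real_normK ?num_real// expr_lt1.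
  by rewrite oppr0 expR0.
have y2 : 1 <= y ^+ 2 by rewrite -real_normK ?num_real// exprn_ege1.
apply: (@squeeze_cvgr _ _ _ _ (fun=> 0) harmonic).
- apply: nearW => n; rewrite expR_ge0/= expRN.
  rewrite /harmonic lef_pV2 ?posrE ?expR_gt0 ?ltr0n//.
  apply: (le_trans _ (expR_ge1Dx _)); rewrite -natr1 addrC lerD2l.
  by rewrite ler_peMr// exprn_ege1.
- exact: cvg_cst.
- exact: cvg_harmonic.
Qed.

End power_cutoff.

(** * Gaussian-type test functions on a cone *)

Section test_functions.
Context {R : realType} {d : nat} {C : convex_cone R d}.

(** The lower bound makes these functions Schwartz. The degree of [q] is unrestricted, since the
    approximate cutoffs use unbounded powers. *)
Definition gauss_test : set (C -> R) := [set phi | exists q : @pexp R d,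
  (forall x, enorm x ^+ 2 <= peval q x) /\
  forall x : C, phi x = expR (- peval q (cone_val x))].

(** For t = (i, c, k) this is (x_i - c) k, of absolute value less than 1 exactly on the slab |x_i -
    c| < 1/k when k > 0. *)
Definition slab_exp (t : 'I_d * R * R) : @pexp R d :=
  PMul (PAdd (PVar t.1.1) (PCst (- t.1.2))) (PCst t.2).

Definition slabs (s : seq ('I_d * R * R)) : set C :=
  [set x | all (fun t => `|peval (slab_exp t) (cone_val x)| < 1) s].

(* As n tends to infinity, n y ^ (4 n) tends to 0 if |y| < 1 and to +oo
   otherwise, so that the exponential of minus this polynomial tends to
   exp (- |x| ^ 2) times the indicator function of [slabs s]. *)
Fixpoint cutoff_exp (s : seq ('I_d * R * R)) (n : nat) : @pexp R d :=
  if s is t :: s' then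
    PAdd (PMul (PCst n%:R) (pexpX (pexpX (slab_exp t) 2) n.*2)) (cutoff_exp s' n)
  else sqnorm_exp.

Lemma peval_cutoff_cons t s n x : peval (cutoff_exp (t :: s) n) x =
  n%:R * (peval (slab_exp t) x ^+ 2) ^+ n.*2 + peval (cutoff_exp s n) x.
Proof.
by rewrite -[LHS]/(n%:R * peval (pexpX (pexpX (slab_exp t) 2) n.*2) x + _) !pevalX.
Qed.

Lemma cutoff_exp_ge s n x : enorm x ^+ 2 <= peval (cutoff_exp s n) x.
Proof.
elim: s => [|t s ih]; first by rewrite /= peval_sqnorm.
rewrite peval_cutoff_cons.
apply: (le_trans ih); rewrite lerDr; apply: mulr_ge0 => //.
by apply: exprn_ge0; exact: sqr_ge0.
Qed.

Lemma cvg_cutoff s (x : C) :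
  (fun n : nat => expR (- peval (cutoff_exp s n) (cone_val x))) @ \oo -->
  expR (- enorm (cone_val x) ^+ 2) * \1_(slabs s) x.
Proof.
elim: s => [|t s ih].
  rewrite (_ : \1_(slabs [::]) x = 1) ?mulr1; last by rewrite indicE mem_set.
  by under eq_fun do rewrite [cutoff_exp _ _]/= peval_sqnorm; exact: cvg_cst.
rewrite (_ : _ * _ = (`|peval (slab_exp t) (cone_val x)| < 1)%R%:R *
    (expR (- enorm (cone_val x) ^+ 2) * \1_(slabs s) x)); last first.
  rewrite mulrCA; congr (_ * _); rewrite !indicE -natrM mulnb; congr (_%:R).
  congr nat_of_bool; apply/idP/andP => [/set_mem|[h1 /set_mem h2]].
    by rewrite /slabs /= => /andP[h1 h2]; split => //; exact/mem_set.
  by apply/mem_set; rewrite /slabs /= h1.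
rewrite (_ : (fun n => _) = (fun n => expR (- (n%:R *
    (peval (slab_exp t) (cone_val x) ^+ 2) ^+ n.*2))) \*
    (fun n => expR (- peval (cutoff_exp s n) (cone_val x)))).
  by apply: cvgM => //; exact: cvg_power_cutoff.
by apply/funext => n; rewrite peval_cutoff_cons opprD expRD.
Qed.

Lemma measurable_peval (q : @pexp R d) :
  measurable_fun setT (fun x : C => peval q (cone_val x)).
Proof.
apply: (measurableT_comp _ (@measurable_cone_val R d C)).
by apply: rV_continuous_measurable; exact: continuous_peval.
Qed.

Lemma measurable_slabs s : measurable (slabs s).
Proof.
elim: s => [|t s ih].
  by rewrite (_ : slabs _ = setT)//; apply/seteqP.
rewrite (_ : slabs _ = (fun x : C => `|peval (slab_exp t) (cone_val x)|) @^-1` `]-oo, 1[ `&`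
  slabs s).
  apply: measurableI => //; rewrite -[X in measurable X]setTI.
  by apply: measurableT_comp => //; exact: measurable_peval.
by apply/seteqP; split => x /=; rewrite /slabs/= in_itv/= => /andP.
Qed.

(** A sup-norm ball is an intersection of slabs, one per coordinate, and an open set is a countable
    union of rational balls. *)
Lemma slabs_generate : @measurable _ C = <<s range slabs >>.
Proof.
apply/seteqP; split; last first.
  apply: smallest_sub; first exact: sigma_algebra_measurable.
  by move=> _ [s _ <-]; exact: measurable_slabs.
apply: smallest_sub; first exact: smallest_sigma_algebra.
move=> _ /cone_openP[B oB <-].
pose sq (p : 'rV[rat]_d * nat) :=
  [seq (i, ratr (p.1 0 i) : R, p.2.+1%:R : R) | i <- enum 'I_d].
have slabsE p : slabs (sq p) = @cone_val R d C @^-1` qball p.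
  apply/seteqP; split => x.
    move=> /allP h; split; first by rewrite invr_gt0.
    move=> i j; rewrite mxE /ball /= ord1.
    have /h : (j, ratr (p.1 0 j) : R, p.2.+1%:R : R) \in sq p.
      by apply/mapP; exists j; rewrite ?mem_enum.
    by rewrite /= normrM normr_nat -ltr_pdivlMr ?ltr0n// div1r distrC.
  move=> [_ h]; apply/allP => _ /mapP[j _ ->] /=.
  have := h 0 j; rewrite mxE /ball /= => hj.
  by rewrite normrM normr_nat -ltr_pdivlMr ?ltr0n// div1r distrC.
pose F n : set C := if unpickle n is Some p
  then [set x | qball p `<=` B /\ slabs (sq p) x] else set0.
rewrite (_ : _ @^-1` B = \bigcup_n F n).
  have sG : sigma_algebra setT (<<s range slabs >>) by exact: smallest_sigma_algebra.
  have [s0 _ sU] := sG; apply: sU => n; rewrite /F.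
  case: unpickle => [p|//].
  have [pB|pB] := pselect (qball p `<=` B); last first.
    by rewrite (_ : mkset _ = set0)//; apply/seteqP; split => x // -[].
  rewrite (_ : mkset _ = slabs (sq p)).
    by apply: sub_sigma_algebra; exists (sq p).
  by apply/seteqP; split => x /= => [[]|].
apply/seteqP; split => [x /= Bx|x [n _]]; last first.
  by rewrite /F; case: unpickle => [p [pB]|//]; rewrite slabsE => /pB.
have /qballP[p [px pB]] : nbhs (cone_val x) B by exact: open_nbhs_nbhs.
by exists (pickle p) => //; rewrite /F pickleK /= slabsE.
Qed.

Variables (mu : {measure set C -> \bar R}).
Hypothesis gauss_int : forall b : R,
  rint mu (fun x => weight b x * expR (- enorm (cone_val x) ^+ 2)).

Let E (x : C) : R := expR (- enorm (cone_val x) ^+ 2).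

Let E_int : rint mu E.
Proof.
have := gauss_int 0; congr rint; apply/funext => x.
by rewrite /weight powRr0 mul1r.
Qed.

Let E_le1 x : 0 <= E x <= 1.
Proof. by rewrite expR_ge0/= -[leRHS](@expR0 R) ler_expR oppr_le0 sqr_ge0. Qed.

Lemma gauss_test_le phi : gauss_test phi -> forall x, 0 <= phi x <= E x.
Proof.
by move=> [q [hq phiE]] x; rewrite phiE expR_ge0/= ler_expR lerN2.
Qed.

Lemma measurable_gauss_test phi : gauss_test phi -> measurable_fun setT phi.
Proof.
move=> [q [_ phiE]]; rewrite (_ : phi = fun x : C => expR (- peval q (cone_val x))).
  by apply: measurableT_comp => //; apply: measurableT_comp => //; exact: measurable_peval.
exact/funext.
Qed.

Lemma gauss_test_int (b : bool) (phi : C -> R) (k c : R) : gauss_test phi -> 0 <= k ->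
  sqint mu (cpair b phi) /\ wint mu (fun x => k * weight c x) (cpair b phi).
Proof.
move=> Dphi k0; have phiE := gauss_test_le Dphi; have mphi := measurable_gauss_test Dphi.
have cphi : cmeasurable (cpair b phi).
  by case: b; split => //=; exact: measurable_cst.
have phi0 x : 0 <= phi x by case/andP: (phiE x).
have pE x : phi x <= E x by case/andP: (phiE x).
have dotE x : cdot (cpair b phi x) (cpair b phi x) = phi x ^+ 2.
  by rewrite /cpair /cdot; case: b {cphi} => /=; rewrite !(mul0r, add0r, addr0) expr2.
split; split => //.
  under eq_fun do rewrite dotE.
  apply: (rint_dom _ E_int) => [|x]; first exact: measurable_funX.
  have /andP[e0 e1] := E_le1 x; rewrite ger0_norm ?sqr_ge0// expr2.
  apply: (le_trans _ (pE x)); rewrite ler_piMr//; exact: le_trans (pE x) e1.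
have nE x : Normc.normc (cpair b phi x) = phi x.
  by rewrite -[RHS]ger0_norm// -sqrtr_sqr -dotE -sqr_normc sqrtr_sqr ger0_norm ?normc_ge0.
under eq_fun do rewrite nE.
apply: (rint_dom _ (rintZ k (gauss_int c))) => [|x].
  by apply: measurable_funM => //; apply: measurable_funM => //; exact: measurable_weight.
rewrite ger0_norm ?mulr_ge0 ?powR_ge0// mulrCA ler_wpM2l// mulrC.
by rewrite ler_wpM2l ?powR_ge0.
Qed.

Lemma gauss_test_schwartz b phi : gauss_test phi -> schwartz (cpair b phi).
Proof.
move=> [q [hq phiE]].
have h1 : schwartz_real (fun x => expR (- peval q x)).
  have := schwartz_pgauss (PCst 1) hq; congr schwartz_real.
  by apply/funext => x; rewrite /pgauss /= mul1r.
exists (fun x => if b then (expR (- peval q x))%:C%C else Complex 0 (expR (- peval q x))).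
by case: b; split => //=; [exact: schwartz_real0|move=> x; rewrite phiE
  |exact: schwartz_real0|move=> x; rewrite phiE].
Qed.

(** With [E] the Gaussian, [E * H] is integrable, and the test functions given by [cutoff_exp]
    converge to [E] times the indicator of [slabs s] while staying below [E]. So [E * H] has
    integral zero over each [slabs s]; these sets form a generating pi-system, and [E] is
    positive. *)
Lemma gauss_test_total (k c : R) : 0 <= k ->
  total mu (fun x => k * weight c x) gauss_test.
Proof.
move=> k0 H mH [h [M [mh h2 hH]]] testH.
pose g x := E x * H x.
have mE : measurable_fun setT E by exact: rint_measurable E_int.
have E0 x : 0 <= E x by case/andP: (E_le1 x).
(* An integrable majorant of E |H|: as E <= 1, the product E |h| is at most h^2 + E. *)
pose B x := h x ^+ 2 + E x + `|M| * k * (weight c x * E x).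
have iB : rint mu B by apply: rintD; [exact: rintD|exact: rintZ].
have HB x : E x * `|H x| <= B x.
  apply: (le_trans (ler_wpM2l (E0 x) (hH x))); rewrite mulrDr; apply: lerD.
    have /andP[_ e1] := E_le1 x; have := E0 x.
    rewrite -[h x ^+ 2](real_normK (num_real _)).
    move: (`|h x|) (E x) e1 (sqr_ge0 (`|h x| - E x)) => u e e1; nra.
  have w0 : 0 <= k * weight c x by rewrite mulr_ge0// powR_ge0.
  have := ler_wpM2r w0 (ler_norm M) => h3.
  apply: (le_trans (ler_wpM2l (E0 x) h3)).
  by rewrite le_eqVlt; apply/orP; left; apply/eqP; ring.
have mg : measurable_fun setT g by exact: measurable_funM.
have ig : rint mu g.
  by apply: (rint_dom _ iB) => // x; rewrite normrM (ger0_norm (E0 x)).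
suff : {ae mu, forall x, g x = 0}.
  apply: filterS => x /eqP; rewrite mulf_eq0 => /orP[|/eqP//].
  by rewrite gt_eqF// expR_gt0.
apply: (integral_pi_system_ae0 slabs_generate) => //.
- move=> _ _ [s _ <-] [t _ <-]; exists (s ++ t) => //.
  apply/seteqP; split => x; rewrite /slabs /= all_cat; first by move/andP.
  by move=> [-> ->].
- by exists [::] => //; apply/seteqP.
- move=> _ [s _ <-].
  pose f_ n x := expR (- peval (cutoff_exp s n) (cone_val x)) * H x.
  have test_n n : gauss_test (fun x => expR (- peval (cutoff_exp s n) (cone_val x))).
    by exists (cutoff_exp s n); split => // x; exact: cutoff_exp_ge.
  have f_0 : (fun n => \int[mu]_x f_ n x) = fun=> 0.
    by apply/funext => n; exact: testH.
  have : (fun n => \int[mu]_x f_ n x) @ \oo --> \int[mu]_x (g x * \1_(slabs s) x).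
    apply: (@dominated_Rintegral_cvg _ _ _ mu f_ _ B) => //.
    + by move=> n; apply: measurable_funM => //; exact: measurable_gauss_test.
    + by apply: measurable_funM => //; apply: measurable_indic; exact: measurable_slabs.
    + move=> n x; rewrite normrM ger0_norm ?expR_ge0//; apply: le_trans (HB x).
      by rewrite ler_wpM2r//; have /andP[] := gauss_test_le (test_n n) x.
    + move=> x; rewrite /g mulrAC; apply: cvgMl; exact: cvg_cutoff.
  rewrite f_0 => h0; apply/esym; exact: (cvg_unique _ (cvg_cst 0) h0).
Qed.

End test_functions.

(** * Weights of dilated sets *)

Lemma powR_continuous_pos (R : realType) (x p : R) : 0 < x ->
  {for x, continuous (fun t : R => t `^ p)}.
Proof.
move=> x0; apply: differentiable_continuous; apply/derivable1_diffP.
by apply: derivable_powR; rewrite in_itv/= x0.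
Qed.

Section weighted_dilations.
Context {R : realType} {d : nat} {C : convex_cone R d}.
Variables (mu : {measure set C -> \bar R}) (a : R).
Hypothesis mu_dil : forall (l : R) (A : set C), 0 < l -> measurable A ->
  mu (dil l @^-1` A) = ((l `^ (- (2 * a)))%:E * mu A)%E.
Variables (b : R) (U : set C).
Hypotheses (b_ge0 : 0 <= b) (mU : measurable U).

(** The real-valued counterpart of [weighted mu b], meaningful when the integrand is integrable. *)
Definition wset (A : set C) : R := \int[mu]_x (weight b x * \1_A x).

Lemma rint_weightP (A : set C) : measurable A ->
  rint mu (fun x => weight b x * \1_A x) <-> (weighted mu b A < +oo)%E.
Proof.
move=> mA; have mw : measurable_fun setT (fun x : C => weight b x * \1_A x).
  by apply: measurable_funM; [exact: measurable_weight|exact: measurable_indic].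
have e : (\int[mu]_x (weight b x * \1_A x)%:E = weighted mu b A)%E.
  rewrite /weighted [RHS]integral_mkcond; apply: eq_integral => x _.
  by rewrite patchE indicE; case: ifPn => _; rewrite ?mulr1 ?mulr0.
rewrite -e; apply: ge0_rintP => // x.
by rewrite mulr_ge0// powR_ge0.
Qed.

Lemma wset_ge0 A : 0 <= wset A.
Proof. by apply: Rintegral_ge0 => x _; rewrite mulr_ge0// powR_ge0. Qed.

Lemma measurable_dil_preimage l (A : set C) : measurable A ->
  measurable (dil l @^-1` A).
Proof. by move=> mA; rewrite -[X in measurable X]setTI; exact: measurable_dil. Qed.

(** 1 + s t <= M (1 + t) as soon as s <= M and 1 <= M; the exponent [b] is nonnegative. *)
Lemma weight_dil (s M : R) (x : C) : 0 < s -> s <= M -> 1 <= M ->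
  weight b (dil s x) <= M `^ b * weight b x.
Proof.
move=> s0 sM M1; have e0 : 0 <= enorm (cone_val x) by exact: sqrtr_ge0.
have M0 : 0 <= M by rewrite (le_trans _ M1).
rewrite /weight dilE// enorm_scale ?(ltW s0)// -powRM ?addr_ge0//.
have se0 : 0 <= s * enorm (cone_val x) by rewrite mulr_ge0// ltW.
have Me0 : 0 <= M * (1 + enorm (cone_val x)) by rewrite mulr_ge0 ?addr_ge0.
apply: ge0_ler_powR; rewrite ?nnegrE ?addr_ge0//.
by rewrite mulrDr mulr1 lerD// ler_wpM2r.
Qed.

Hypothesis U_int : rint mu (fun x => weight b x * \1_U x).

Let mweight : measurable_fun setT (weight b : C -> R).
Proof. exact: measurable_weight. Qed.

Lemma cone_dil_cvg (s : nat -> R) (x : C) : (forall n, 0 < s n) -> s @ \oo --> (1 : R) ->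
  (fun n => cone_val (dil (s n) x)) @ \oo --> cone_val x.
Proof.
move=> s0 s1; under eq_fun do rewrite dilE//.
have : (fun n => s n *: cone_val x) @ \oo --> 1 *: cone_val x by exact: cvgZr_tmp.
by rewrite scale1r.
Qed.

Section one_sequence.
Variables (s : nat -> R) (M : R).
Hypotheses (s0 : forall n, 0 < s n) (sM : forall n, (s n)^-1 <= M) (M1 : 1 <= M).
Hypothesis s1 : s @ \oo --> (1 : R).
Hypothesis U_open : forall x, U x -> \forall n \near \oo, U (dil (s n) x).

(** The weighted indicator of the n-th dilate after the change of variables: the set no longer
    depends on n, only the weight does. *)
Let k n x := weight b (dil (s n)^-1 x) * \1_U x.

Let k_int n : rint mu (k n).
Proof.
apply: (rint_dom _ (rintZ (M `^ b) U_int)) => [|x].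
  apply: measurable_funM; last exact: measurable_indic.
  by apply: (measurableT_comp mweight); exact: measurable_dil.
rewrite ger0_norm ?mulr_ge0 ?powR_ge0// mulrA ler_wpM2r// weight_dil// ?invr_gt0//.
Qed.

Let weight_dil_preimageE n x :
  weight b x * \1_(dil (s n) @^-1` U) x = k n (dil (s n) x).
Proof. by rewrite /k dilK. Qed.

Lemma rint_weight_dil n : rint mu (fun x => weight b x * \1_(dil (s n) @^-1` U) x).
Proof.
under eq_fun do rewrite weight_dil_preimageE.
exact: rint_dil mu_dil _ _ _ _.
Qed.

Let cvg_weight (x : C) : (fun n => weight b (dil (s n)^-1 x)) @ \oo --> weight b x.
Proof.
have cv : (fun n => cone_val (dil (s n)^-1 x)) @ \oo --> cone_val x.
  apply: cone_dil_cvg; first by move=> n; rewrite invr_gt0.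
  by rewrite -[X in _ --> X]invr1; apply: cvgV => //; rewrite oner_eq0.
have e0 : 0 <= enorm (cone_val x) by exact: sqrtr_ge0.
have c1 : (fun n => 1 + enorm (cone_val (dil (s n)^-1 x))) @ \oo --> 1 + enorm (cone_val x).
  apply: cvgD; first exact: cvg_cst.
  exact: (continuous_cvg _ (@enorm_continuous R d (cone_val x)) cv).
have p0 : 0 < 1 + enorm (cone_val x) by rewrite ltr_pwDl.
exact: (continuous_cvg _ (powR_continuous_pos p0) c1).
Qed.

(* Both the weight of the dilate of U and that of its intersection with U tend
   to the weight of U. *)
Lemma wset_dil_setD_cvg : (fun n => wset ((dil (s n) @^-1` U) `\` U)) @ \oo --> (0 : R).
Proof.
pose D n := dil (s n) @^-1` U.
have mD n : measurable (D n) by exact: measurable_dil_preimage.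
have h1 : (fun n => \int[mu]_x (weight b x * \1_(D n) x)) @ \oo --> wset U.
  rewrite (_ : (fun n => _) = (fun n => s n `^ (- (2 * a)) * \int[mu]_x k n x)); last first.
    apply/funext => n; under eq_Rintegral do rewrite weight_dil_preimageE.
    by rewrite (Rintegral_dil mu_dil).
  rewrite -[X in _ --> X]mul1r; apply: cvgM.
    have h : (1 : R) `^ (- (2 * a)) = 1 by rewrite powR1.
    rewrite -[X in _ --> X]h.
    exact: (continuous_cvg _ (powR_continuous_pos ltr01) s1).
  apply: (dominated_Rintegral_cvg (g := fun x => M `^ b * (weight b x * \1_U x))).
  - by move=> n; exact: rint_measurable (k_int n).
  - exact: rint_measurable U_int.
  - exact: rintZ.
  - move=> n x; rewrite ger0_norm ?mulr_ge0 ?powR_ge0// mulrA ler_wpM2r//.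
    by rewrite weight_dil ?invr_gt0.
  - by move=> x; apply: cvgMl; exact: cvg_weight.
have h2 : (fun n => \int[mu]_x (weight b x * \1_U x * \1_(D n) x)) @ \oo --> wset U.
  apply: (dominated_Rintegral_cvg (g := fun x => weight b x * \1_U x)) => //.
  - move=> n; apply: measurable_funM; last exact: measurable_indic.
    exact: rint_measurable U_int.
  - exact: rint_measurable U_int.
  - move=> n x; rewrite ger0_norm ?mulr_ge0 ?powR_ge0//.
    by rewrite ler_piMr ?mulr_ge0 ?powR_ge0// indicE; case: (_ \in _).
  (* Here [U_open] is used: a point of [U] belongs to [D n] for all large n. *)
  - move=> x; have [/set_mem Ux|Ux] := boolP (x \in U).
      rewrite -[X in _ --> X]mulr1; apply: cvgMr.
      apply: cvg_near_cst; near=> n.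
      rewrite indicE mem_set//; near: n; exact: U_open.
    rewrite (_ : (fun n => _) = fun=> 0); last first.
      by apply/funext => n; rewrite indicE (negbTE Ux) mulr0 mul0r.
    by rewrite indicE (negbTE Ux) mulr0; exact: cvg_cst.
rewrite (_ : (fun n => _) = (fun n => \int[mu]_x (weight b x * \1_(D n) x) -
    \int[mu]_x (weight b x * \1_U x * \1_(D n) x))).
  by rewrite -[X in _ --> X](subrr (wset U)); exact: cvgB.
apply/funext => n; rewrite -RintegralB//; last 2 first.
- exact: rint_weight_dil.
- exact: rint_indic.
apply: eq_Rintegral => x _; rewrite -mulrA -mulrBr; congr (_ * _).
rewrite !indicE in_setD -/(D n).
by case: (x \in D n); case: (x \in U); rewrite /= ?mulr1 ?mulr0 ?subr0 ?subrr.
Unshelve. all: by end_near.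
Qed.

End one_sequence.

(** The union exceeds [U] by at most the N differences [D n j] minus [U]. With N fixed, the sum of
    their weights tends to 0. *)
Lemma wset_bigcup_dil (N : nat) (s : nat -> nat -> R) (M : nat -> R) (e : R) : 0 < e ->
  (forall n j, 0 < s n j) -> (forall n j, (s n j)^-1 <= M j) -> (forall j, 1 <= M j) ->
  (forall j, s ^~ j @ \oo --> (1 : R)) ->
  (forall j x, U x -> \forall n \near \oo, U (dil (s n j) x)) ->
  \forall n \near \oo,
    rint mu (fun x => weight b x * \1_(\bigcup_(j in `I_N) dil (s n j) @^-1` U) x) /\
    wset (\bigcup_(j in `I_N) dil (s n j) @^-1` U) <= wset U + e.
Proof.
move=> e0 s0 sM M1 s1 Uo.
pose D n j := dil (s n j) @^-1` U.
have mD n j : measurable (D n j) by exact: measurable_dil_preimage.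
have mB n : measurable (\bigcup_(j in `I_N) D n j).
  by apply: bigcup_measurable => j _; exact: mD.
have iD n j : rint mu (fun x => weight b x * \1_(D n j) x).
  by apply: (@rint_weight_dil (s ^~ j) (M j)).
have iDU n j : rint mu (fun x => weight b x * \1_(D n j `\` U) x).
  apply: (rint_dom _ (iD n j)) => [|x].
    by apply: measurable_funM => //; apply: measurable_indic; exact: measurableD.
  rewrite ger0_norm ?mulr_ge0 ?powR_ge0// ler_wpM2l ?powR_ge0//.
  by rewrite !indicE in_setD; case: (_ \in D n j); case: (_ \in U).
have le1 n x : \1_(\bigcup_(j in `I_N) D n j) x <=
    \1_U x + \sum_(0 <= j < N) \1_(D n j `\` U) x :> R.
  have s_ge0 : 0 <= \sum_(0 <= j < N) \1_(D n j `\` U) x :> R by apply: sumr_ge0.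
  rewrite [leLHS]indicE; have [/set_mem[j jN Dj]|_] := boolP (x \in _); last by rewrite addr_ge0.
  rewrite [\1_U _]indicE; have [xU|xU] := boolP (x \in U); first by rewrite lerDl.
  rewrite add0r big_mkord (bigD1 (Ordinal jN))//= indicE mem_set/=.
    by rewrite lerDl; apply: sumr_ge0.
  by split => //; move/mem_set; exact/negP.
have iR n : rint mu (fun x => weight b x * \1_U x +
    \sum_(0 <= j < N) weight b x * \1_(D n j `\` U) x).
  by apply: rintD => //; apply: rint_sum => j.
have iB n : rint mu (fun x => weight b x * \1_(\bigcup_(j in `I_N) D n j) x).
  apply: (rint_dom _ (iR n)) => [|x].
    by apply: measurable_funM => //; exact: measurable_indic.
  rewrite ger0_norm ?mulr_ge0 ?powR_ge0// -mulr_sumr -mulrDr.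
  by rewrite ler_wpM2l ?powR_ge0.
have cvgS : (fun n => \sum_(0 <= j < N) wset (D n j `\` U)) @ \oo --> (0 : R).
  elim: N {mB le1 iR iB} => [|N ih].
    by under eq_fun do rewrite big_nil; exact: cvg_cst.
  have h := cvgD ih (@wset_dil_setD_cvg (s ^~ N) (M N) (s0 ^~ N) (sM ^~ N) (M1 N)
    (s1 N) (Uo N)).
  rewrite addr0 in h.
  have eS : (fun n => \sum_(0 <= j < N.+1) wset (D n j `\` U)) =
      (fun n => \sum_(0 <= j < N) wset (D n j `\` U)) \+ (fun n => wset (D n N `\` U)).
    by apply/funext => n; rewrite big_nat_recr.
  rewrite eS; exact: h.
near=> n; split; first exact: iB.
have hn : `|\sum_(0 <= j < N) wset (D n j `\` U)| <= e.
  by near: n; exact: (cvgr0_norm_le _ cvgS e e0).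
apply: (@le_trans _ _ (wset U + \sum_(0 <= j < N) wset (D n j `\` U))); last first.
  by rewrite lerD2l (le_trans (ler_norm _)).
rewrite /wset -Rintegral_sum// -RintegralD//; last by apply: rint_sum => j.
apply: le_Rintegral => //; [exact: iB|exact: iR|].
move=> x _; rewrite -mulr_sumr -mulrDr.
by apply: ler_wpM2l; [exact: powR_ge0|exact: le1].
Unshelve. all: by end_near.
Qed.

End weighted_dilations.

(** * Continuity of kernel integrals *)

Section kernel_operator_limits.
Context {d1 d2 : measure_display} {X : measurableType d1} {Y : measurableType d2}
  {R : realType}.
Variable mu : {sigma_finite_measure set X -> \bar R}.

(** |f| w <= |f|^2 + w^2 on [V]. Squaring the growth of the kernel doubles its exponent, which is
    why the sets are measured with the exponents 2m and 2mh. *)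
Lemma wint_supported (w : X -> R) (V : set X) (f : X -> R[i]) : measurable V ->
  measurable_fun setT w -> (forall x, 0 <= w x) ->
  rint mu (fun x => w x ^+ 2 * \1_V x) -> sqint mu f -> (forall x, ~ V x -> f x = 0) ->
  wint mu w f.
Proof.
move=> mV mw w0 iw [mf jf] fV; split => //.
apply: (rint_dom _ (rintD jf iw)) => [|x].
  by apply: measurable_funM => //; exact: measurable_normc.
rewrite ger0_norm ?mulr_ge0 ?normc_ge0// indicE.
have [/set_mem Vx|/negP Vx] := boolP (x \in V); last first.
  by rewrite fV ?Normc.normc0 ?mul0r ?mulr0 ?addr0 ?cdot0l// => h; exact/Vx/mem_set.
rewrite mulr1 -sqr_normc.
by have := w0 x; have := normc_ge0 (f x); move: (Normc.normc _) (w x) => u v; nra.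
Qed.

Variables (K : X -> Y -> R[i]) (w1 : X -> R) (w2 : Y -> R).
Hypothesis mK : cmeasurable (fun p : X * Y => K p.1 p.2).
Hypotheses (w1_ge0 : forall x, 0 <= w1 x) (w2_ge0 : forall y, 0 <= w2 y).
Hypothesis Kw : forall x y, Normc.normc (K x y) <= w1 x * w2 y.

(** Dominated convergence; the bound [c] on [w2] along the sequence provides the common majorant c
    |f| w1. *)
Lemma kop_cvg (f : X -> R[i]) (y_ : nat -> Y) (y : Y) (c : R) : wint mu w1 f ->
  (forall n, w2 (y_ n) <= c) ->
  (forall x, (fun n => complex.Re (K x (y_ n))) @ \oo --> complex.Re (K x y)) ->
  (forall x, (fun n => complex.Im (K x (y_ n))) @ \oo --> complex.Im (K x y)) ->
  ((fun n => complex.Re (kop mu K f (y_ n))) @ \oo --> complex.Re (kop mu K f y)) /\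
  ((fun n => complex.Im (kop mu K f (y_ n))) @ \oo --> complex.Im (kop mu K f y)).
Proof.
move=> hf yc rK jK; have [mf jf] := hf.
have bnd n x : Normc.normc (f x * K x (y_ n)) <= c * (Normc.normc (f x) * w1 x).
  rewrite Normc.normcM mulrCA ler_wpM2l ?normc_ge0//.
  by rewrite (le_trans (Kw _ _))// mulrC ler_wpM2r.
have ReE (z w : R[i]) : complex.Re (z * w) =
    complex.Re z * complex.Re w - complex.Im z * complex.Im w.
  by case: z w => [? ?] [].
have ImE (z w : R[i]) : complex.Im (z * w) =
    complex.Re z * complex.Im w + complex.Im z * complex.Re w.
  by case: z w => [? ?] [].
have cst_cvg (k : R) (u : nat -> R) (l : R) : u @ \oo --> l ->
    (fun n => k * u n) @ \oo --> k * l.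
  by move=> ul; apply: cvgM => //; exact: cvg_cst.
split; apply: (dominated_Rintegral_cvg (g := fun x => c * (Normc.normc (f x) * w1 x))).
- by move=> n; exact: rint_measurable (wint_Re mK Kw (y_ n) hf).
- exact: rint_measurable (wint_Re mK Kw y hf).
- exact: rintZ.
- by move=> n x; exact: le_trans (Re_le_normc _) (bnd n x).
- move=> x; rewrite ReE; under eq_fun do rewrite ReE.
  by apply: cvgB; exact: cst_cvg.
- by move=> n; exact: rint_measurable (wint_Im mK Kw (y_ n) hf).
- exact: rint_measurable (wint_Im mK Kw y hf).
- exact: rintZ.
- by move=> n x; exact: le_trans (Im_le_normc _) (bnd n x).
- move=> x; rewrite ImE; under eq_fun do rewrite ImE.
  by apply: cvgD; exact: cst_cvg.
Qed.

Lemma kop_neq0_near (f : X -> R[i]) (y_ : nat -> Y) (y : Y) (c : R) : wint mu w1 f ->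
  (forall n, w2 (y_ n) <= c) ->
  (forall x, (fun n => complex.Re (K x (y_ n))) @ \oo --> complex.Re (K x y)) ->
  (forall x, (fun n => complex.Im (K x (y_ n))) @ \oo --> complex.Im (K x y)) ->
  kop mu K f y <> 0 -> \forall n \near \oo, kop mu K f (y_ n) <> 0.
Proof.
move=> hf yc rK jK f0; have [hr hj] := kop_cvg hf yc rK jK.
have [r0|r0] := eqVneq (complex.Re (kop mu K f y)) 0; last first.
  near=> n => f_0.
  have : complex.Re (kop mu K f (y_ n)) != 0 by near: n; exact: cvgr_neq0 hr r0.
  by rewrite f_0 eqxx.
have [j0|j0] := eqVneq (complex.Im (kop mu K f y)) 0.
  by case: f0; exact: complexP.
near=> n => f_0.
have : complex.Im (kop mu K f (y_ n)) != 0 by near: n; exact: cvgr_neq0 hj j0.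
by rewrite f_0 eqxx.
Unshelve. all: by end_near.
Qed.

End kernel_operator_limits.

Lemma measurable_cneq0 (disp : measure_display) (X : measurableType disp)
    (R : realType) (q : X -> R[i]) :
  cmeasurable q -> measurable [set x | q x <> 0].
Proof.
move=> mq; rewrite (_ : mkset _ = ~` ((fun x => cdot (q x) (q x)) @^-1` [set 0])).
  apply: measurableC; rewrite -[X in measurable X]setTI.
  exact: (measurable_cdot mq mq measurableT (measurable_set1 0)).
apply/seteqP; split => x /=; first by move=> h /cdot_eq0.
by move=> h q0; apply: h; rewrite q0 cdot0l.
Qed.

Section kernel_continuity.
Context {R : realType} {d : nat} {C D : convex_cone R d}.
Variable K : C -> D -> R[i].
Hypothesis K_cont : kernel_continuous K.

(** Continuity into [R[i]^o] is expressed by a complex-valued norm; this is its form with a real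
    bound. *)
Let K_near (p : C * D) (e : R) : 0 < e ->
  \forall q \near p, Normc.normc (K p.1 p.2 - K q.1 q.2) <= e.
Proof.
move=> e0; have := @K_cont p => /(@cvgrPdist_lt _ R[i]^o) /(_ e%:C%C).
rewrite ltcR => /(_ e0); apply: filterS => q.
rewrite normc_def => h; apply: ltW; move: h; rewrite ltcR.
by case: (K p.1 p.2 - K q.1 q.2).
Qed.

Lemma kernel_Re_continuous : continuous (fun p : C * D => complex.Re (K p.1 p.2)).
Proof.
move=> p; apply/cvgrPdist_le => e e0.
have := K_near p e0; apply: filterS => q; apply: le_trans.
apply: le_trans (Re_le_normc _).
by case: (K p.1 p.2) (K q.1 q.2) => [? ?] [].
Qed.

Lemma kernel_Im_continuous : continuous (fun p : C * D => complex.Im (K p.1 p.2)).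
Proof.
move=> p; apply/cvgrPdist_le => e e0.
have := K_near p e0; apply: filterS => q; apply: le_trans.
apply: le_trans (Im_le_normc _).
by case: (K p.1 p.2) (K q.1 q.2) => [? ?] [].
Qed.

Lemma kernel_cmeasurable : cmeasurable (fun p : C * D => K p.1 p.2).
Proof.
split; apply: continuous_cone_prod_measurable.
- exact: kernel_Re_continuous.
- exact: kernel_Im_continuous.
Qed.

Lemma dil_cvg (s : nat -> R) (x : C) : (forall n, 0 < s n) -> s @ \oo --> (1 : R) ->
  (fun n => dil (s n) x) @ \oo --> x.
Proof.
move=> s0 s1 A /cone_nbhsP[B Bx BA].
have h : \forall n \near \oo, B (cone_val (dil (s n) x)).
  exact: cone_dil_cvg s0 s1 _ Bx.
by apply: filterS h => n Bn; exact: BA.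
Qed.

End kernel_continuity.

(** * Linear independence of dilates *)

Section dilates_free.
Context {R : realType} {d : nat} {C : convex_cone R d}.
Variables (mu : {measure set C -> \bar R}) (a : R).
Hypothesis a_gt0 : 0 < a.
Hypothesis mu_dil : forall (l : R) (A : set C), 0 < l -> measurable A ->
  mu (dil l @^-1` A) = ((l `^ (- (2 * a)))%:E * mu A)%E.

(* The dilation by l < 1 has Jacobian l ^ (- 2 a) > 1. *)
Lemma absorbing_dil_eq0 (l : R) (B : set C) : 0 < l < 1 -> measurable B ->
  (mu B < +oo)%E -> mu (dil l @^-1` B `\` B) = 0%E -> mu B = 0%E.
Proof.
move=> /andP[l0 l1] mB Bfin B0.
have mD : measurable (dil l @^-1` B) by exact: measurable_dil_preimage.
have h : (mu (dil l @^-1` B) <= mu B)%E.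
  apply: (@le_trans _ _ (mu (B `|` (dil l @^-1` B `\` B)))).
    apply: le_measure; rewrite ?inE//.
    - by apply: measurableU => //; exact: measurableD.
    - by move=> x Dx; have [Bx|Bx] := pselect (B x); [left|right].
  by rewrite -[leRHS]adde0 -[in leRHS]B0; apply: measureU2 => //; exact: measurableD.
move: h; rewrite mu_dil//; have Bf : mu B \is a fin_num by rewrite ge0_fin_numE.
rewrite -(fineK Bf) -EFinM lee_fin => h.
have l2 : 1 < l `^ (- (2 * a)).
  rewrite powRN invf_gt1 ?powR_gt0//.
  have h1 : (1 : R) `^ (2 * a) = 1 by rewrite powR1.
  by rewrite -[ltRHS]h1 gt0_ltr_powR ?mulr_gt0 ?nnegrE// ltW.
congr EFin; apply/eqP; rewrite eq_le fine_ge0// andbT.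
by move: h l2; move: (fine _) (l `^ _) => u v; nra.
Qed.

(** Let i0 be the largest index with a nonzero coefficient and [B] the union of the dilates of [V]
    with index below i0. Outside a null set, the relation puts the dilate of index i0 inside [B].
    The preimage of [B] under the dilation by l is the union of the dilates of indices 1 to i0, so
    [B] absorbs it and is null; but [V], the dilate of index 0, lies in [B] up to a null set. *)
Lemma dilates_free (N : nat) (q : C -> R[i]) (l : R) (v : 'I_N -> R) :
  cmeasurable q -> 0 < l < 1 ->
  (mu [set x | q x <> 0%R] < +oo)%E -> mu [set x | q x <> 0] <> 0%E ->
  {ae mu, forall y, \sum_i (v i)%:C%C * q (dil (l ^+ i) y) = 0} -> forall i, v i = 0.
Proof.
move=> mq l01 Vfin V0 [N0 [mN0 N00 sub]] i1; apply/eqP/negPn/negP => vi1.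
have /andP[l0 l1] := l01.
set V := [set x | q x <> 0] in Vfin V0.
have mV : measurable V by exact: measurable_cneq0.
have [i0 vi0 imax] := @arg_maxnP _ i1 (fun i => v i != 0) (fun i => i : nat) vi1.
pose D j := dil (l ^+ j) @^-1` V.
have mD j : measurable (D j) by exact: measurable_dil_preimage.
pose B := \bigcup_(j in `I_i0) D j.
have mB : measurable B by apply: bigcup_measurable => j _.
have key x : D i0 x -> ~ B x -> N0 x.
  move=> Dx Bx; apply: sub => /=.
  rewrite (bigD1 i0)//= big1 => [|i ii0]; last first.
    have [ilt|] := ltnP i i0.
      have -> : q (dil (l ^+ i) x) = 0.
        by apply: contrapT => qi; apply: Bx; exists (i : nat).
      by rewrite mulr0.
    rewrite leq_eqVlt eq_sym => /orP[/eqP/val_inj ii|ilt]; first by rewrite ii eqxx in ii0.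
    have -> : v i = 0.
      by apply/eqP/negPn/negP => /imax/(leq_ltn_trans)/(_ ilt); rewrite ltnn.
    by rewrite mul0r.
  rewrite addr0 => /eqP; rewrite mulf_eq0 => /orP[/eqP h|/eqP//].
  by case/negP: vi0; apply/eqP; move: h => -[].
have Bfin : (mu B < +oo)%E.
  rewrite /B bigcup_mkord; elim: (i0 : nat) => [|n ih]; first by rewrite big_ord0 measure0.
  rewrite big_ord_recr/=; apply: (@le_lt_trans _ _ (mu (\big[setU/set0]_(i < n) D i) + mu (D n))%E).
    by apply: measureU2 => //; apply: bigsetU_measurable => j _.
  apply: lte_add_pinfty => //; rewrite /D mu_dil ?exprn_gt0//.
  by rewrite lte_mul_pinfty// ?lee_fin ?powR_ge0.
have B0 : mu B = 0%E.
  apply: (absorbing_dil_eq0 l01) => //.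
  apply: (subset_measure0 _ mN0) => //.
    by apply: measurableD => //; exact: measurable_dil_preimage.
  move=> x [[j ji Dj] Bx]; apply: key => //.
  move: Dj; rewrite /D /= dil_comp ?exprn_gt0// -exprSr => Dj.
  move: ji; rewrite /= leq_eqVlt => /orP[/eqP <-//|ji].
  by case: Bx; exists j.+1.
apply: V0; apply/eqP; rewrite eq_le measure_ge0 andbT.
apply: (@le_trans _ _ (mu (B `|` N0))).
  apply: le_measure; rewrite ?inE//; first exact: measurableU.
  move=> x Vx; have [Bx|Bx] := pselect (B x); [by left|right].
  have D0 : D 0%N x by rewrite /D /= expr0 dil1.
  (* For i0 = 0 the set [B] is empty, and the relation itself puts [V] inside the null set. *)
  have [i00|i00] := posnP i0; first by apply: key => //; rewrite i00.
  by case: Bx; exists 0%N.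
have h : (mu (B `|` N0) <= mu B + mu N0)%E by exact: measureU2.
by move: h; rewrite B0 N00 adde0.
Qed.

End dilates_free.

Lemma weight_sqr (R : realType) (d : nat) (C : convex_cone R d) (b : R) (x : C) :
  weight b x ^+ 2 = weight (2 * b) x.
Proof. by rewrite -powR_mulrn ?powR_ge0// -powRrM mulrC. Qed.

(** The measures of the theorem do not carry sigma-finiteness in their type, while Fubini asks for
    it. The structure is rebuilt on the same set function, so that the resulting equality can be
    eliminated. *)
Lemma sigma_finite_measure_pack (disp : measure_display) (T : measurableType disp)
    (R : realType) (mu : {measure set T -> \bar R}) : sigma_finite setT mu ->
  exists nu : {sigma_finite_measure set T -> \bar R},
    (nu : {measure set T -> \bar R}) = mu.
Proof.
case: mu => f [c1 c2] sf.
pose mu0 : {measure set T -> \bar R} := @Measure.Pack _ _ _ f (Measure.Class c2).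
pose mx := Measure_isSigmaFinite.Build _ _ _ mu0 sf.
pose nu : {sigma_finite_measure set T -> \bar R} := HB.pack f mu0 mx.
by exists nu.
Qed.

Lemma rint_weight_ae_subset (R : realType) (d : nat) (C : convex_cone R d)
    (mu : {measure set C -> \bar R}) (b : R) (S V : set C) :
  measurable S -> measurable V -> {ae mu, forall x, ~ S x -> ~ V x} ->
  rint mu (fun x => weight b x * \1_S x) -> rint mu (fun x => weight b x * \1_V x).
Proof.
move=> mS mV VS iS; have mw : measurable_fun setT (weight b : C -> R).
  exact: measurable_weight.
apply: (ae_rint _ _ (rint_indic mV iS)).
  by apply: measurable_funM => //; exact: measurable_indic.
apply: filterS VS => x VS; rewrite -mulrA; congr (_ * _); rewrite !indicE -natrM mulnb.
have [xV|] := boolP (x \in V); last by rewrite andbF.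
rewrite andbT mem_set//; apply: contrapT => Sx.
by apply: VS (set_mem xV).
Qed.

(** * The uncertainty principle for homogeneous measures *)

Section uncertainty.
Context {R : realType} {d : nat} {Omega Omegah : convex_cone R d}.
Variables (mu : {sigma_finite_measure set Omega -> \bar R})
  (muh : {sigma_finite_measure set Omegah -> \bar R}) (a : R).
Hypothesis a_gt0 : 0 < a.
Hypothesis mu_dil : forall (l : R) (A : set Omega), 0 < l -> measurable A ->
  mu (dil l @^-1` A) = ((l `^ (- (2 * a)))%:E * mu A)%E.
Hypothesis muh_dil : forall (l : R) (A : set Omegah), 0 < l -> measurable A ->
  muh (dil l @^-1` A) = ((l `^ (- (2 * a)))%:E * muh A)%E.
Hypothesis mu_gauss : forall b : R,
  rint mu (fun x => weight b x * expR (- enorm (cone_val x) ^+ 2)).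
Hypothesis muh_gauss : forall b : R,
  rint muh (fun x => weight b x * expR (- enorm (cone_val x) ^+ 2)).
Variables (K : Omega -> Omegah -> R[i]) (cT m mh : R).
Hypotheses (m_ge0 : 0 <= m) (mh_ge0 : 0 <= mh).
Hypothesis K_cont : kernel_continuous K.
Hypothesis K_bnd : kernel_bounded K cT m mh.
Hypothesis K_hom : kernel_homogeneous K.
Variable T : (Omega -> R[i]) -> (Omegah -> R[i]).
Hypothesis T_ext : unitary_extension mu muh K T.

(** The absolute value is taken since [kernel_bounded] does not fix the sign of [cT]. The factor 1
    in [w2] gives both weights the shape expected by [gauss_test_total]. *)
Let w1 (x : Omega) : R := `|cT| * weight m x.
Let w2 (y : Omegah) : R := 1 * weight mh y.

Let w1_ge0 x : 0 <= w1 x. Proof. by rewrite mulr_ge0// powR_ge0. Qed.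

Let w2_ge0 y : 0 <= w2 y. Proof. by rewrite mulr_ge0// powR_ge0. Qed.

Let w1_sqr x : w1 x ^+ 2 = cT ^+ 2 * weight (2 * m) x.
Proof. by rewrite exprMn weight_sqr real_normK ?num_real. Qed.

Let w2_sqr y : w2 y ^+ 2 = weight (2 * mh) y.
Proof. by rewrite /w2 mul1r weight_sqr. Qed.

Let mw1 : measurable_fun setT w1.
Proof. by apply: measurable_funM => //; exact: measurable_weight. Qed.

Let mw2 : measurable_fun setT w2.
Proof. by apply: measurable_funM => //; exact: measurable_weight. Qed.

Let mK : cmeasurable (fun p : Omega * Omegah => K p.1 p.2).
Proof. exact: kernel_cmeasurable. Qed.

Let Kw x y : Normc.normc (K x y) <= w1 x * w2 y.
Proof.
apply: (le_trans (K_bnd x y)); rewrite /w1 /w2 mul1r -/(weight m x) -/(weight mh y).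
by rewrite ler_wpM2r ?powR_ge0// ler_wpM2r ?powR_ge0// ler_norm.
Qed.

Let mK' := cmeasurable_adjK mK.
Let Kw' := adjK_bound Kw.

Let T_sqint f : sqint mu f -> sqint muh (T f).
Proof. by move=> /cLfun2P hf; apply/cLfun2P; exact: ue_Lfun T_ext _ hf. Qed.

Let T_add f g : sqint mu f -> sqint mu g ->
  {ae muh, forall y, T (fun x => f x + g x) y = T f y + T g y}.
Proof.
move=> /cLfun2P hf /cLfun2P hg; have := ue_linear T_ext 1 hf hg.
rewrite (_ : (fun x => 1 * f x + g x) = (fun x => f x + g x)).
  by apply: filterS => y ->; rewrite mul1r.
by apply/funext => x; rewrite mul1r.
Qed.

Let T_iso f : sqint mu f -> rip muh (T f) (T f) = rip mu f f.
Proof. by move=> /cLfun2P hf; rewrite !cLnorm2_rip (ue_isometry T_ext hf). Qed.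

Let T_onto h : sqint muh h -> exists2 f, sqint mu f & {ae muh, forall y, T f y = h y}.
Proof.
move=> /cLfun2P /(ue_onto T_ext)[f [/cLfun2P hf fh]]; by exists f.
Qed.

Let D1 : set (Omega -> R) := gauss_test.
Let D2 : set (Omegah -> R) := gauss_test.

Let D1_int b phi : D1 phi -> sqint mu (cpair b phi) /\ wint mu w1 (cpair b phi).
Proof. by move=> h; exact: gauss_test_int. Qed.

Let D2_int b phi : D2 phi -> sqint muh (cpair b phi) /\ wint muh w2 (cpair b phi).
Proof. by move=> h; exact: gauss_test_int. Qed.

Let D1_total : total mu w1 D1. Proof. exact: gauss_test_total. Qed.

Let D2_total : total muh w2 D2. Proof. exact: gauss_test_total. Qed.

Let T_D1 b phi : D1 phi ->
  {ae muh, forall y, T (cpair b phi) y = kop mu K (cpair b phi) y}.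
Proof. by move=> h; apply: (ue_extends T_ext); exact: gauss_test_schwartz. Qed.

Let T_rip f g : sqint mu f -> sqint mu g -> rip muh (T f) (T g) = rip mu f g.
Proof. exact: unitary_rip. Qed.

Let T_inv f g : sqint mu f -> wint muh w2 g -> sqint muh g ->
  {ae muh, forall y, T f y = g y} -> {ae mu, forall x, f x = kop muh (adjK K) g x}.
Proof.
exact: (unitary_inv_kop mK w2_ge0 Kw T_sqint T_add T_iso D1_total D1_int T_D1).
Qed.

Let T_kop f : sqint mu f -> wint mu w1 f -> {ae muh, forall y, T f y = kop mu K f y}.
Proof.
exact: (unitary_kop mK w1_ge0 w2_ge0 Kw T_sqint T_add T_iso T_onto D1_total D2_total
  D1_int D2_int T_D1).
Qed.

Let sqint_dil q s : 0 < s -> sqint muh q -> sqint muh (fun y => q (dil s y)).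
Proof.
move=> s0 [[rq jq] iq]; split.
  by split; [apply: (measurableT_comp rq)|apply: (measurableT_comp jq)];
    exact: measurable_dil.
exact: (rint_dil muh_dil s0 iq).
Qed.

(** Homogeneity gives K(x, y) = K(x / s, s y); the change of variables from s y to y then produces
    the Jacobian s^(- 2 a). *)
Lemma adj_kop_dil q s x : 0 < s -> wint muh w2 q ->
  kop muh (adjK K) (fun y => q (dil s y)) x =
  (s `^ (- (2 * a)))%:C%C * kop muh (adjK K) q (dil s^-1 x).
Proof.
move=> s0 hq; rewrite /kop /cintegral.
have e y : adjK K y x = adjK K (dil s y) (dil s^-1 x).
  rewrite /adjK; congr (_^*%C); apply: (K_hom s0); last by rewrite dilE.
  by rewrite dilE ?invr_gt0// scalerA mulfV ?gt_eqF// scale1r.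
apply: complexP => /=; rewrite !(mul0r, subr0, addr0).
- rewrite -(Rintegral_dil muh_dil s0 (wint_Re mK' Kw' (dil s^-1 x) hq)).
  by apply: eq_Rintegral => y _; rewrite e.
- rewrite -(Rintegral_dil muh_dil s0 (wint_Im mK' Kw' (dil s^-1 x) hq)).
  by apply: eq_Rintegral => y _; rewrite e.
Qed.

(* The ratios s n are bounded above, as the growth of the kernel requires for
   the dominated convergence in [kop_neq0_near]. *)
Definition radially_open (C : convex_cone R d) (U : set C) :=
  forall (s : nat -> R) (M : R), (forall n, 0 < s n <= M) -> s @ \oo --> (1 : R) ->
  forall x, U x -> \forall n \near \oo, U (dil (s n) x).

(** The kernel is continuous and [w2] stays bounded along the dilates of a point, so the kernel
    integral converges along them and being nonzero persists. *)
Lemma kop_radially_open f : wint mu w1 f ->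
  radially_open [set y | kop mu K f y <> 0].
Proof.
move=> hf s M sM s1 y /= f0; have s0 n : 0 < s n by case/andP: (sM n).
have M0 : 0 <= Num.max 1 M by rewrite le_max ler01.
have pc (x : Omega) : (fun n => (x, dil (s n) y)) @ \oo --> (x, y).
  move=> A [[P Q] /= [Px Qy] PQ].
  have h : \forall n \near \oo, Q (dil (s n) y) by exact: dil_cvg s0 s1 _ Qy.
  by apply: filterS h => n Qn; apply: PQ; split => //; exact: nbhs_singleton Px.
(* [weight_dil] wants a bound on the ratios that is at least 1, hence the maximum. *)
apply: (kop_neq0_near mK w1_ge0 Kw (c := 1 * (Num.max 1 M `^ mh * weight mh y)) hf _ _ _ f0).
- move=> n; rewrite /w2 ler_wpM2l// weight_dil//.
    by rewrite le_max; case/andP: (sM n) => _ ->; rewrite orbT.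
  by rewrite le_max lexx.
- move=> x; have c := pc x.
  apply: (@continuous_cvg _ _ _ _ _ _
    (fun p : Omega * Omegah => complex.Re (K p.1 p.2)) _ _ c).
  exact: kernel_Re_continuous.
- move=> x; have c := pc x.
  apply: (@continuous_cvg _ _ _ _ _ _
    (fun p : Omega * Omegah => complex.Im (K p.1 p.2)) _ _ c).
  exact: kernel_Im_continuous.
Qed.

Lemma adj_radially_open g : wint muh w2 g ->
  radially_open [set x | kop muh (adjK K) g x <> 0].
Proof.
move=> hg s M sM s1 x /= f0; have s0 n : 0 < s n by case/andP: (sM n).
have M0 : 0 <= Num.max 1 M by rewrite le_max ler01.
have pc (y : Omegah) : (fun n => (dil (s n) x, y)) @ \oo --> (x, y).
  move=> A [[P Q] /= [Px Qy] PQ].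
  have h : \forall n \near \oo, P (dil (s n) x) by exact: dil_cvg s0 s1 _ Px.
  by apply: filterS h => n Pn; apply: PQ; split => //; exact: nbhs_singleton Qy.
apply: (kop_neq0_near mK' w2_ge0 Kw'
  (c := `|cT| * (Num.max 1 M `^ m * weight m x)) hg _ _ _ f0).
- move=> n; rewrite /w1 ler_wpM2l// weight_dil//.
    by rewrite le_max; case/andP: (sM n) => _ ->; rewrite orbT.
  by rewrite le_max lexx.
- move=> y; rewrite /adjK; have c := pc y.
  have ReJ (z : R[i]) : complex.Re z^*%C = complex.Re z by case: z.
  rewrite ReJ; under eq_fun do rewrite ReJ.
  apply: (@continuous_cvg _ _ _ _ _ _
    (fun p : Omega * Omegah => complex.Re (K p.1 p.2)) _ _ c).
  exact: kernel_Re_continuous.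
- move=> y; rewrite /adjK; have c := pc y.
  have ImJ (z : R[i]) : complex.Im z^*%C = - complex.Im z by case: z.
  rewrite ImJ; under eq_fun do rewrite ImJ.
  apply: cvgN.
  apply: (@continuous_cvg _ _ _ _ _ _
    (fun p : Omega * Omegah => complex.Im (K p.1 p.2)) _ _ c).
  exact: kernel_Im_continuous.
Qed.

(** Ratios increasing to 1 from 1/2: they stay below 1, as [dilates_free] requires, and their
    inverses stay below 2. *)
Let scales (n : nat) : R := 1 - 2^-1 * harmonic n.

Let scales_itv n : 2^-1 <= scales n < 1.
Proof.
have h0 : 0 < harmonic n :> R by rewrite invr_gt0 ltr0n.
have h1 : harmonic n <= 1 :> R by rewrite invf_le1 ?ler1n ?ltr0n.
by rewrite /scales; apply/andP; split; lra.
Qed.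

Let scales_gt0 n : 0 < scales n.
Proof. by have /andP[h _] := scales_itv n; apply: lt_le_trans h; rewrite invr_gt0. Qed.

Let scales_cvg : scales @ \oo --> (1 : R).
Proof.
have h : scales @ \oo --> (1 - 2^-1 * 0 : R).
  apply: cvgB; first exact: cvg_cst.
  by apply: cvgM; [exact: cvg_cst|exact: cvg_harmonic].
by move: h; rewrite mulr0 subr0.
Qed.

Let scalesX_cvg j : (fun n => scales n ^+ j) @ \oo --> (1 : R).
Proof.
elim: j => [|j ih]; first by under eq_fun do rewrite expr0; exact: cvg_cst.
under eq_fun do rewrite exprS.
have h := cvgM scales_cvg ih; rewrite mulr1 in h; exact: h.
Qed.

Let scalesX_gt0 n j : 0 < scales n ^+ j. Proof. by rewrite exprn_gt0. Qed.

Let scalesX_le1 n j : scales n ^+ j <= 1.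
Proof. by rewrite exprn_ile1 ?(ltW (scales_gt0 n))//; case/andP: (scales_itv n) => _ /ltW. Qed.

Let scalesX_ge n j : (scales n ^+ j)^-1 <= 2 ^+ j.
Proof.
rewrite -exprVn; have sV : (scales n)^-1 <= 2.
  have /andP[h _] := scales_itv n.
  by rewrite -[leRHS]invrK lef_pV2 ?posrE ?invr_gt0.
by apply: lerXn2r; rewrite ?nnegrE// invr_ge0 ltW.
Qed.

(* The N dilates of q and of p stay supported in sets of almost the same
   weight as V and U once the ratio is close enough to 1, which bounds N. *)
Lemma uncertainty_pair (q : Omegah -> R[i]) (p := kop muh (adjK K) q)
    (U := [set x | p x <> 0]) (V := [set y | q y <> 0]) :
  sqint muh q -> wint muh w2 q -> radially_open V -> measurable U -> measurable V ->
  rint mu (fun x => weight (2 * m) x * \1_U x) ->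
  rint muh (fun y => weight (2 * mh) y * \1_V y) ->
  (muh V < +oo)%E -> muh V = 0%E.
Proof.
move=> q2 qw Vopen mU mV iU iV Vfin; apply: contrapT => V0.
have Uopen : radially_open U := adj_radially_open qw.
have m2 : 0 <= 2 * m by rewrite mulr_ge0.
have mh2 : 0 <= 2 * mh by rewrite mulr_ge0.
(* The allowance 1 is arbitrary; what matters is that these bounds do not involve N, which is then
   chosen beyond the Hilbert-Schmidt bound they give. *)
pose WU := wset mu (2 * m) U + 1; pose WV := wset muh (2 * mh) V + 1.
have WU0 : 0 <= WU by rewrite addr_ge0// wset_ge0.
have WV0 : 0 <= WV by rewrite addr_ge0// wset_ge0.
pose N := Num.bound (2 * (cT ^+ 2 * WV * WU)).
have NE : 2 * (cT ^+ 2 * WV * WU) < N%:R.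
  apply: archi_boundP; apply: mulr_ge0 => //; apply: mulr_ge0 => //.
  by apply: mulr_ge0 => //; exact: sqr_ge0.
(* By [adj_kop_dil], the dilation of [q] by l^j becomes that of [p] by l^(-j). The constants bound
   the inverse ratios: l^j <= 1 on this side, l^(-j) <= 2^j on the other. *)
have hU := wset_bigcup_dil mu_dil m2 mU iU N (s := fun n j => (scales n ^+ j)^-1)
  (M := fun=> 1) ltr01.
have hV := wset_bigcup_dil muh_dil mh2 mV iV N (s := fun n j => scales n ^+ j)
  (M := fun j => 2 ^+ j) ltr01.
have [n [[iUU leUU] [iVV leVV]]] : exists n,
   (rint mu (fun x => weight (2 * m) x *
       \1_(\bigcup_(j in `I_N) dil (scales n ^+ j)^-1 @^-1` U) x) /\
     wset mu (2 * m) (\bigcup_(j in `I_N) dil (scales n ^+ j)^-1 @^-1` U) <= WU) /\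
   (rint muh (fun y => weight (2 * mh) y *
       \1_(\bigcup_(j in `I_N) dil (scales n ^+ j) @^-1` V) y) /\
     wset muh (2 * mh) (\bigcup_(j in `I_N) dil (scales n ^+ j) @^-1` V) <= WV).
  apply: (@filter_ex _ \oo); apply: filterI.
  - apply: hU.
    + by move=> n j; rewrite invr_gt0.
    + by move=> n j; rewrite invrK.
    + by [].
    + by move=> j; rewrite -[X in _ --> X]invr1; apply: cvgV.
    + move=> j x Ux; apply: (Uopen _ (2 ^+ j)) => //.
        by move=> n; rewrite invr_gt0 scalesX_gt0 scalesX_ge.
      by rewrite -[X in _ --> X]invr1; apply: cvgV.
  - apply: hV => //.
    + by move=> j; rewrite exprn_ege1// ler1n.
    + move=> j y Vy; apply: (Vopen _ 1) => // n.
      by rewrite scalesX_gt0 scalesX_le1.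
set UU := \bigcup_(j in _) _ in iUU leUU.
set VV := \bigcup_(j in _) _ in iVV leVV.
pose l := scales n.
have l01 : 0 < l < 1 by rewrite /l scales_gt0/=; have /andP[] := scales_itv n.
have mUU : measurable UU.
  by apply: bigcup_measurable => j _; apply: measurable_dil_preimage.
have mVV : measurable VV.
  by apply: bigcup_measurable => j _; apply: measurable_dil_preimage.
pose g (i : 'I_N) y := q (dil (l ^+ i) y).
pose f (i : 'I_N) := kop muh (adjK K) (g i).
have g2 i : sqint muh (g i) by apply: sqint_dil => //; exact: scalesX_gt0.
have gV i y : ~ VV y -> g i y = 0.
  move=> Vy; apply: contrapT => gy; apply: Vy.
  by exists (i : nat); [exact: (ltn_ord i)|exact: gy].
have iw2 : rint muh (fun y => w2 y ^+ 2 * \1_VV y).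
  by under eq_fun do rewrite w2_sqr.
have gw i : wint muh w2 (g i) by exact: (wint_supported mVV mw2 w2_ge0 iw2 (g2 i) (@gV i)).
(* By surjectivity each [g i] is the image of some [h i], which agrees almost everywhere with [f i];
   the isometry then gives [f] and [g] the same Gram matrix. *)
have [h hP] : exists h : 'I_N -> Omega -> R[i], forall i,
    sqint mu (h i) /\ {ae muh, forall y, T (h i) y = g i y}.
  have /choice[h hP] : forall i, exists h, sqint mu h /\ {ae muh, forall y, T h y = g i y}.
    by move=> i; have [h h2 Th] := T_onto (g2 i); exists h.
  by exists h.
have h2 i : sqint mu (h i) by case: (hP i).
have Th i : {ae muh, forall y, T (h i) y = g i y} by case: (hP i).
have hf i : {ae mu, forall x, h i x = f i x} by exact: T_inv.
have mf i : cmeasurable (f i) by exact: (kop_cmeasurable muh mK' (proj1 (g2 i))).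
have f2 i : sqint mu (f i).
  split => //; apply: (ae_rint _ _ (proj2 (h2 i))).
    exact: measurable_cdot.
  by apply: filterS (hf i) => x ->.
have fg i j : rip mu (f i) (f j) = rip muh (g i) (g j).
  rewrite -(rip_ae (proj1 (h2 i)) (mf i) (proj1 (h2 j)) (mf j) (hf i) (hf j)).
  rewrite -T_rip//; apply: rip_ae => //; first by have [] := T_sqint (h2 i).
  - by have [] := g2 i.
  - by have [] := T_sqint (h2 j).
  - by have [] := g2 j.
have gfree v : {ae muh, forall y, \sum_i (v i)%:C%C * g i y = 0} -> forall i, v i = 0.
  exact: (dilates_free a_gt0 muh_dil (proj1 q2) l01 Vfin V0).
have fU i x : ~ UU x -> f i x = 0.
  move=> Ux; rewrite /f (adj_kop_dil _ (scalesX_gt0 n i) qw) -/(p _).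
  have -> : p (dil (l ^+ i)^-1 x) = 0.
    apply: contrapT => px; apply: Ux.
    by exists (i : nat); [exact: (ltn_ord i)|exact: px].
  by rewrite mulr0.
pose BV := wset muh (2 * mh) VV.
have BV0 : 0 <= BV by exact: wset_ge0.
(* The real pairings of [g i] with the truncated kernel and with i times it are the real and the
   imaginary part of [f i x]. *)
pose k x y : R[i] := K x y * (\1_VV y)%:C%C.
pose k' x y : R[i] := 'i%C * (K x y * (\1_VV y)%:C%C).
have mk x : cmeasurable (k x).
  apply: cmeasurableM; last by apply: cmeasurable_real; exact: measurable_indic.
  have [rK jK] := mK.
  by split; [exact: (measurableT_comp rK (measurable_pair1 x))|
             exact: (measurableT_comp jK (measurable_pair1 x))].
have mk' x : cmeasurable (k' x).
  apply: cmeasurableM; last exact: mk.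
  by split; exact: measurable_cst.
have kle x y : cdot (k x y) (k x y) <= w1 x ^+ 2 * (weight (2 * mh) y * \1_VV y).
  rewrite -sqr_normc Normc.normcM Normc_real exprMn mulrA -w2_sqr.
  have -> : `|\1_VV y| ^+ 2 = \1_VV y :> R.
    by rewrite indicE; case: (_ \in _); rewrite ?normr1 ?normr0 ?expr1n ?expr0n.
  rewrite ler_wpM2r// -exprMn lerXn2r ?nnegrE ?normc_ge0// mulr_ge0//.
have k'E x y : cdot (k' x y) (k' x y) = cdot (k x y) (k x y).
  by rewrite /k' /k; case: (K x y * _) => u v; rewrite /cdot /=; ring.
have ik x : rint muh (fun y => w1 x ^+ 2 * (weight (2 * mh) y * \1_VV y)).
  exact: rintZ.
have k2 x : sqint muh (k x).
  split => //; apply: (rint_dom _ (ik x)); first exact: measurable_cdot.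
  by move=> y; rewrite ger0_norm ?cdot_ge0.
have k'2 x : sqint muh (k' x).
  split => //; under eq_fun do rewrite k'E.
  by case: (k2 x).
have krip x : rip muh (k x) (k x) <= w1 x ^+ 2 * BV.
  rewrite /BV /wset -RintegralZl//; apply: le_Rintegral => //.
  - by case: (k2 x).
  - exact: ik.
have k'rip x : rip muh (k' x) (k' x) <= w1 x ^+ 2 * BV.
  by rewrite (_ : rip muh (k' x) (k' x) = rip muh (k x) (k x))//; exact: eq_Rintegral.
have fRe i x : complex.Re (f i x) = rip muh (g i) (k x).
  rewrite ReE_cdot (kop_cdot mK' Kw' _ _ (gw i)); apply: eq_Rintegral => y _.
  rewrite /adjK conjcK mul1r /k indicE; have [_|/negP Vy] := boolP (y \in VV).
    by rewrite mulr1.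
  by rewrite gV ?cdot0l// => Vy'; apply: Vy; exact/mem_set.
have fIm i x : complex.Im (f i x) = rip muh (g i) (k' x).
  rewrite ImE_cdot (kop_cdot mK' Kw' _ _ (gw i)); apply: eq_Rintegral => y _.
  rewrite /adjK conjcK /k' indicE; have [_|/negP Vy] := boolP (y \in VV).
    by rewrite mulr1.
  by rewrite gV ?cdot0l// => Vy'; apply: Vy; exact/mem_set.
have wE x : w1 x ^+ 2 * BV * \1_UU x = cT ^+ 2 * BV * (weight (2 * m) x * \1_UU x).
  by rewrite w1_sqr; ring.
have iw1 : rint mu (fun x => w1 x ^+ 2 * BV * \1_UU x).
  by under eq_fun do rewrite wE; exact: rintZ.
have := hilbert_schmidt_dim f2 g2 gfree fg iw1 (fun x _ => k2 x) (fun x _ => k'2 x)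
  (fun x _ => krip x) (fun x _ => k'rip x) (fun i x _ => fRe i x) (fun i x _ => fIm i x) fU.
apply/negP; rewrite -ltNge; apply: le_lt_trans NE.
under eq_Rintegral do rewrite wE.
rewrite RintegralZl// ler_wpM2l//; apply: ler_pM => //.
- by apply: mulr_ge0 => //; exact: sqr_ge0.
- exact: wset_ge0.
- by rewrite ler_wpM2l// sqr_ge0.
Qed.

Lemma uncertainty (S : set Omega) (Sigma : set Omegah) (f : Omega -> R[i]) :
  measurable S -> measurable Sigma ->
  (weighted mu (2 * m) S < +oo)%E -> (weighted muh (2 * mh) Sigma < +oo)%E ->
  sqint mu f -> {ae mu, forall x, ~ S x -> f x = 0} ->
  {ae muh, forall xi, ~ Sigma xi -> T f xi = 0} -> {ae mu, forall x, f x = 0}.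
Proof.
move=> mS mSigma /(rint_weightP _ _ mS) iS /(rint_weightP _ _ mSigma) iSigma f2 fS TfS.
(* The truncation vanishes everywhere outside [S], not just almost everywhere, so [wint_supported]
   makes it integrable against [w1]. *)
pose f1 x := f x * (\1_S x)%:C%C.
have mf1 : cmeasurable f1.
  apply: cmeasurableM; first by case: f2.
  by apply: cmeasurable_real; exact: measurable_indic.
have ff1 : {ae mu, forall x, f x = f1 x}.
  apply: filterS fS => x fS; rewrite /f1 indicE.
  have [_|/negP xS] := boolP (x \in S); first by rewrite mulr1.
  by rewrite fS ?mul0r// => Sx; apply: xS; exact/mem_set.
have f12 : sqint mu f1.
  split => //; apply: (ae_rint _ _ (proj2 f2)); first exact: measurable_cdot.
  by apply: filterS ff1 => x ->.
have f1S x : ~ S x -> f1 x = 0.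
  by move=> Sx; rewrite /f1 indicE memNset// mulr0.
have f1w : wint mu w1 f1.
  apply: (wint_supported mS mw1 w1_ge0 _ f12 f1S).
  rewrite (_ : (fun x => _) = (fun x => cT ^+ 2 * (weight (2 * m) x * \1_S x))).
    exact: rintZ.
  by apply/funext => x; rewrite w1_sqr mulrA.
pose q := kop mu K f1.
have mq : cmeasurable q by exact: (kop_cmeasurable mu mK mf1).
have Tq : {ae muh, forall y, T f1 y = q y} by exact: T_kop.
have q2 : sqint muh q.
  split => //; have [_ h] := T_sqint f12.
  apply: (ae_rint _ _ h); first exact: measurable_cdot.
  by apply: filterS Tq => y ->.
have TT : {ae muh, forall y, T f y = T f1 y}.
  by apply: (ue_ae_eq T_ext) ff1; apply/cLfun2P.
pose V := [set y | q y <> 0].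
have mV : measurable V by exact: measurable_cneq0.
have iV : rint muh (fun y => weight (2 * mh) y * \1_V y).
  apply: (rint_weight_ae_subset mSigma mV _ iSigma).
  apply: filterS3 Tq TT TfS => y Tqy TTy h /h; rewrite TTy Tqy => qy Vy.
  exact: Vy qy.
have qw : wint muh w2 q.
  apply: (wint_supported mV mw2 w2_ge0 _ q2); last by move=> y /contrapT.
  by under eq_fun do rewrite w2_sqr.
pose p := kop muh (adjK K) q.
have fp : {ae mu, forall x, f1 x = p x} by exact: T_inv.
pose U := [set x | p x <> 0].
have mU : measurable U.
  by apply: measurable_cneq0; exact: (kop_cmeasurable muh mK' mq).
have iU : rint mu (fun x => weight (2 * m) x * \1_U x).
  apply: (rint_weight_ae_subset mS mU _ iS).
  by apply: filterS fp => x fp /f1S; rewrite fp => px Ux; exact: Ux px.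
(* The weight is at least 1 because its exponent is nonnegative, so finite weight gives finite
   measure. *)
have Vfin : (muh V < +oo)%E.
  have : rint muh (fun y => \1_V y : R).
    apply: (rint_dom _ iV) => [|y]; first exact: measurable_indic.
    rewrite ger0_norm// ler_peMl// /weight.
    rewrite -[leLHS](powRr0 (1 + enorm (cone_val y))); apply: ler_powR.
      by rewrite lerDl sqrtr_ge0.
    by rewrite mulr_ge0.
  by move=> /integrable_lty; rewrite integral_indic// setIT; exact.
have V0 := uncertainty_pair q2 qw (kop_radially_open f1w) mU mV iU iV Vfin.
have q0 : {ae muh, forall y, q y = 0}.
  by exists V; split => // y.
(* The image of [f1] vanishes almost everywhere, and the isometry carries this back to [f1]. *)
have f10 : {ae mu, forall x, f1 x = 0}.
  apply: rip_eq0 => //; rewrite -T_iso//.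
  rewrite (_ : rip muh _ _ = rip muh (fun=> 0) (fun=> 0)).
    rewrite /rip; under eq_Rintegral do rewrite cdot0l.
    by rewrite Rintegral_cst// mul0r.
  have Tf10 : {ae muh, forall y, T f1 y = 0} by apply: filterS2 Tq q0 => y ->.
  have [mT _] := T_sqint f12.
  by apply: rip_ae => //; exact: cmeasurable0.
by apply: filterS2 ff1 f10 => x ->.
Qed.

End uncertainty.

Theorem theorem3p5 (R : realType) (d : nat) (d_gt0 : (0 < d)%N)
  (Omega Omegah : convex_cone R d)
  (mu : {measure set Omega -> \bar R}) (muh : {measure set Omegah -> \bar R})
  (mu_ac : lebesgue_abs_continuous mu) (muh_ac : lebesgue_abs_continuous muh)
  (a ah : R) (Q Qh : 'rV[R]_d -> R)
  (mu_polar : polar_decomposition mu a Q)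
  (muh_polar : polar_decomposition muh ah Qh)
  (ah_eq : ah = a) (a_gt0 : 0 < a)
  (K : Omega -> Omegah -> R[i]) (cT m mh : R)
  (m_ge0 : 0 <= m) (mh_ge0 : 0 <= mh)
  (K_continuous : kernel_continuous K)
  (K_bounded : kernel_bounded K cT m mh)
  (K_homogeneous : kernel_homogeneous K)
  (T_inversion : inversion_formula mu muh K m mh)
  (T_plancherel : plancherel mu muh K)
  (T : (Omega -> R[i]) -> (Omegah -> R[i]))
  (T_extension : unique_unitary_extension mu muh K T)
  (S : set Omega) (Sigma : set Omegah)
  (S_meas : measurable S) (Sigma_meas : measurable Sigma)
  (S_gt0 : (0 < weighted mu (2 * m) S)%E)
  (S_fin : (weighted mu (2 * m) S < +oo)%E)
  (Sigma_gt0 : (0 < weighted muh (2 * mh) Sigma)%E)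
  (Sigma_fin : (weighted muh (2 * mh) Sigma < +oo)%E)
  (f : Omega -> R[i]) (f_L2 : cLfun mu 2%:E f)
  (f_supp : {ae mu, forall x, ~ S x -> f x = 0})
  (Tf_supp : {ae muh, forall xi, ~ Sigma xi -> T f xi = 0}) :
  {ae mu, forall x, f x = 0}.
Proof.
subst ah; have [T_ext _] := T_extension.
(* The polar decompositions are turned into the scaling law, the finite mass of an annulus and the
   nullity of the origin, which together make Gaussians integrable against any weight. *)
have mu_dil := measure_dil mu_polar.
have muh_dil := measure_dil muh_polar.
have mu_gauss := gauss_integrable a_gt0 mu_dil (annulus_finite mu_polar)
  (measure_origin mu_polar).
have muh_gauss := gauss_integrable a_gt0 muh_dil (annulus_finite muh_polar)
  (measure_origin muh_polar).
(* Both measures are replaced by equal ones whose type records sigma-finiteness. *)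
have [nu nuE] := sigma_finite_measure_pack (homogeneous_sigma_finite a_gt0 mu_dil
  (annulus_finite mu_polar) (measure_origin mu_polar)).
have [nuh nuhE] := sigma_finite_measure_pack (homogeneous_sigma_finite a_gt0 muh_dil
  (annulus_finite muh_polar) (measure_origin muh_polar)).
subst mu muh.
move/cLfun2P : f_L2 => f2.
exact: (uncertainty a_gt0 mu_dil muh_dil mu_gauss muh_gauss m_ge0 mh_ge0 K_continuous
  K_bounded K_homogeneous T_ext S_meas Sigma_meas S_fin Sigma_fin f2 f_supp Tf_supp).
Qed.
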